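(* Let $\Omega\subset\mathbb C^n$ be open and let $\Phi:\Omega\to\mathbb R$ be real-analytic and strictly plurisubharmonic. The operator $\Pi_{\mathcal C,\chi}$ defined in the context has the following properties. (1) Continuity: $\Pi_{\mathcal C,\chi}:L^2_{\Phi,\mathrm{loc}}(\Omega)\to L^2_{\Phi,\mathrm{loc}}(\Omega)$ is uniformly properly supported and uniformly continuous. (2) Self-adjointness: $\Pi_{\mathcal C,\chi}=\Pi_{\mathcal C,\chi}^*$. (3) Exponential localization: if $K\subset\Omega$ is closed, there exists $\Phi_2\in C^0(\Omega;\mathbb R)$ with $\Phi_2\le\Phi$ on $\Omega$ and $\Phi_2<\Phi$ on $\Omega\setminus K$ such that $$\Pi_{\mathcal C,\chi}=\mathcal O(1):L^2_{\Phi,\mathrm{loc}}(K)\to L^2_{\Phi_2,\mathrm{loc}}(\Omega),$$ where $L^2_{\Phi,\mathrm{loc}}(K):=\{u\in L^2_{\Phi,\mathrm{loc}}(\Omega):\operatorname{supp}u\subset K\}$.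
   Context: General notation. $0<\hbar\le1$ is a semiclassical parameter; functions, symbols and operators may depend on $\hbar$; constants are independent of $\hbar$. $L(\mathrm dx)$ is Lebesgue measure. $\mathcal V(x_0)$: open neighbourhoods of $x_0$; $K\Subset\Omega$: $\overline K$ compact in $\Omega$; $\overline\Omega:=\{\bar x:x\in\Omega\}$ (complex conjugates). Weighted spaces. For $\Phi\in C^0(\Omega;\mathbb R)$: $L^2_\Phi(\Omega)=L^2(\Omega;e^{-2\Phi/\hbar}L(\mathrm dx))$; $H_\Phi(\Omega)=\mathrm{Hol}(\Omega)\cap L^2_\Phi(\Omega)$; $L^2_{\Phi,\mathrm{loc}}(\Omega)$ is $L^2_{\mathrm{loc}}(\Omega)$ with the seminorms $\|u\|_{L^2_\Phi(\tilde\Omega)}$, $\tilde\Omega\Subset\Omega$. A linear $A=A_\hbar:L^2_{\Phi_1,\mathrm{loc}}(\Omega_1)\to L^2_{\Phi_2,\mathrm{loc}}(\Omega_2)$ is uniformly continuous, written $A=\mathcal O(1)$, if there is $\hbar_0>0$ such that for every $\tilde\Omega_2\Subset\Omega_2$ there are $\tilde\Omega_1\Subset\Omega_1$ and $C>0$ independent of $\hbar$ with $\|Au\|_{L^2_{\Phi_2}(\tilde\Omega_2)}\le C\|u\|_{L^2_{\Phi_1}(\tilde\Omega_1)}$ for all $u$ and all $\hbar\in]0,\hbar_0]$ (analogously when the domain is a subspace). $A$ with distribution kernel $K_A$ on $\Omega_2\times\Omega_1$ is uniformly properly supported if there is $\hbar_0>0$ such that for every $\tilde\Omega_2\Subset\Omega_2$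 there is an $\hbar$-independent $\tilde\Omega_1\Subset\Omega_1$ with $\{y:\exists x\in\tilde\Omega_2,(x,y)\in\operatorname{supp}K_A\}\subset\tilde\Omega_1$ for all $\hbar\in]0,\hbar_0]$, and the same with the two factors exchanged. $A^*$ denotes the formal adjoint with respect to $(u|v)_{L^2_\Phi}=\int u\bar v\,e^{-2\Phi/\hbar}L(\mathrm dx)$. Formal analytic symbols and Brg quantization. A formal classical analytic symbol is a formal series $\sum_{j\ge0}a_j\hbar^j$, $a_j$ holomorphic, such that on each compact set $K$, $\sup_K|a_j|\le C_K^{j+1}j^j$ ($0^0=1$); a classical analytic symbol with this expansion is a holomorphic $a_\hbar$, locally bounded uniformly in $\hbar$, with $\sup_K|a_\hbar-\sum_{j<N}a_j\hbar^j|\le\hbar^NC_K^{N+1}N^N$ for all $N\ge 0$. $\psi(x,w)$ is the holomorphic function near $\mathrm{adiag}=\{(x,\bar x):x\in\Omega\}$ with $\psi(x,\bar x)=\Phi(x)$. Near $x_0\in\Omega$, for small $r>0$, $[\mathrm{Op}^{\mathrm{Brg}}(a_\hbar)u](x)=\frac{2^n}{(\pi\hbar)^n}\int_{|y-x|<r}e^{\frac2\hbar(\psi(x,\bar y)-\Phi(y))}a_\hbar(x,\bar y)\det(\partial^2_{x,w}\psi)(x,\bar y)u(y)L(\mathrm dy)$, which for holomorphic $u$ is holomorphic near $x_0$ up to errors $O(e^{(\Phi-c)/\hbar})$, $c>0$, and is independent of small $r$ modulo such errors. There is a unique formal classical analytic symbol $\sum_ja_j(x,w)\hbar^j$ on a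 neighbourhood of adiag such that for every $x_0\in\Omega$, $\mathrm{Op}^{\mathrm{Brg}}(a_\hbar)$ equals the identity modulo a negligible operator at $x_0$, where $a_\hbar$ is a classical analytic symbol near $(x_0,\bar x_0)$ with this expansion (negligible at $x_0$: for every sufficiently small $\Omega_1\in\mathcal V(x_0)$ there are $\Omega_2\in\mathcal V(x_0)$ and a continuous $\Phi_2<\Phi$ on $\Omega_2$ such that the operator is bounded $H_\Phi(\Omega_1)\to H_{\Phi_2}(\Omega_2)$ uniformly as $\hbar\to0$). It satisfies $a_j(x,\bar y)=\overline{a_j(y,\bar x)}$. The operator $\Pi_{\mathcal C,\chi}$. Fix a neighbourhood $\Omega^{(2)}\subset\Omega\times\overline\Omega$ of adiag, invariant under $(x,\bar y)\mapsto(y,\bar x)$, on which $\psi$ and all $a_j$ are defined, and sufficiently close to adiag (so that the projections of closed subsets of $\Omega\times\overline\Omega$ contained in $\Omega^{(2)}$ to the two factors are proper, and $\Phi(x)+\Phi(y)-2\mathrm{Re}\,\psi(x,\bar y)\asymp|x-y|^2$ locally uniformly). Let $\mathcal C\in C^\infty(\Omega^{(2)};]0,\infty[)$ satisfy $\mathcal C(x,\bar y)=\mathcal C(y,\bar x)$ and $|a_j|\le\mathcal C^{j+1}j^j$ on $\Omega^{(2)}$ for all $j$. Let $\theta\in C_0^\infty([0,1[;[0,1])$ equal $1$ on $[0,\frac12]$ and $a_{\mathcal C}(x,w;\hbar)=\sum_{j\ge0}\theta(j\hbar\,\mathcal C(x,w))a_j(x,w)\hbar^j$. Let $\chi\in C^\infty(\Omega\times\overline\Omega;\mathbb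 R)$ satisfy $\chi(x,\bar y)=\chi(y,\bar x)$, be supported in $\Omega^{(2)}$ and equal $1$ near adiag. Then $$(\Pi_{\mathcal C,\chi}u)(x)=\frac{2^n}{(\pi\hbar)^n}\int_\Omega e^{\frac2\hbar(\psi(x,\bar y)-\Phi(y))}a_{\mathcal C}(x,\bar y;\hbar)\,u(y)\,\chi(x,\bar y)\det(\partial^2_{x,w}\psi)(x,\bar y)\,L(\mathrm dy).$$ *)

(* Defs.v *)
Set Warnings "-all".
From HB Require Import structures.
From mathcomp Require Import all_boot all_order all_algebra.
From mathcomp Require Import all_classical all_reals all_analysis.
From mathcomp Require Import complex.
Set Implicit Arguments.
Unset Strict Implicit.
Unset Printing Implicit Defensive.
Import Order.TTheory GRing.Theory Num.Theory.
Import numFieldNormedType.Exports.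
Local Open Scope classical_set_scope.
Local Open Scope ring_scope.
Local Open Scope complex_scope.

(* Topology of R[i]; with it, [differentiable] and ['D_v] on 'rV[R[i]]_n
   are complex (Frechet, directional) derivatives. *)
HB.instance Definition _ (R : realType) := NormedModule.copy R[i] (R[i]^o).

Notation "''Cn[' R ]_ n" := 'rV[R[i]]_n
  (at level 8, n at level 2, format "''Cn[' R ]_ n") : type_scope.

(* The library's sigma-finite instance on [m1 \x m2] is shadowed by its
   subprobability instance; [sfprod] is [m1 \x m2] with that instance. *)
Section sfprod.
Local Open Scope ereal_scope.
Context d1 d2 (T1 : measurableType d1) (T2 : measurableType d2) (R : realType).
Variable m1 : {sigma_finite_measure set T1 -> \bar R}.
Variable m2 : {sigma_finite_measure set T2 -> \bar R}.

Definition sfprod : set (T1 * T2) -> \bar R := m1 \x m2.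

HB.instance Definition _ := Measure.on sfprod.

Lemma sfprod_sigma_finite : sigma_finite setT sfprod.
Proof.
have /sigma_finiteP[F [TF ndF Foo]] := sigma_finiteT m1.
have /sigma_finiteP[G [TG ndG Goo]] := sigma_finiteT m2.
exists (fun n => F n `*` G n).
 rewrite -setXTT TF TG predeqE => -[x y]; split.
    move=> [/= [n _ Fnx] [k _ Gky]]; exists (maxn n k) => //; split.
    - by move: x Fnx; exact/subsetPset/ndF/leq_maxl.
    - by move: y Gky; exact/subsetPset/ndG/leq_maxr.
  by move=> [n _ []/= ? ?]; split; exists n.
move=> k; have [? ?] := Foo k; have [? ?] := Goo k.
split; first exact: measurableX.
by rewrite /sfprod product_measure1E// lte_mul_pinfty// ge0_fin_numE.
Qed.

HB.instance Definition _ := Measure_isSigmaFinite.Build _ _ _ sfprod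
  sfprod_sigma_finite.

End sfprod.

Section cons_measure.
Local Open Scope ereal_scope.
Context d (T : measurableType d) (R : realType) (n : nat).
Variable mu : {sigma_finite_measure set T -> \bar R}.
Variable nu : {sigma_finite_measure set (n.-tuple T) -> \bar R}.

Definition tuple_cons (p : T * n.-tuple T) : n.+1.-tuple T :=
  [the n.+1.-tuple T of p.1 :: p.2].

Lemma measurable_tuple_cons : measurable_fun setT tuple_cons.
Proof. exact: measurable_cons. Qed.

Definition cons_measure : set (n.+1.-tuple T) -> \bar R :=
  pushforward (sfprod mu nu) tuple_cons.

Let cons_measure0 : cons_measure set0 = 0.
Proof. by rewrite /cons_measure /pushforward preimage_set0 measure0. Qed.

Let cons_measure_ge0 A : 0 <= cons_measure A.
Proof. by rewrite /cons_measure /pushforward; exact: measure_ge0. Qed.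

Let cons_measure_sigma_additive : semi_sigma_additive cons_measure.
Proof.
move=> F mF tF mUF; rewrite /cons_measure /pushforward preimage_bigcup.
have mp A : measurable A -> measurable (tuple_cons @^-1` A).
  by move=> mA; rewrite -[X in measurable X]setTI; exact: measurable_tuple_cons.
apply: measure_semi_sigma_additive.
- by move=> k; exact: mp.
- apply/trivIsetP => /= i j _ _ ij; rewrite -preimage_setI.
  by move/trivIsetP : tF => /(_ _ _ _ _ ij) ->//; rewrite preimage_set0.
- by rewrite -preimage_bigcup; exact: mp.
Qed.

HB.instance Definition _ := isMeasure.Build _ _ _ cons_measure
  cons_measure0 cons_measure_ge0 cons_measure_sigma_additive.

Let cons_measure_sigma_finite : sigma_finite setT cons_measure.
Proof.
have [F TF Foo] := sigma_finiteT (sfprod mu nu).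
pose uncons (t : n.+1.-tuple T) : T * n.-tuple T := (thead t, [tuple of behead t]).
have muncons : measurable_fun setT uncons.
  apply/measurable_fun_pairP; split; last exact: measurable_behead.
  exact: measurable_tnth.
have unconsK p : uncons (tuple_cons p) = p.
  case: p => x t; rewrite /uncons /tuple_cons /= theadE; congr (_, _).
  by apply/val_inj.
exists (fun k => uncons @^-1` F k).
  by rewrite -preimage_bigcup -TF.
move=> k; have [mF Fk] := Foo k; split.
  by rewrite -[X in measurable X]setTI; exact: muncons.
rewrite /cons_measure /pushforward -comp_preimage.
by rewrite (_ : uncons \o tuple_cons = id)//; apply/funext => p /=.
Qed.

HB.instance Definition _ := Measure_isSigmaFinite.Build _ _ _ cons_measure
  cons_measure_sigma_finite.

End cons_measure.

Fixpoint power_measure d (T : measurableType d) (R : realType)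
    (mu : {sigma_finite_measure set T -> \bar R}) (n : nat) :
    {sigma_finite_measure set (n.-tuple T) -> \bar R} :=
  if n is m.+1 then cons_measure mu (power_measure mu m)
  else dirac [tuple].

Notation R2 R := (measurableTypeR R * measurableTypeR R)%type.

Definition lebesgueCn (R : realType) (n : nat) :
    {sigma_finite_measure set (n.-tuple (R2 R)) -> \bar R} :=
  power_measure (sfprod (@lebesgue_measure R) (@lebesgue_measure R)) n.

Section Cn.
Context {R : realType} {n : nat}.
Implicit Types (x y v : 'Cn[R]_n) (p : 'Cn[R]_n * 'Cn[R]_n).

(* C^n is identified with (R * R)^n; all measure theory on C^n is transported
   through this bijection. *)
Definition of_tuple (t : n.-tuple (R2 R)) : 'Cn[R]_n :=
  \row_j ((tnth t j).1 +i* (tnth t j).2).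

Definition conjv x : 'Cn[R]_n := map_mx conjc x.

Definition enorm x : R :=
  Num.sqrt (\sum_(j < n) (complex.Re (x ord0 j) ^+ 2 + complex.Im (x ord0 j) ^+ 2)).

(* (x, conj y) |-> (y, conj x) *)
Definition swap p : 'Cn[R]_n * 'Cn[R]_n := (conjv p.2, conjv p.1).

Definition bidomain (Omega : set 'Cn[R]_n) : set ('Cn[R]_n * 'Cn[R]_n) :=
  [set p | Omega p.1 /\ Omega (conjv p.2)].

Definition adiag (Omega : set 'Cn[R]_n) : set ('Cn[R]_n * 'Cn[R]_n) :=
  [set p | Omega p.1 /\ p.2 = conjv p.1].

(* The relatively compact subsets used in the seminorms are taken open, which
   makes them measurable and defines the same seminorm topology. *)
Definition relcompact (U Omega : set 'Cn[R]_n) : Prop :=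
  [/\ open U, compact (closure U) & closure U `<=` Omega].

End Cn.

Definition cexp {R : realType} (z : R[i]) : R[i] :=
  (expR (complex.Re z))%:C * (cos (complex.Im z) +i* sin (complex.Im z)).

Section regularity.
Context {R : realType}.

Definition holomorphic_on (V : normedModType R[i]) (U : set V) (f : V -> R[i]) :=
  forall x, U x -> differentiable f x.

(* Derivative of a real function along the real line x + R v. *)
Definition rderiv (V : normedModType R[i]) (v : V) (f : V -> R) (x : V) : R :=
  derive1 (fun t : R => f (x + t%:C *: v)) 0.

(* C^k on an open set U, with respect to the underlying real structure *)
Fixpoint Ck (V : normedModType R[i]) (k : nat) (U : set V) (f : V -> R) : Prop :=
  (forall x, U x -> {for x, continuous f}) /\
  if k is k'.+1 then
    forall v : V,
      (forall x, U x -> derivable (fun t : R => f (x + t%:C *: v)) 0 1) /\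
      Ck k' U (rderiv v f)
  else True.

Definition smooth_on (V : normedModType R[i]) (U : set V) (f : V -> R) : Prop :=
  forall k, Ck k U f.

Context {n : nat}.
Implicit Types (x v h : 'Cn[R]_n) (f : 'Cn[R]_n -> R) (g : 'Cn[R]_n -> R[i]).

Definition real_coord h (i : 'I_n * bool) : R :=
  if i.2 then complex.Im (h ord0 i.1) else complex.Re (h ord0 i.1).

Definition real_monomial (alpha : {ffun 'I_n * bool -> nat}) h : R :=
  \prod_i real_coord h i ^+ alpha i.

(* f is the sum of an absolutely convergent power series in the 2n real
   coordinates; the partial sums run over the multi-indices with entries < N. *)
Definition real_analytic_at f x : Prop :=
  exists (c : {ffun 'I_n * bool -> nat} -> R) (r : R), 0 < r /\
  let trunc N (alpha : {ffun 'I_n * bool -> 'I_N}) : {ffun 'I_n * bool -> nat} :=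
    [ffun i => nat_of_ord (alpha i)] in
  forall h, enorm h < r ->
    (exists M : R, forall N,
       \sum_(alpha : {ffun 'I_n * bool -> 'I_N})
         `|c (trunc N alpha) * real_monomial (trunc N alpha) h| <= M) /\
    (fun N => \sum_(alpha : {ffun 'I_n * bool -> 'I_N})
         c (trunc N alpha) * real_monomial (trunc N alpha) h) @ \oo --> f (x + h).

Definition crderiv v g x : R[i] :=
  rderiv v (fun y => complex.Re (g y)) x +i* rderiv v (fun y => complex.Im (g y)) x.

Definition d_z (j : 'I_n) g x : R[i] :=
  (crderiv (delta_mx ord0 j) g x - (0 +i* 1) * crderiv ((0 +i* 1) *: delta_mx ord0 j) g x) / 2.

Definition d_zbar (j : 'I_n) g x : R[i] :=
  (crderiv (delta_mx ord0 j) g x + (0 +i* 1) * crderiv ((0 +i* 1) *: delta_mx ord0 j) g x) / 2.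

(* In R[i], [0 < z] means that z is real and positive. *)
Definition strictly_psh_on (Omega : set 'Cn[R]_n) (f : 'Cn[R]_n -> R) : Prop :=
  forall x, Omega x -> forall xi : 'Cn[R]_n, xi != 0 ->
    0 < \sum_(j < n) \sum_(k < n)
          d_z j (d_zbar k (fun y => (f y)%:C)) x * xi ord0 j * conjc (xi ord0 k).

Definition mixed_hessian (psi : 'Cn[R]_n * 'Cn[R]_n -> R[i])
    (p : 'Cn[R]_n * 'Cn[R]_n) : 'M[R[i]]_n :=
  \matrix_(j < n, k < n)
    'D_((delta_mx ord0 j, 0) : 'Cn[R]_n * 'Cn[R]_n)
      (fun q => 'D_((0, delta_mx ord0 k) : 'Cn[R]_n * 'Cn[R]_n) psi q) p.

End regularity.

Section weighted.
Context {R : realType} {n : nat}.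
Implicit Types (Omega U K : set 'Cn[R]_n) (u v : 'Cn[R]_n -> R[i]).
Implicit Types (Phi : 'Cn[R]_n -> R) (h : R).

Definition cintegral U u : R[i] :=
  let D := of_tuple @^-1` U in
  (\int[lebesgueCn R n]_(t in D) complex.Re (u (of_tuple t)))%R +i*
  (\int[lebesgueCn R n]_(t in D) complex.Im (u (of_tuple t)))%R.

Definition cmeasurable_on U u : Prop :=
  let D := of_tuple @^-1` U in
  measurable_fun D (fun t => complex.Re (u (of_tuple t)) : measurableTypeR R) /\
  measurable_fun D (fun t => complex.Im (u (of_tuple t)) : measurableTypeR R).

Definition L2norm Phi h U u : \bar R :=
  sqrte (\int[lebesgueCn R n]_(t in of_tuple @^-1` U)
    (((complex.Re (u (of_tuple t))) ^+ 2 + (complex.Im (u (of_tuple t))) ^+ 2) *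
     expR (- 2 * Phi (of_tuple t) / h))%:E)%E.

(* L^2_loc(Omega), the underlying vector space of L^2_{Phi,loc}(Omega) for
   every continuous Phi; classes are represented by Borel functions. *)
Definition L2loc Omega : set ('Cn[R]_n -> R[i]) :=
  [set u | cmeasurable_on Omega u /\
     forall U, relcompact U Omega -> (L2norm (fun=> 0%R) 1%R U u < +oo)%E].

Definition H_space Phi h Omega : set ('Cn[R]_n -> R[i]) :=
  [set u | holomorphic_on Omega u /\ (L2norm Phi h Omega u < +oo)%E].

(* support, in Omega, of the class of u modulo null sets *)
Definition esupp Omega u : set 'Cn[R]_n :=
  [set x | Omega x /\ forall U, open U -> U x ->
     ~ {ae lebesgueCn R n, forall t,
          (Omega `&` U) (of_tuple t) -> u (of_tuple t) = 0}].

(* L^2_{Phi,loc}(K), for K a closed subset of Omega *)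
Definition L2loc_supp Omega K : set ('Cn[R]_n -> R[i]) :=
  [set u | L2loc Omega u /\ esupp Omega u `<=` K].

(* A = O(1) : D -> L^2_{Phi2,loc}(Omega2), where D is a subspace of
   L^2_{Phi1,loc}(Omega1) and A depends on h in ]0,1] *)
Definition uniformly_continuous
    (Omega1 : set 'Cn[R]_n) (Phi1 : 'Cn[R]_n -> R) (D : set ('Cn[R]_n -> R[i]))
    (Omega2 : set 'Cn[R]_n) (Phi2 : 'Cn[R]_n -> R)
    (A : R -> ('Cn[R]_n -> R[i]) -> ('Cn[R]_n -> R[i])) : Prop :=
  [/\ forall h u, 0 < h <= 1 -> D u -> L2loc Omega2 (A h u),
      forall h (c : R[i]) u v, 0 < h <= 1 -> D u -> D v ->
        {ae lebesgueCn R n, forall t, Omega2 (of_tuple t) ->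
           A h (fun x => c * u x + v x) (of_tuple t) =
           c * A h u (of_tuple t) + A h v (of_tuple t)} &
      exists h0 : R, 0 < h0 <= 1 /\
        forall U2, relcompact U2 Omega2 ->
        exists (U1 : set 'Cn[R]_n) (M : R), relcompact U1 Omega1 /\ 0 < M /\
          forall h u, 0 < h <= h0 -> D u ->
            (L2norm Phi2 h U2 (A h u) <= M%:E * L2norm Phi1 h U1 u)%E].

Definition kernel_operator Omega (K : R -> 'Cn[R]_n -> 'Cn[R]_n -> R[i])
    h u : 'Cn[R]_n -> R[i] :=
  fun x => cintegral Omega (fun y => K h x y * u y).

(* Support in Omega2 x Omega1 of a continuous kernel *)
Definition kernel_supp (Omega2 Omega1 : set 'Cn[R]_n)
    (K : 'Cn[R]_n -> 'Cn[R]_n -> R[i]) : set ('Cn[R]_n * 'Cn[R]_n) :=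
  (Omega2 `*` Omega1) `&`
  closure [set p | (Omega2 `*` Omega1) p /\ K p.1 p.2 != 0].

Definition uniformly_properly_supported (Omega2 Omega1 : set 'Cn[R]_n)
    (K : R -> 'Cn[R]_n -> 'Cn[R]_n -> R[i]) : Prop :=
  exists h0 : R, 0 < h0 <= 1 /\
    (forall U2, relcompact U2 Omega2 -> exists U1, relcompact U1 Omega1 /\
       forall h, 0 < h <= h0 -> forall x y, U2 x ->
         kernel_supp Omega2 Omega1 (K h) (x, y) -> U1 y) /\
    (forall U1, relcompact U1 Omega1 -> exists U2, relcompact U2 Omega2 /\
       forall h, 0 < h <= h0 -> forall x y, U1 y ->
         kernel_supp Omega2 Omega1 (K h) (x, y) -> U2 x).

Definition L2dot Phi h Omega u v : R[i] :=
  cintegral Omega (fun x => u x * conjc (v x) * (expR (- 2 * Phi x / h))%:C).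

(* One of the two functions
   has compact support, so that both pairings converge for properly
   supported A and B. *)
Definition formal_adjoint Omega Phi
    (A B : R -> ('Cn[R]_n -> R[i]) -> ('Cn[R]_n -> R[i])) : Prop :=
  forall h u v, 0 < h <= 1 -> L2loc Omega u -> L2loc Omega v ->
    compact (esupp Omega u) \/ compact (esupp Omega v) ->
    L2dot Phi h Omega (A h u) v = L2dot Phi h Omega u (B h v).

End weighted.

Section Brg.
Context {R : realType} {n : nat}.
Local Notation E2 := ('Cn[R]_n * 'Cn[R]_n)%type.
Implicit Types (Omega : set 'Cn[R]_n) (W : set E2) (Phi : 'Cn[R]_n -> R).
Implicit Types (psi : E2 -> R[i]) (a : nat -> E2 -> R[i]) (h : R).

Definition formal_analytic_symbol W a : Prop :=
  (forall j, holomorphic_on W (a j)) /\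
  (forall K : set E2, compact K -> K `<=` W -> exists M : R, 0 < M /\
     forall j p, K p -> `|a j p| <= (M ^+ j.+1 * j%:R ^+ j)%:C).

Definition analytic_symbol W (b : R -> E2 -> R[i]) a : Prop :=
  [/\ forall h, 0 < h <= 1 -> holomorphic_on W (b h),
      forall K : set E2, compact K -> K `<=` W -> exists M : R,
        forall h p, 0 < h <= 1 -> K p -> `|b h p| <= M%:C &
      forall K : set E2, compact K -> K `<=` W -> exists M : R, 0 < M /\
        forall h N p, 0 < h <= 1 -> K p ->
          `|b h p - \sum_(j < N) a j p * h%:C ^+ j| <=
          (h ^+ N * M ^+ N.+1 * N%:R ^+ N)%:C].

Definition Brg_kernel Phi psi h (x y : 'Cn[R]_n) : R[i] :=
  (2 ^+ n / (pi * h) ^+ n)%:C *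
  cexp ((2 / h)%:C * (psi (x, conjv y) - (Phi y)%:C)) *
  \det (mixed_hessian psi (x, conjv y)).

(* Op^Brg(b), with the integral cut off to |y - x| < r *)
Definition Op_Brg Phi psi (r : R) (b : R -> E2 -> R[i]) h (u : 'Cn[R]_n -> R[i]) :
    'Cn[R]_n -> R[i] :=
  fun x => cintegral [set y | enorm (y - x) < r]
    (fun y => Brg_kernel Phi psi h x y * b h (x, conjv y) * u y).

(* Op^Brg(b), b a symbol on W, is the identity modulo a negligible operator at
   x0. The cut-off radius r is any small enough one, depending on Omega1; as
   Op^Brg(b) u is holomorphic only up to exponentially small errors, the
   difference is measured in L^2_{Phi2}. *)
Definition Brg_identity_at Omega Phi psi W (b : R -> E2 -> R[i])
    (x0 : 'Cn[R]_n) : Prop :=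
  exists Omega0 : set 'Cn[R]_n, [/\ open Omega0, Omega0 x0, Omega0 `<=` Omega &
  forall Omega1 : set 'Cn[R]_n, open Omega1 -> Omega1 x0 -> Omega1 `<=` Omega0 ->
  exists r0 : R, 0 < r0 /\ forall r : R, 0 < r < r0 ->
  exists (Omega2 : set 'Cn[R]_n) (Phi2 : 'Cn[R]_n -> R),
    [/\ open Omega2, Omega2 x0, Omega2 `<=` Omega1,
        forall x y : 'Cn[R]_n, Omega2 x -> enorm (y - x) < r -> Omega1 y /\ W (x, conjv y) &
      [/\ forall x, Omega2 x -> {for x, continuous Phi2},
          forall x, Omega2 x -> Phi2 x < Phi x &
        exists (h0 M : R), 0 < h0 <= 1 /\ 0 < M /\
        forall h u, 0 < h <= h0 -> H_space Phi h Omega1 u ->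
          (L2norm Phi2 h Omega2 (fun x => Op_Brg Phi psi r b h u x - u x)%R
             <= M%:E * L2norm Phi h Omega1 u)%E]]].

(* Op^Brg(a) is the identity modulo negligible operators, for every classical
   analytic symbol with expansion sum_j a_j h^j near a point of adiag *)
Definition Brg_inverts_identity Omega Phi psi W a : Prop :=
  forall x0, Omega x0 -> forall (W' : set E2) (b : R -> E2 -> R[i]),
    open W' -> W' (x0, conjv x0) -> W' `<=` W -> analytic_symbol W' b a ->
    Brg_identity_at Omega Phi psi W' b x0.

(* F(x, conj y) = conj F(y, conj x) *)
Definition hermitian_on W (F : E2 -> R[i]) : Prop :=
  forall p, W p -> F (swap p) = conjc (F p).

(* the projections to the factors of Omega x conj(Omega), restricted to any
   relatively closed set contained in W, are proper *)
Definition proper_projections Omega W : Prop :=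
  forall F : set E2, F `<=` W -> bidomain Omega `&` closure F `<=` F ->
    (forall K : set 'Cn[R]_n, compact K -> K `<=` Omega ->
       compact (F `&` [set p | K p.1])) /\
    (forall K : set 'Cn[R]_n, compact K -> K `<=` [set w | Omega (conjv w)] ->
       compact (F `&` [set p | K p.2])).

(* Phi(x) + Phi(y) - 2 Re psi(x, conj y) ~ |x - y|^2 locally uniformly on W *)
Definition diastasis_equiv Phi psi W : Prop :=
  forall K : set E2, compact K -> K `<=` W -> exists M : R, 0 < M /\
    forall p, K p ->
      let x := p.1 in let y := conjv p.2 in
      let d := Phi x + Phi y - 2 * complex.Re (psi p) in
      M^-1 * enorm (x - y) ^+ 2 <= d /\ d <= M * enorm (x - y) ^+ 2.

(* theta in C_0^oo([0,1[; [0,1]), equal to 1 on [0,1/2]; only the values on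
   [0,+oo[ matter, and smoothness at 0 is implied by theta = 1 on [0,1/2] *)
Definition is_cutoff (theta : R -> R) : Prop :=
  [/\ forall k (t : R), 0 < t -> derivable (derive1n k theta) t 1,
      forall t : R, 0 <= t -> 0 <= theta t <= 1,
      forall t : R, 0 <= t <= 2^-1 -> theta t = 1 &
      exists2 delta : R, delta < 1 & forall t, delta <= t -> theta t = 0].

(* a_C; the sum is finite at each point where [Cc] is positive *)
Definition a_C (theta : R -> R) (Cc : E2 -> R) a h (p : E2) : R[i] :=
  limn (series (fun j => (theta (j%:R * h * Cc p))%:C * a j p * h%:C ^+ j)).

Definition Pi_kernel Phi psi a theta Cc (chi : E2 -> R) h (x y : 'Cn[R]_n) : R[i] :=
  Brg_kernel Phi psi h x y * a_C theta Cc a h (x, conjv y) * (chi (x, conjv y))%:C.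

Definition Pi_op Omega Phi psi a theta Cc (chi : E2 -> R) :
    R -> ('Cn[R]_n -> R[i]) -> ('Cn[R]_n -> R[i]) :=
  kernel_operator Omega (Pi_kernel Phi psi a theta Cc chi).

End Brg.

(* Main.v *)
Require Import Defs.
From HB Require Import structures.
From mathcomp Require Import all_boot all_order all_algebra.
From mathcomp Require Import all_classical all_reals all_analysis.
From mathcomp Require Import complex perm.
From mathcomp Require Import ring lra measurable_realfun.
Set Implicit Arguments.
Unset Strict Implicit.
Unset Printing Implicit Defensive.
Import Order.TTheory GRing.Theory Num.Theory.
Import numFieldNormedType.Exports.
Local Open Scope classical_set_scope.
Local Open Scope ring_scope.
Local Open Scope complex_scope.

(** Off the support of the cut-off the kernel of Pi vanishes, and on it its
    modulus is at most C h^-n e^{(Phi(x) - Phi(y) - D(x,y))/h}, where the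
    diastasis D(x,y) = Phi(x) + Phi(y) - 2 Re psi(x, conj y) is comparable to
    |x - y|^2. So D/2 leaves a Gaussian of mass O(h^n), to which the Schur test
    applies, while the other D/2 can be spent on a weight: the
    inf-convolution delta(x) of D/2 over the points y of K is 1-Lipschitz,
    positive off K and at most D(x,y)/2 for y in K, so that Phi2 = Phi - delta
    gives the exponential localization. Self-adjointness is the Hermitian
    symmetry of the kernel; for the mixed Hessian it uses that the mixed complex
    derivatives of psi are continuous and commute, which is derived from the
    Cauchy integral formula on circles. *)

(** * Goursat's theorem on rectangles *)

(** Holomorphy is given as complex Frechet differentiability at each point, with nothing assumed
    about the derivatives as functions of the point. The kernel contains second derivatives of [psi]
    and must be continuous before measurability or Schur's test can be discussed; hence the
    bisection proof of Goursat's theorem, which asks for no continuity of the partial derivatives.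

    Every constant must be independent of h. Properness of the projections makes the part of the
    support of [chi] over a relatively compact set compact, so all the bounds come from continuity
    on that compact set. The truncated symbol is bounded uniformly in h by a geometric series,
    because [theta] keeps only the terms with j h Cc(p) < delta < 1.

    The infimum of D/2 over the admissible y of K alone may jump in x, since the set of admissible y
    varies with x and may be empty. Letting x move to a nearby z at the price |x - z| is what makes
    the gap function Lipschitz; in return its positivity needs a lower bound on D that is locally
    uniform in the first variable. *)

Section rectangle_integral.
Context {R : realType}.
Implicit Types (P Q : R -> R -> R) (f : R -> R) (a b c d x y p q : R).
Local Notation mu := (@lebesgue_measure R).

(** First-order expansion with gradient (p, q). The l1 norm of the increment is convenient because
    on a rectangle it is at most the sum of the two sides. *)
Definition real_diff_at P x0 y0 p q := forall e : R, 0 < e ->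
  exists2 del, 0 < del & forall x y, `|x - x0| < del -> `|y - y0| < del ->
    `|P x y - P x0 y0 - p * (x - x0) - q * (y - y0) : R| <=
      e * (`|x - x0| + `|y - y0|).

Lemma real_diff_at_ctsl P x0 y0 p q : real_diff_at P x0 y0 p q ->
  {for x0, continuous (P ^~ y0)}.
Proof.
move=> H; apply/cvgrPdist_lt => e e0.
have [del del0 {}H] := H 1 ltr01.
have K0 : 0 < `|p| + 1 by rewrite ltr_wpDl.
near=> x.
have xx0 : `|x - x0| < del.
  by rewrite distrC; near: x; apply: cvgr_dist_lt.
have := H x y0 xx0; rewrite subrr normr0 mulr0 subr0 addr0 mul1r => /(_ del0) {}H.
have : `|x - x0| < e / (`|p| + 1).
  by rewrite distrC; near: x; apply: cvgr_dist_lt => //; rewrite divr_gt0.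
rewrite ltr_pdivlMr// mulrC mulrDl mul1r => {}xx0.
rewrite distrC; apply: le_lt_trans xx0.
rewrite -normrM; apply: le_trans (lerD (lexx _) H).
by apply: le_trans (ler_normD _ _); rewrite le_eqVlt; apply/orP; left; apply/eqP; congr `|_|; ring.
Unshelve. all: by end_near. Qed.

Lemma real_diff_at_ctsr P x0 y0 p q : real_diff_at P x0 y0 p q ->
  {for y0, continuous (P x0)}.
Proof.
move=> H; apply: (@real_diff_at_ctsl (fun y x => P x y) y0 x0 q p) => e e0.
have [del del0 {}H] := H e e0; exists del => // x y xx yy.
by rewrite addrAC (addrC `|_|); exact: H.
Qed.

Lemma cts_integrable f a b : (forall x, a <= x <= b -> {for x, continuous f}) ->
  mu.-integrable `[a, b] (EFin \o f).
Proof.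
move=> cf; apply: continuous_compact_integrable; first exact: segment_compact.
by apply: continuous_in_subspaceT => x; rewrite inE/= in_itv/=; exact: cf.
Qed.

Lemma Rintegral_chasles f a b c : a <= b -> b <= c ->
  mu.-integrable `[a, c] (EFin \o f) ->
  \int[mu]_(x in `[a, c]) f x =
  \int[mu]_(x in `[a, b]) f x + \int[mu]_(x in `[b, c]) f x.
Proof.
move=> ab bc fi.
have := @Rintegral_itvB _ _ _ _ b fi; rewrite !bnd_simp => /(_ ab bc).
rewrite Rintegral_itv_obnd_cbnd => [<-|]; first by rewrite addrC subrK.
by apply: integrableS fi => //; apply: subset_itvr; exact: ab.
Qed.

Lemma Rintegral_near_cst f a b k e : a <= b -> mu.-integrable `[a, b] (EFin \o f) ->
  (forall x, a <= x <= b -> `|f x - k| <= e) ->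
  `|\int[mu]_(x in `[a, b]) f x - k * (b - a)| <= e * (b - a).
Proof.
move=> ab fi fk.
have mab : fine (mu `[a, b]) = b - a.
  rewrite lebesgue_measure_itv/= lte_fin; case: ltP => [//|ba].
  by rewrite (@le_anti _ _ a b) ?subrr// ab ba.
have ik r : mu.-integrable `[a, b] (EFin \o cst r).
  by apply: cts_integrable => x _; exact: cst_continuous.
have mi : measurable (`[a, b]%classic : set (measurableTypeR R)) by [].
have iB : mu.-integrable `[a, b] (EFin \o (fun x => f x - k)).
  exact: (integrableB mi fi (ik k)).
rewrite -mab -!Rintegral_cst// -RintegralB//; last exact: ik.
apply: (le_trans (le_normr_Rintegral _ _)) => //.
apply: (le_Rintegral mi (integrable_norm iB) (ik e)) => x /=.
by rewrite in_itv/=; exact: fk.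
Qed.

End rectangle_integral.

Section goursat.
Context {R : realType}.
Implicit Types (a b c d x y p q r e : R).
Local Notation mu := (@lebesgue_measure R).
Variables (P Q : R -> R -> R) (A B C D : R).
(** The shared number [q] says that the y-derivative of P equals the x-derivative of Q at each
    point: the form P dx + Q dy is closed, in a purely pointwise sense. *)
Hypothesis PQ_closed : forall x y, A <= x <= B -> C <= y <= D ->
  exists p q r, real_diff_at P x y p q /\ real_diff_at Q x y q r.

(** The integral of P dx + Q dy along the boundary of the rectangle, counterclockwise. *)
Let J a b c d : R := \int[mu]_(x in `[a, b]) (P x c - P x d) +
  \int[mu]_(y in `[c, d]) (Q b y - Q a y).

Let iP a b c d : A <= a -> b <= B -> C <= c <= D -> C <= d <= D ->
  mu.-integrable `[a, b] (EFin \o (fun x => P x c - P x d)).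
Proof.
move=> Aa bB hc hd; apply: cts_integrable => x /andP[ax xb].
have hx : A <= x <= B by rewrite (le_trans Aa ax) (le_trans xb bB).
have [p [q [_ [H1 _]]]] := PQ_closed hx hc.
have [p' [q' [_ [H2 _]]]] := PQ_closed hx hd.
exact: continuousB (real_diff_at_ctsl H1) (real_diff_at_ctsl H2).
Qed.

Let iQ a b c d : C <= c -> d <= D -> A <= a <= B -> A <= b <= B ->
  mu.-integrable `[c, d] (EFin \o (fun y => Q b y - Q a y)).
Proof.
move=> Cc dD ha hb; apply: cts_integrable => y /andP[cy yd].
have hy : C <= y <= D by rewrite (le_trans Cc cy) (le_trans yd dD).
have [_ [q [r [_ H1]]]] := PQ_closed ha hy.
have [_ [q' [r' [_ H2]]]] := PQ_closed hb hy.
exact: continuousB (real_diff_at_ctsr H2) (real_diff_at_ctsr H1).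
Qed.

Let J_splitl a m b c d : A <= a -> a <= m -> m <= b -> b <= B ->
  C <= c -> c <= d -> d <= D -> J a b c d = J a m c d + J m b c d.
Proof.
move=> Aa am mb bB Cc cd dD; rewrite /J.
rewrite (Rintegral_chasles am mb); last by apply: iP; lra.
have mi : measurable (`[c, d]%classic : set (measurableTypeR R)) by [].
have i1 : mu.-integrable `[c, d] (EFin \o (fun y => Q b y - Q m y)).
  by apply: iQ; lra.
have i2 : mu.-integrable `[c, d] (EFin \o (fun y => Q m y - Q a y)).
  by apply: iQ; lra.
rewrite [X in _ + X = _](_ : _ = \int[mu]_(y in `[c, d]) ((Q b y - Q m y) + (Q m y - Q a y))).
  by rewrite [X in _ + X = _]RintegralD// [X in _ + X = _]addrC addrACA.
by apply: eq_Rintegral => y _; rewrite addrA subrK.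
Qed.

Let J_splitr a b c m d : A <= a -> a <= b -> b <= B ->
  C <= c -> c <= m -> m <= d -> d <= D -> J a b c d = J a b c m + J a b m d.
Proof.
move=> Aa ab bB Cc cm md dD; rewrite /J.
rewrite [X in _ + X = _](Rintegral_chasles cm md); last by apply: iQ; lra.
have mi : measurable (`[a, b]%classic : set (measurableTypeR R)) by [].
have i1 : mu.-integrable `[a, b] (EFin \o (fun y => P y c - P y m)).
  by apply: iP; lra.
have i2 : mu.-integrable `[a, b] (EFin \o (fun y => P y m - P y d)).
  by apply: iP; lra.
rewrite [X in X + _ = _](_ : _ = \int[mu]_(y in `[a, b]) ((P y c - P y m) + (P y m - P y d))).
  by rewrite [X in X + _ = _]RintegralD// addrACA.
by apply: eq_Rintegral => y _; rewrite addrA subrK.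
Qed.

(** The affine part of a closed form has zero contour integral: constants and the [p] and [r] terms
    cancel between opposite sides, and the two [q] terms are opposite. Only the first-order errors
    remain, at most 2 e times the half perimeter on each pair of sides, times its length. *)
Let J_small x0 y0 p q r e : 0 < e ->
  real_diff_at P x0 y0 p q -> real_diff_at Q x0 y0 q r ->
  exists2 del, 0 < del & forall a b c d, A <= a -> b <= B -> C <= c -> d <= D ->
    a <= x0 <= b -> c <= y0 <= d ->
    b - a < del -> d - c < del -> `|J a b c d| <= 2 * e * (b - a + (d - c)) ^+ 2.
Proof.
move=> e0 hP hQ.
have [d1 d10 {}hP] := hP _ e0; have [d2 d20 {}hQ] := hQ _ e0.
exists (Num.min d1 d2); first by rewrite lt_min d10.
move=> a b c d Aa bB Cc dD hx hy; rewrite !lt_min => /andP[l1 l2] /andP[l3 l4].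
have absle s x1 x2 : x1 <= s <= x2 -> forall t, x1 <= t <= x2 -> `|t - s| <= x2 - x1.
  by move=> hs t ht; rewrite ler_norml; lra.
have H1 : `|\int[mu]_(x in `[a, b]) (P x c - P x d) - (q * (c - d)) * (b - a)|
    <= (2 * e * (b - a + (d - c))) * (b - a).
  apply: Rintegral_near_cst; first lra.
    by apply: iP; lra.
  move=> x xab; have hxx := absle _ _ _ hx x xab.
  have hc := absle _ _ _ hy c; have hd := absle _ _ _ hy d.
  have E1 := hP x c (le_lt_trans hxx l1) (le_lt_trans (hc _) l3).
  have E2 := hP x d (le_lt_trans hxx l1) (le_lt_trans (hd _) l3).
  have {}hc : `|c - y0| <= d - c by apply: hc; lra.
  have {}hd : `|d - y0| <= d - c by apply: hd; lra.
  have {}E1 : `|P x c - P x0 y0 - p * (x - x0) - q * (c - y0)| <= e * (b - a + (d - c)).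
    by apply: le_trans (E1 _) _; [lra|rewrite ler_pM2l// lerD].
  have {}E2 : `|P x d - P x0 y0 - p * (x - x0) - q * (d - y0)| <= e * (b - a + (d - c)).
    by apply: le_trans (E2 _) _; [lra|rewrite ler_pM2l// lerD].
  by move: E1 E2; rewrite !ler_norml; lra.
have H2 : `|\int[mu]_(y in `[c, d]) (Q b y - Q a y) - (q * (b - a)) * (d - c)|
    <= (2 * e * (b - a + (d - c))) * (d - c).
  apply: Rintegral_near_cst; first lra.
    by apply: iQ; lra.
  move=> y ycd; have hyy := absle _ _ _ hy y ycd.
  have ha := absle _ _ _ hx a; have hb := absle _ _ _ hx b.
  have E1 := hQ a y (le_lt_trans (ha _) l2) (le_lt_trans hyy l4).
  have E2 := hQ b y (le_lt_trans (hb _) l2) (le_lt_trans hyy l4).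
  have {}ha : `|a - x0| <= b - a by apply: ha; lra.
  have {}hb : `|b - x0| <= b - a by apply: hb; lra.
  have {}E1 : `|Q a y - Q x0 y0 - q * (a - x0) - r * (y - y0)| <= e * (b - a + (d - c)).
    by apply: le_trans (E1 _) _; [lra|rewrite ler_pM2l// lerD].
  have {}E2 : `|Q b y - Q x0 y0 - q * (b - x0) - r * (y - y0)| <= e * (b - a + (d - c)).
    by apply: le_trans (E2 _) _; [lra|rewrite ler_pM2l// lerD].
  by move: E1 E2; rewrite !ler_norml; lra.
rewrite /J; move: H1 H2.
set I1 := Rintegral _ _ _; set I2 := Rintegral _ _ _.
by rewrite !ler_norml; lra.
Qed.

Let w := B - A.
Let v := D - C.
Let cell n (s : R * R) := J s.1 (s.1 + w / 2 ^+ n) s.2 (s.2 + v / 2 ^+ n).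
Let inside n (s : R * R) := [/\ A <= s.1, s.1 + w / 2 ^+ n <= B, C <= s.2 &
  s.2 + v / 2 ^+ n <= D].

Let cell_step n s : A <= B -> C <= D -> inside n s -> exists s', inside n.+1 s' /\
  [/\ `|cell n.+1 s'| >= `|cell n s| / 4,
    s.1 <= s'.1, s'.1 + w / 2 ^+ n.+1 <= s.1 + w / 2 ^+ n,
    s.2 <= s'.2 & s'.2 + v / 2 ^+ n.+1 <= s.2 + v / 2 ^+ n].
Proof.
case: s => x y AB CD [/= Ax xB Cy yD].
have hw : w / 2 ^+ n = w / 2 ^+ n.+1 + w / 2 ^+ n.+1 by rewrite exprS; field.
have hv : v / 2 ^+ n = v / 2 ^+ n.+1 + v / 2 ^+ n.+1 by rewrite exprS; field.
have w0 : 0 <= w / 2 ^+ n.+1 by rewrite divr_ge0 ?exprn_ge0// subr_ge0.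
have v0 : 0 <= v / 2 ^+ n.+1 by rewrite divr_ge0 ?exprn_ge0// subr_ge0.
rewrite /cell/= hw hv !addrA; rewrite hw addrA in xB; rewrite hv addrA in yD.
move: hw hv w0 v0 xB yD; set w' := w / 2 ^+ n.+1; set v' := v / 2 ^+ n.+1.
move=> _ _ w0 v0 xB yD.
set J0 := J x (x + w' + w') y (y + v' + v').
set J1 := J x (x + w') y (y + v').
set J2 := J x (x + w') (y + v') (y + v' + v').
set J3 := J (x + w') (x + w' + w') y (y + v').
set J4 := J (x + w') (x + w' + w') (y + v') (y + v' + v').
have E : J0 = J1 + J2 + (J3 + J4).
  rewrite /J0 (@J_splitl x (x + w')); [|lra..].
  rewrite (@J_splitr x (x + w') y (y + v')); [|lra..].
  by rewrite (@J_splitr (x + w') (x + w' + w') y (y + v')); [|lra..].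
have /or4P[H|H|H|H] : [|| `|J1| >= `|J0| / 4, `|J3| >= `|J0| / 4,
   `|J2| >= `|J0| / 4 | `|J4| >= `|J0| / 4].
- apply: contraT; rewrite !negb_or -!ltNge => /and4P[+ + + +].
  have := ler_normD (J1 + J2) (J3 + J4).
  have := ler_normD J1 J2; have := ler_normD J3 J4; rewrite -E.
  lra.
- by exists (x, y) => /=; split; split; rewrite /= -?/w' -?/v'; first [exact: H | clear -Ax xB Cy yD w0 v0; lra].
- by exists (x + w', y) => /=; split; split; rewrite /= -?/w' -?/v'; first [exact: H | clear -Ax xB Cy yD w0 v0; lra].
- by exists (x, y + v') => /=; split; split; rewrite /= -?/w' -?/v'; first [exact: H | clear -Ax xB Cy yD w0 v0; lra].
- by exists (x + w', y + v') => /=; split; split; rewrite /= -?/w' -?/v'; first [exact: H | clear -Ax xB Cy yD w0 v0; lra].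
Qed.

Let nested_point (u : nat -> R) (l : R) : 0 <= l -> (forall n, u n <= u n.+1) ->
  (forall n, u n.+1 + l / 2 ^+ n.+1 <= u n + l / 2 ^+ n) ->
  exists x, forall n, u n <= x <= u n + l / 2 ^+ n.
Proof.
move=> l0 u1 u2.
have ln n : 0 <= l / 2 ^+ n by rewrite divr_ge0// exprn_ge0.
have um k n : u n <= u (n + k)%N.
  by elim: k => [|k IH]; rewrite ?addn0// addnS (le_trans IH).
have uM k n : u (n + k)%N + l / 2 ^+ (n + k) <= u n + l / 2 ^+ n.
  by elim: k => [|k IH]; rewrite ?addn0// addnS (le_trans _ IH).
have ub m n : u m <= u n + l / 2 ^+ n.
  case: (leqP n m) => [/subnKC <-|/ltnW/subnKC <-].
    by apply: le_trans (uM (m - n)%N n); rewrite lerDl.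
  by apply: (le_trans (um (n - m)%N m)); rewrite lerDl.
have hs : has_sup (range u).
  by split; [exists (u 0%N); exists 0%N|exists (u 0%N + l / 2 ^+ 0) => _ [m _ <-]; exact: ub].
exists (sup (range u)) => n; apply/andP; split.
  by apply: sup_upper_bound => //; exists n.
by apply: ge_sup; [exact: hs.1|move=> _ [m _ <-]; exact: ub].
Qed.

(* Bisection: if the contour integral were not 0, one quarter of each rectangle
   would carry at least a quarter of it, against first order differentiability
   at the common point of the nested rectangles. *)
Lemma rectangle_closed_form : A <= B -> C <= D ->
  \int[mu]_(x in `[A, B]) (P x C - P x D) +
  \int[mu]_(y in `[C, D]) (Q B y - Q A y) = 0.
Proof.
move=> AB CD; rewrite -/(J A B C D).
have /choice[g gP] : forall ns : nat * (R * R), exists s', inside ns.1 ns.2 ->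
    inside ns.1.+1 s' /\
  [/\ `|cell ns.1.+1 s'| >= `|cell ns.1 ns.2| / 4,
    ns.2.1 <= s'.1, s'.1 + w / 2 ^+ ns.1.+1 <= ns.2.1 + w / 2 ^+ ns.1,
    ns.2.2 <= s'.2 & s'.2 + v / 2 ^+ ns.1.+1 <= ns.2.2 + v / 2 ^+ ns.1].
  case=> n s; have [H|H] := pselect (inside n s); last by exists s.
  by have [s' ?] := cell_step AB CD H; exists s'.
pose s := fix s n := if n is m.+1 then g (m, s m) else (A, C).
have ins n : inside n (s n).
  elim: n => [|n IH]; first by rewrite /inside /= !divr1 /w /v; split; lra.
  by have [] := gP (n, s n) IH.
have [x0 hx] : exists x, forall n, (s n).1 <= x <= (s n).1 + w / 2 ^+ n.
  apply: nested_point => [|n|n]; first by rewrite subr_ge0.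
    by have [_ []] := gP (n, s n) (ins n).
  by have [_ []] := gP (n, s n) (ins n).
have [y0 hy] : exists y, forall n, (s n).2 <= y <= (s n).2 + v / 2 ^+ n.
  apply: nested_point => [|n|n]; first by rewrite subr_ge0.
    by have [_ []] := gP (n, s n) (ins n).
  by have [_ []] := gP (n, s n) (ins n).
have big n : `|J A B C D| / 4 ^+ n <= `|cell n (s n)|.
  elim: n => [|n IH].
    have eB : A + w = B by rewrite /w addrC subrK.
    have eD : C + v = D by rewrite /v addrC subrK.
    by rewrite expr0 divr1 /cell/= !expr0 !divr1 eB eD.
  have [_ [H _ _ _ _]] := gP (n, s n) (ins n).
  apply: le_trans H; rewrite exprSr invfM mulrA ler_pM2r//.
have [p [q [r [hP hQ]]]] : exists p q r, real_diff_at P x0 y0 p q /\ real_diff_at Q x0 y0 q r.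
  by apply: PQ_closed; have := hx 0%N; have := hy 0%N; rewrite /= !divr1 /w /v; lra.
apply/eqP; rewrite -normr_eq0 eq_le normr_ge0 andbT.
apply/ler_addgt0Pr => e e0; rewrite add0r.
(* After n bisections the integral is at least the original divided by 4^n, while [J_small] bounds
   it by a multiple of ((w + v) / 2^n)^2, so the powers of 4 cancel. The added 1 keeps [wv] positive
   for a degenerate rectangle. *)
pose wv := (w + v) ^+ 2 + 1.
have wv0 : 0 < wv by rewrite ltr_wpDl// sqr_ge0.
have e20 : 0 < e / (2 * wv) by rewrite divr_gt0// mulr_gt0.
have [del del0 small] := J_small e20 hP hQ.
have w0 : 0 <= w by rewrite subr_ge0.
have v0 : 0 <= v by rewrite subr_ge0.
have [n hn] : exists n, (w + v) / del < 2 ^+ n.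
  exists (Num.bound ((w + v) / del)).
  apply: lt_le_trans (archi_boundP _) _; first by apply: divr_ge0; [exact: addr_ge0|exact: ltW].
  by rewrite -natrX ler_nat; exact/ltnW/ltn_expl.
have n0 : 0 < 2 ^+ n :> R by rewrite exprn_gt0.
rewrite ltr_pdivrMr// mulrC -ltr_pdivrMr// in hn.
have [h1 h2 h3 h4] := ins n.
have wn0 : 0 <= w / 2 ^+ n by rewrite divr_ge0// ltW.
have vn0 : 0 <= v / 2 ^+ n by rewrite divr_ge0// ltW.
have := small (s n).1 ((s n).1 + w / 2 ^+ n) (s n).2 ((s n).2 + v / 2 ^+ n) h1 h2 h3 h4 (hx n) (hy n).
move: hn; rewrite mulrDl => hn.
move=> /(_ ltac:(lra) ltac:(lra)).
rewrite -/(cell n (s n)) => H.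
have := le_trans (big n) H.
have -> : 2 * (e / (2 * wv)) * ((s n).1 + w / 2 ^+ n - (s n).1 + ((s n).2 + v / 2 ^+ n - (s n).2)) ^+ 2
  = e * ((w + v) ^+ 2 / wv) / 4 ^+ n.
  rewrite (_ : 4 = 2 ^+ 2); last by rewrite expr2; ring.
  rewrite -exprM mulnC exprM; move: (lt0r_neq0 n0) (lt0r_neq0 wv0); set k := 2 ^+ n => k0 wvn0.
  by field; rewrite k0 wvn0.
rewrite ler_pM2r; last by rewrite invr_gt0 exprn_gt0.
move=> /le_trans; apply; rewrite ler_piMr//; first exact: ltW.
by rewrite ler_pdivrMr// mul1r /wv lerDl.
Qed.

End goursat.

(** * Complex analysis in one variable *)

(** The norm of R[i] takes its values in R[i]; the real-valued modulus keeps the estimates in the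
    ordered field R. *)
Notation cabs := Normc.normc.

Section complex_modulus.
Context {R : realType}.
Implicit Types (z w : R[i]) (e x y : R).

Lemma cabsE z : `|z| = (cabs z)%:C.
Proof. by rewrite normc_def; case: z. Qed.

Lemma lt_cabs z e : (`|z| < e%:C) = (cabs z < e).
Proof. by rewrite cabsE ltcR. Qed.

Lemma le_cabs z e : (`|z| <= e%:C) = (cabs z <= e).
Proof. by rewrite cabsE lecR. Qed.

Lemma cabs_ge0 z : 0 <= cabs z.
Proof. by case: z => x y; exact: sqrtr_ge0. Qed.

Lemma cabs_eq0 z : (cabs z == 0) = (z == 0).
Proof. by apply/eqP/eqP => [/Normc.eq0_normc//|->]; exact: Normc.normc0. Qed.

Lemma cabs_gt0 z : (0 < cabs z) = (z != 0).
Proof. by rewrite lt_neqAle cabs_ge0 andbT eq_sym cabs_eq0. Qed.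

Lemma cabsD z w : cabs (z + w) <= cabs z + cabs w.
Proof. by rewrite -lecR rmorphD/= -!cabsE ler_normD. Qed.

Lemma cabsM z w : cabs (z * w) = cabs z * cabs w.
Proof. exact: Normc.normcM. Qed.

Lemma cabsN z : cabs (- z) = cabs z.
Proof. exact: normcN. Qed.

Lemma cabsB z w : cabs (z - w) = cabs (w - z).
Proof. by rewrite -cabsN opprB. Qed.

Lemma cabsX z k : cabs (z ^+ k) = cabs z ^+ k.
Proof. by elim: k => [|k IH]; rewrite ?Normc.normc1// !exprS cabsM IH. Qed.

Lemma cabsJ z : cabs (conjc z) = cabs z.
Proof. by case: z => x y /=; rewrite sqrrN. Qed.

Lemma cabs_real x : cabs (x%:C) = `|x|.
Proof. by rewrite /= expr0n/= addr0 sqrtr_sqr. Qed.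

Lemma sqr_cabs z : cabs z ^+ 2 = complex.Re z ^+ 2 + complex.Im z ^+ 2.
Proof. by case: z => x y /=; rewrite sqr_sqrtr// addr_ge0// sqr_ge0. Qed.

Lemma Re_le_cabs z : `|complex.Re z| <= cabs z.
Proof. by rewrite -lecR -cabsE normc_ge_Re. Qed.

Lemma Im_le_cabs z : `|complex.Im z| <= cabs z.
Proof.
rewrite -(ler_pXn2r (_ : (0 < 2)%N))// ?nnegrE ?cabs_ge0//.
by rewrite sqr_cabs real_normK ?num_real// lerDr sqr_ge0.
Qed.

Lemma cabs_le z : cabs z <= `|complex.Re z| + `|complex.Im z|.
Proof.
rewrite -(ler_pXn2r (_ : (0 < 2)%N))// ?nnegrE ?cabs_ge0 ?addr_ge0//.
rewrite sqr_cabs sqrrD !real_normK ?num_real//.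
by rewrite addrAC lerDl mulrn_wge0// mulr_ge0.
Qed.

Lemma ReM z w : complex.Re (z * w) =
  complex.Re z * complex.Re w - complex.Im z * complex.Im w.
Proof. by case: z; case: w. Qed.

Lemma ImM z w : complex.Im (z * w) =
  complex.Re z * complex.Im w + complex.Im z * complex.Re w.
Proof. by case: z; case: w. Qed.

Lemma ReD z w : complex.Re (z + w) = complex.Re z + complex.Re w.
Proof. by case: z; case: w. Qed.

Lemma ImD z w : complex.Im (z + w) = complex.Im z + complex.Im w.
Proof. by case: z; case: w. Qed.

Lemma ReB z w : complex.Re (z - w) = complex.Re z - complex.Re w.
Proof. by case: z; case: w. Qed.

Lemma ImB z w : complex.Im (z - w) = complex.Im z - complex.Im w.
Proof. by case: z; case: w. Qed.

Lemma complex_gt0 (e : R[i]) : 0 < e -> exists2 r : R, 0 < r & e = r%:C.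
Proof.
by case: e => a b; rewrite ltcE/= => /andP[/eqP-> a0]; exists a.
Qed.

Lemma complexP z w : complex.Re z = complex.Re w -> complex.Im z = complex.Im w ->
  z = w.
Proof. by case: z w => [a b] [c d] /= -> ->. Qed.

End complex_modulus.

Section complex_topology.
Context {R : realType}.

Lemma cvg_cabsP (T : Type) (F : set_system T) (FF : Filter F) (f : T -> R[i]) l :
  f @ F --> l <-> forall e : R, 0 < e -> \forall t \near F, cabs (f t - l) < e.
Proof.
split=> [/cvgrPdist_lt H e e0|H].
  have e0' : 0 < e%:C by rewrite ltcR.
  by have := H _ e0'; apply: filterS => t; rewrite lt_cabs cabsB.
apply/cvgrPdist_lt => e /complex_gt0[r r0 ->].
by have := H r r0; apply: filterS => t; rewrite lt_cabs cabsB.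
Qed.

Lemma cvg_Re (T : Type) (F : set_system T) (FF : Filter F) (f : T -> R[i]) l :
  f @ F --> l -> (fun t => complex.Re (f t)) @ F --> complex.Re l.
Proof.
move=> /cvg_cabsP H; apply/cvgrPdist_lt => e /H; apply: filterS => t.
by rewrite distrC -ReB; apply: le_lt_trans; exact: Re_le_cabs.
Qed.

Lemma cvg_Im (T : Type) (F : set_system T) (FF : Filter F) (f : T -> R[i]) l :
  f @ F --> l -> (fun t => complex.Im (f t)) @ F --> complex.Im l.
Proof.
move=> /cvg_cabsP H; apply/cvgrPdist_lt => e /H; apply: filterS => t.
by rewrite distrC -ImB; apply: le_lt_trans; exact: Im_le_cabs.
Qed.

Lemma cvg_ReIm (T : Type) (F : set_system T) (FF : Filter F) (f : T -> R[i]) l :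
  (fun t => complex.Re (f t)) @ F --> complex.Re l ->
  (fun t => complex.Im (f t)) @ F --> complex.Im l -> f @ F --> l.
Proof.
move=> /cvgrPdist_lt HR /cvgrPdist_lt HI; apply/cvg_cabsP => e e0.
have e20 : 0 < e / 2 by rewrite divr_gt0.
near=> t; apply: le_lt_trans (cabs_le _) _; rewrite [ltRHS]splitr ReB ImB.
by rewrite ltrD// distrC; near: t; [exact: HR|exact: HI].
Unshelve. all: by end_near. Qed.

Lemma cvg_realC (T : Type) (F : set_system T) (FF : Filter F) (f : T -> R) (l : R) :
  f @ F --> l -> (fun t => (f t)%:C) @ F --> l%:C.
Proof. by move=> H; apply: cvg_ReIm => //=; exact: cvg_cst. Qed.

Lemma cvg_cabs (T : Type) (F : set_system T) (FF : Filter F) (f : T -> R[i]) l :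
  f @ F --> l -> (fun t => cabs (f t)) @ F --> cabs l.
Proof.
move=> /cvg_cabsP H; apply/cvgrPdist_lt => e /H; apply: filterS => t.
apply: le_lt_trans; rewrite ler_norml; apply/andP; split.
  by have := cabsD (f t - l) l; rewrite subrK; lra.
by have := cabsD (l - f t) (f t); rewrite subrK cabsB; lra.
Qed.

End complex_topology.

Section directional.
Context {R : realType} {V : normedModType R[i]}.
Implicit Types (f : V -> R[i]) (x v : V) (l k : R[i]).

(** The complex directional derivative with the quotient multiplied out: k = 0 is no exception, and
    expansions can be composed without dividing. [ddirP] relates it to the usual limit. *)
Definition ddir f x v l := forall e : R, 0 < e -> exists2 d : R, 0 < d &
  forall k, cabs k < d -> cabs (f (k *: v + x) - f x - l * k) <= e * cabs k.

Let quotient_mulK (k X l : R[i]) : k != 0 -> (k^-1 *: X - l) * k = X - l * k.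
Proof.
by move=> k0; rewrite -[k^-1 *: X]/(k^-1 * X) mulrBl mulrAC mulVf// mul1r.
Qed.

Lemma ddirP f x v l : ddir f x v l <->
  h^-1 *: ((f \o shift x) (h *: v) - f x) @[h --> 0^'] --> l.
Proof.
split=> [H|/cvg_cabsP H e e0].
  apply/cvg_cabsP => e e0.
  have [d d0 {}H] := H (e / 2) ltac:(lra).
  exists d%:C => [|k /=]; first by rewrite /= ltcR.
  rewrite sub0r normrN lt_cabs => kd k0.
  have k00 : 0 < cabs k by rewrite cabs_gt0.
  rewrite -(ltr_pM2r k00) -cabsM quotient_mulK//.
  apply: le_lt_trans (H k kd) _; rewrite ltr_pM2r//; lra.
have [d /= d0 {}H] := H e e0.
move: d0 H => /complex_gt0[r r0 ->] H; exists r => // k kr.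
have [->|k0] := eqVneq k 0; first by rewrite scale0r add0r subrr mulr0 subr0 Normc.normc0 mulr0.
have := H k; rewrite /= sub0r normrN lt_cabs => /(_ kr k0) /ltW.
have k00 : 0 < cabs k by rewrite cabs_gt0.
by rewrite -(ler_pM2r k00) -cabsM quotient_mulK.
Qed.

Lemma derivable_ddir f x v : derivable f x v -> ddir f x v ('D_v f x).
Proof. by move=> H; apply/ddirP. Qed.

Lemma ddir_derivable f x v l : ddir f x v l -> derivable f x v.
Proof. by move=> /ddirP H; apply/cvg_ex; exists l. Qed.

Lemma ddir_derive f x v l : ddir f x v l -> 'D_v f x = l.
Proof. by move=> /ddirP H; apply: cvg_lim. Qed.

End directional.

Section complex_exponential.
Context {R : realType}.
Implicit Types (z w k : R[i]).

Lemma cexpD z w : cexp (z + w) = cexp z * cexp w.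
Proof.
case: z w => [a b] [c d]; apply: complexP; rewrite /cexp ?ReM ?ImM/= ?ReM ?ImM/=.
  by rewrite expRD cosD; ring.
by rewrite expRD sinD; ring.
Qed.

Lemma cexp0 : cexp (0 : R[i]) = 1.
Proof. by rewrite /cexp/= expR0 cos0 sin0; apply: complexP => /=; ring. Qed.

Lemma cexpN z : cexp (- z) = (cexp z)^-1.
Proof.
have e1 : cexp z * cexp (- z) = 1 by rewrite -cexpD subrr cexp0.
have z0 : cexp z != 0.
  by apply/eqP => z0; move: e1; rewrite z0 mul0r => /eqP; rewrite eq_sym oner_eq0.
by apply: (mulfI z0); rewrite e1 mulfV.
Qed.

Let small_o (f : R -> R) (l : R) : is_derive (0 : R) 1 f l -> forall e : R, 0 < e ->
  exists2 d : R, 0 < d & forall x, `|x| < d -> `|f x - f 0 - l * x| <= e * `|x|.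
Proof.
move=> Df e e0.
have Dq : h^-1 *: ((f \o shift 0) (h *: (1 : R)) - f 0) @[h --> 0^'] --> l.
  by rewrite -(@derive_val _ _ _ _ _ _ _ Df); apply: ex_derive.
have /cvgrPdist_le/(_ e e0) [d /= d0 {}H] := Dq.
exists d => // x xd.
have [->|x0] := eqVneq x 0; first by rewrite subrr mulr0 subr0 normr0 mulr0.
have := H x; rewrite /= sub0r normrN => /(_ xd x0).
have x00 : 0 < `|x| by rewrite normr_gt0.
rewrite -(ler_pM2r x00) -normrM; apply: le_trans.
rewrite (_ : x *: 1 + 0 = x); last by rewrite addr0 -[LHS]/(x * 1) mulr1.
rewrite -[_ *: _]/(x^-1 * _) mulrBl mulrAC mulVf// mul1r.
by rewrite le_eqVlt [X in X == _]distrC eqxx.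
Qed.

Let cexp_ddir0 : ddir (@cexp R) 0 1 1.
Proof.
(* The 9 is 4 + 5: the real part of the remainder is at most (3 + 1) eps |k| and the imaginary part
   at most (3 + 2) eps |k|. The bound eps <= 1 gives |expR x| <= 3. *)
move=> e e0; pose eps := Num.min 1 (e / 9).
have eps0 : 0 < eps by rewrite lt_min ltr01/= divr_gt0.
have eps1 : eps <= 1 by rewrite ge_min lexx.
have epse : 9 * eps <= e by rewrite mulrC -ler_pdivlMr// ge_min lexx orbT.
have [d1 d10 H1] := small_o (is_derive_expR (0 : R)) eps0.
have [d2 d20 H2] := small_o (is_derive_cos (0 : R)) eps0.
have [d3 d30 H3] := small_o (is_derive_sin (0 : R)) eps0.
exists (Num.min eps (Num.min d1 (Num.min d2 d3))); first by rewrite lt_min eps0 lt_min d10 lt_min d20.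
case=> x y; set k := (x +i* y).
rewrite lt_min => /andP[k0]; rewrite lt_min => /andP[k1]; rewrite lt_min => /andP[k2 k3].
have xk : `|x| <= cabs k := Re_le_cabs k.
have yk : `|y| <= cabs k := Im_le_cabs k.
have {}H1 := H1 x (le_lt_trans xk k1).
have {}H2 := H2 y (le_lt_trans yk k2).
have {}H3 := H3 y (le_lt_trans yk k3).
rewrite expR0 mul1r in H1; rewrite sin0 oppr0 mul0r subr0 cos0 in H2.
rewrite sin0 cos0 mul1r subr0 in H3.
rewrite cexp0 mul1r addr0 (_ : k *: 1 = k); last by rewrite -[LHS]/(k * 1) mulr1.
apply: le_trans (cabs_le _) _.
rewrite !ReB !ImB /cexp ReM ImM/= !mul0r subr0 addr0 subr0.
have x1 : `|x| <= eps by apply: le_trans xk _; exact: ltW.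
have xx : eps * `|x| <= `|x| by rewrite ler_piMl.
have ex : `|expR x - 1| <= 2 * `|x|.
  have := ler_normD (expR x - 1 - x) x; rewrite subrK; lra.
have ex3 : `|expR x| <= 3.
  have := ler_normD (expR x - 1) 1; rewrite subrK normr1; lra.
have R1 : `|expR x * cos y - 1 - x| <= 3 * (eps * `|y|) + eps * `|x|.
  rewrite (_ : _ - x = expR x * (cos y - 1) + (expR x - 1 - x)); last by ring.
  apply: le_trans (ler_normD _ _) _; apply: lerD => //.
  by rewrite normrM; apply: ler_pM.
have I1 : `|expR x * sin y - y| <= 3 * (eps * `|y|) + (2 * eps) * `|y|.
  rewrite (_ : _ - y = expR x * (sin y - y) + (expR x - 1) * y); last by ring.
  apply: le_trans (ler_normD _ _) _; rewrite !normrM; apply: lerD.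
    exact: ler_pM.
  apply: ler_pM => //; apply: le_trans ex _; lra.
have Y1 : eps * `|y| <= eps * cabs k by rewrite ler_pM2l.
have X1 : eps * `|x| <= eps * cabs k by rewrite ler_pM2l.
have : 9 * eps * cabs k <= e * cabs k by rewrite ler_wpM2r// cabs_ge0.
rewrite -[Num.ExtraDef.sqrtr _]/(cabs k); lra.
Qed.

Lemma cexp_derivable z : derivable (@cexp R) z 1.
Proof.
apply: (@ddir_derivable _ _ _ _ _ (cexp z)) => e e0.
have c0 : 0 < cabs (cexp z) + 1 by rewrite ltr_wpDl// cabs_ge0.
have [d d0 H] := cexp_ddir0 (divr_gt0 e0 c0).
exists d => // k /H; rewrite addr0 cexp0 mul1r => {}H.
have -> : cexp (k *: 1 + z) - cexp z - cexp z * k =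
    cexp z * (cexp (k *: 1) - 1 - k) by rewrite cexpD; ring.
rewrite cabsM; apply: le_trans (ler_wpM2l (cabs_ge0 _) H) _.
rewrite mulrA ler_wpM2r ?cabs_ge0// mulrC -mulrA ler_piMr ?(ltW e0)//.
by rewrite mulrC ler_pdivrMr// mul1r lerDl.
Qed.

End complex_exponential.

(** * Circle means and Cauchy's formula for the first derivative *)

Section cauchy.
Context {R : realType}.
Implicit Types (f g h : R[i] -> R[i]) (z l : R[i]) (r t x y : R).
Local Notation mu := (@lebesgue_measure R).

Definition circ r t : R[i] := (r * cos t) +i* (r * sin t).

Lemma cexp_circ x t : cexp (x +i* t) = circ (expR x) t.
Proof. by apply: complexP; rewrite /cexp ?ReM ?ImM/=; ring. Qed.

Lemma cabs_circ r t : 0 <= r -> cabs (circ r t) = r.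
Proof.
move=> r0; rewrite /circ/= !exprMn -mulrDr cos2Dsin2 mulr1.
by rewrite sqrtr_sqr ger0_norm.
Qed.

Lemma circ_neq0 r t : 0 < r -> circ r t != 0.
Proof. by move=> r0; rewrite -cabs_gt0 cabs_circ// ltW. Qed.

Lemma circ_continuous r : continuous (circ r : R -> R[i]).
Proof.
by move=> t; apply: cvg_ReIm => /=; apply: cvgM; [exact: cvg_cst|exact: continuous_cos|exact: cvg_cst|exact: continuous_sin].
Qed.

Lemma circ_2pi r : circ r (pi *+ 2) = circ r 0.
Proof. by rewrite /circ cos2pi cos0 sin2pi sin0. Qed.

(** The Cauchy-Riemann equations. With P = Im h and Q = Re h the shared derivative is Re l, so that
    Im h dx + Re h dy, the imaginary part of h dz, is closed in the sense of [PQ_closed]. *)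
Lemma ddir_real_diff h x0 y0 l : ddir h (x0 +i* y0) 1 l ->
  real_diff_at (fun x y => complex.Re (h (x +i* y))) x0 y0 (complex.Re l) (- complex.Im l) /\
  real_diff_at (fun x y => complex.Im (h (x +i* y))) x0 y0 (complex.Im l) (complex.Re l).
Proof.
move=> Hl; suff H e : 0 < e -> exists2 del, 0 < del &
    forall x y, `|x - x0| < del -> `|y - y0| < del ->
    cabs (h (x +i* y) - h (x0 +i* y0) - l * ((x - x0) +i* (y - y0)))
      <= e * (`|x - x0| + `|y - y0|).
  split=> e /H[d d0 {}H]; exists d => // x y xd yd; apply: le_trans (H x y xd yd).
    by apply: le_trans (Re_le_cabs _); rewrite !ReB ReM/= mulNr opprB opprK addrA addrAC.
  by apply: le_trans (Im_le_cabs _); rewrite !ImB ImM/= opprD addrA addrAC.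
move=> e0; have [d d0 H] := Hl e e0; exists (d / 2) => [|x y xd yd]; first lra.
have := H ((x - x0) +i* (y - y0)); set k := _ +i* _.
have kle : cabs k <= `|x - x0| + `|y - y0| := cabs_le k.
move=> /(_ ltac:(lra)).
rewrite (_ : k *: 1 + (x0 +i* y0) = x +i* y); last first.
  by rewrite -[k *: 1]/(k * 1) mulr1; apply: complexP; rewrite ?ReD ?ImD/= subrK.
move=> /le_trans; apply; exact: (ler_wpM2l (ltW e0) kle).
Qed.

(* Through exp, the annulus is a rectangle whose horizontal sides cancel. *)
Lemma circle_mean_const (g : R[i] -> R[i]) (x1 x2 : R) : x1 <= x2 ->
  (forall w, complex.Re w <= x2 -> derivable (g \o @cexp R) w 1) ->
  \int[mu]_(t in `[0, pi *+ 2]) (complex.Re (g (circ (expR x2) t)) -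
     complex.Re (g (circ (expR x1) t))) = 0.
Proof.
move=> x12 Dg.
have H x y : x1 <= x <= x2 -> 0 <= y <= pi *+ 2 -> exists p q r,
   real_diff_at (fun x y => complex.Im ((g \o cexp) (x +i* y))) x y p q /\
   real_diff_at (fun x y => complex.Re ((g \o cexp) (x +i* y))) x y q r.
  move=> xx _.
  have Dh : derivable (g \o @cexp R) (x +i* y) 1 by apply: Dg; case/andP: xx.
  have [HR HI] := ddir_real_diff (derivable_ddir Dh).
  by exists (complex.Im ('D_1 (g \o cexp) (x +i* y))), (complex.Re ('D_1 (g \o cexp) (x +i* y))),
    (- complex.Im ('D_1 (g \o cexp) (x +i* y))).
have pi2 : 0 <= pi *+ 2 :> R by rewrite mulrn_wge0// pi_ge0.
have := rectangle_closed_form H x12 pi2.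
rewrite [X in X + _](_ : _ = 0) ?add0r.
  by move=> E; rewrite -[RHS]E; apply: eq_Rintegral => t _; rewrite /= !cexp_circ.
rewrite [LHS](_ : _ = \int[mu]_(x in `[x1, x2]) (cst 0 x)).
  by rewrite Rintegral_cst ?mul0r.
by apply: eq_Rintegral => t _; rewrite /= !cexp_circ circ_2pi subrr.
Qed.

End cauchy.

Section cauchy_formula.
Context {R : realType}.
Implicit Types (f g : R[i] -> R[i]) (h : R -> R[i]) (z l c : R[i]) (r t x y e : R).
Local Notation mu := (@lebesgue_measure R).
Local Notation circle := (`[0, (pi : R) *+ 2]%classic).

Lemma derivable1_cts f z : derivable f z 1 -> {for z, continuous f}.
Proof. by move=> /derivable1_diffP; exact: differentiable_continuous. Qed.

Definition cts_on_circle h := forall t, 0 <= t <= pi *+ 2 -> {for t, continuous h}.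

Definition cI h : R[i] := (\int[mu]_(t in circle) complex.Re (h t)) +i*
  (\int[mu]_(t in circle) complex.Im (h t)).

Lemma cts_on_circle_Re h : cts_on_circle h ->
  mu.-integrable circle (EFin \o (fun t => complex.Re (h t))).
Proof. by move=> H; apply: cts_integrable => t /H; exact: cvg_Re. Qed.

Lemma cts_on_circle_Im h : cts_on_circle h ->
  mu.-integrable circle (EFin \o (fun t => complex.Im (h t))).
Proof. by move=> H; apply: cts_integrable => t /H; exact: cvg_Im. Qed.

Let mcircle : measurable (circle : set (measurableTypeR R)).
Proof. by []. Qed.

Let iZ (k : R) (h : R -> R) : mu.-integrable circle (EFin \o h) ->
  mu.-integrable circle (EFin \o (fun t => k * h t)).
Proof. by move=> ih; have := integrableZl mcircle k ih. Qed.

Lemma cIZ c h : cts_on_circle h -> cI (fun t => c * h t) = c * cI h.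
Proof.
move=> ch; have iR := cts_on_circle_Re ch; have iI := cts_on_circle_Im ch.
apply: complexP; rewrite /cI ?ReM ?ImM/=.
  rewrite (_ : Rintegral _ _ _ = \int[mu]_(t in circle)
     (complex.Re c * complex.Re (h t) - complex.Im c * complex.Im (h t))).
    rewrite RintegralB ?RintegralZl//; exact: iZ.
  by apply: eq_Rintegral => t _; rewrite ReM.
rewrite (_ : Rintegral _ _ _ = \int[mu]_(t in circle)
   (complex.Re c * complex.Im (h t) + complex.Im c * complex.Re (h t))).
  rewrite RintegralD ?RintegralZl//; exact: iZ.
by apply: eq_Rintegral => t _; rewrite ImM.
Qed.

Lemma cIB h h' : cts_on_circle h -> cts_on_circle h' ->
  cI (fun t => h t - h' t) = cI h - cI h'.
Proof.
move=> ch ch'; have iR := cts_on_circle_Re ch; have iI := cts_on_circle_Im ch.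
have iR' := cts_on_circle_Re ch'; have iI' := cts_on_circle_Im ch'.
apply: complexP; rewrite ?ReB ?ImB /cI/= -RintegralB//; apply: eq_Rintegral => t _.
  by rewrite ReB.
by rewrite ImB.
Qed.

Let pi2_ge0 : 0 <= pi *+ 2 :> R.
Proof. by rewrite mulrn_wge0// pi_ge0. Qed.

Lemma cI_near h h' e : cts_on_circle h -> cts_on_circle h' ->
  (forall t, 0 <= t <= pi *+ 2 -> cabs (h t - h' t) <= e) ->
  cabs (cI h - cI h') <= 2 * (pi *+ 2) * e.
Proof.
move=> ch ch' H.
have chB : cts_on_circle (fun t => h t - h' t).
  by move=> t tc; apply: cvgB; [exact: ch|exact: ch'].
rewrite -cIB//; apply: le_trans (cabs_le _) _; rewrite /cI/=.
have HR : `|\int[mu]_(t in circle) complex.Re (h t - h' t)| <= e * (pi *+ 2).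
  have := @Rintegral_near_cst _ (fun t => complex.Re (h t - h' t)) _ _ 0 e pi2_ge0 (cts_on_circle_Re chB).
  rewrite mul0r !subr0; apply => t tc.
  by rewrite subr0; apply: le_trans (Re_le_cabs _) (H t tc).
have HI : `|\int[mu]_(t in circle) complex.Im (h t - h' t)| <= e * (pi *+ 2).
  have := @Rintegral_near_cst _ (fun t => complex.Im (h t - h' t)) _ _ 0 e pi2_ge0 (cts_on_circle_Im chB).
  rewrite mul0r !subr0; apply => t tc.
  by rewrite subr0; apply: le_trans (Im_le_cabs _) (H t tc).
lra.
Qed.

Lemma cvg_cI (S : Type) (F : set_system S) (FF : Filter F) (G : S -> R -> R[i]) (G0 : R -> R[i]) :
  (\forall s \near F, cts_on_circle (G s)) -> cts_on_circle G0 ->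
  (forall e, 0 < e -> \forall s \near F, forall t, 0 <= t <= pi *+ 2 -> cabs (G s t - G0 t) <= e) ->
  (fun s => cI (G s)) @ F --> cI G0.
Proof.
move=> cG cG0 H; apply/cvg_cabsP => e e0.
have K0 : 0 < 4 * (pi *+ 2) :> R by rewrite mulr_gt0// mulrn_wgt0// pi_gt0.
have e1 : 0 < e / (4 * (pi *+ 2)) by exact: divr_gt0.
move: cG (H _ e1); apply: filterS2 => s cGs Hs.
apply: (le_lt_trans (cI_near cGs cG0 Hs)).
rewrite mulrA ltr_pdivrMr//.
rewrite [X in _ < X](_ : _ = 2 * (pi *+ 2) * e + 2 * (pi *+ 2) * e); last by ring.
by rewrite ltrDl !mulr_gt0// mulrn_wgt0// pi_gt0.
Qed.

(** The mean of the quotient (f(z) - f(0)) / z over a circle around 0 does not depend on the radius,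
    by [circle_mean_const], and the quotient tends to f'(0) as the radius shrinks. *)
Let cauchy_Re f r : 0 < r -> (forall z, cabs z <= r -> derivable f z 1) ->
  \int[mu]_(t in circle) complex.Re ((f (circ r t) - f 0) / circ r t) =
    complex.Re ('D_1 f 0) * (pi *+ 2).
Proof.
move=> r0 Df; set l := 'D_1 f 0.
have cg s : 0 < s <= r -> cts_on_circle (fun t => (f (circ s t) - f 0) / circ s t).
  move=> /andP[s0 sr] t _; apply: cvgM.
    apply: cvgB; last exact: cvg_cst.
    apply: (@continuous_comp _ _ _ (circ s) f); first exact: circ_continuous.
    by apply: derivable1_cts; apply: Df; rewrite cabs_circ// ltW.
  apply: cvgV; first exact: circ_neq0.
  exact: circ_continuous.
have Dg w : complex.Re w <= ln r ->
    derivable ((fun z => (f z - f 0) / z) \o @cexp R) w 1.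
  move=> wr; rewrite (_ : _ \o _ = (fun w => f (cexp w) - f 0) * (@cexp R \o -%R)); last first.
    by apply/funext => z /=; rewrite [RHS]/(_ * _) /= cexpN.
  apply: derivableM.
    apply: derivableB; last exact: derivable_cst.
    apply/derivable1_diffP; apply: (@differentiable_comp _ _ _ _ (@cexp R) f).
      exact/derivable1_diffP/cexp_derivable.
    apply/derivable1_diffP/Df.
    case: w wr => x y xr; rewrite cexp_circ cabs_circ ?expR_ge0//.
    by rewrite -[leRHS](lnK r0) ler_expR.
  apply/derivable1_diffP; apply: differentiable_comp; last exact/derivable1_diffP/cexp_derivable.
  apply/derivable1_diffP; apply: (@ddir_derivable _ _ _ _ _ (-1)) => e e0.
  exists 1 => // k _; rewrite -[k *: 1]/(k * 1) (_ : _ - _ - _ = 0); last by ring.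
  by rewrite Normc.normc0 mulr_ge0 ?cabs_ge0// ltW.
apply/eqP; rewrite -subr_eq0 -normr_eq0 eq_le normr_ge0 andbT.
apply/ler_addgt0Pr => e e0; rewrite add0r.
have pi20 : 0 < pi *+ 2 :> R by rewrite mulrn_wgt0// pi_gt0.
have e10 : 0 < e / (pi *+ 2) by rewrite divr_gt0.
have D0 : ddir f 0 1 l by apply/derivable_ddir/Df; rewrite Normc.normc0 ltW.
have [d d0 {}D0] := D0 _ e10.
(* A radius at most r on which the quotient is within e / (2 pi) of f'(0); integrating over the
   circle turns this into e. *)
pose s := Num.min r (d / 2).
have s0 : 0 < s by rewrite lt_min r0 divr_gt0.
have sr : s <= r by rewrite ge_min lexx.
have sd : s < d by rewrite gt_min; apply/orP; right; lra.
have := @circle_mean_const _ _ (ln s) (ln r) _ Dg.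
rewrite ler_ln ?posrE// => /(_ sr); rewrite !lnK ?posrE//.
have ir := cts_on_circle_Re (cg r ltac:(by rewrite r0 lexx)).
have is_ := cts_on_circle_Re (cg s ltac:(by rewrite s0 sr)).
rewrite RintegralB// => /eqP; rewrite subr_eq0 => /eqP ->.
have := @Rintegral_near_cst _ _ 0 (pi *+ 2) (complex.Re l) (e / (pi *+ 2)) pi2_ge0 is_.
rewrite subr0 divfK ?lt0r_neq0//; apply => t _.
rewrite -ReB; apply: le_trans (Re_le_cabs _) _.
have c0 := circ_neq0 t s0.
have cs := @cabs_circ _ s t (ltW s0).
rewrite -(ler_pM2r s0) -[X in _ * X <= _]cs -cabsM mulrBl divfK//.
by have := D0 (circ s t); rewrite cs => /(_ sd); rewrite addr0 -[circ s t *: 1]/(circ s t * 1) mulr1.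
Qed.

(** The imaginary part is the real part of -i f, so [cauchy_Re] is applied to f and to -i f. Since
    the mean of 1/z over the circle is 0, this is Cauchy's integral for f'(0) with f(0)
    subtracted. *)
Lemma cauchy_derivative f r : 0 < r -> (forall z, cabs z <= r -> derivable f z 1) ->
  cI (fun t => (f (circ r t) - f 0) / circ r t) = 'D_1 f 0 * (pi *+ 2)%:C.
Proof.
move=> r0 Df.
have ReNi z : complex.Re ((0 -i* 1) * z) = complex.Im z by rewrite ReM/=; ring.
pose g z := (0 -i* 1) * f z.
have dg z l : ddir f z 1 l -> ddir g z 1 ((0 -i* 1) * l).
  move=> D0 e e0; have [d d0 {}D0] := D0 _ e0; exists d => // k /D0 {}D0.
  rewrite /g -mulrBr -mulrA -mulrBr cabsM [cabs (0 -i* 1)](_ : _ = 1) ?mul1r//.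
  by rewrite /= expr0n/= add0r sqrrN expr1n sqrtr1.
have Dg z : cabs z <= r -> derivable g z 1.
  by move=> /Df/derivable_ddir/dg/ddir_derivable.
have Dg0 : 'D_1 g 0 = (0 -i* 1) * 'D_1 f 0.
  by apply/ddir_derive/dg/derivable_ddir/Df; rewrite Normc.normc0 ltW.
have HR := cauchy_Re r0 Df.
have HI := cauchy_Re r0 Dg.
apply: complexP; first by rewrite ReM /= mulr0 subr0; exact: HR.
rewrite ImM /= mulr0 add0r; move: HI; rewrite Dg0 ReNi => <-.
by apply: eq_Rintegral => t _; rewrite /g -mulrBr -mulrA ReNi.
Qed.

(** Compactness of [0, 2 pi] in its near-covering form: joint convergence in the angle and the
    parameter at each angle gives convergence uniform in the angle, which is what passing to the
    limit in [cI] requires. *)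
Lemma cts_uniform (S : Type) (F : set_system S) (FF : Filter F) (G : S -> R -> R[i]) (G0 : R -> R[i]) :
  cts_on_circle G0 ->
  (forall t, 0 <= t <= pi *+ 2 -> (fun q => G q.2 q.1) @ (nbhs t, F) --> G0 t) ->
  forall e, 0 < e -> \forall s \near F, forall t, 0 <= t <= pi *+ 2 -> cabs (G s t - G0 t) <= e.
Proof.
move=> cG0 H e e0.
have /compact_near_coveringP := @segment_compact R 0 (pi *+ 2).
move=> /(_ S F (fun s t => cabs (G s t - G0 t) <= e) FF).
move=> K; suff /K : forall t, `[0, pi *+ 2]%classic t ->
    \forall t' \near t & s \near F, cabs (G s t' - G0 t') <= e.
  by apply: filterS => s Ks t tc; apply: Ks; rewrite /= in_itv.
move=> t; rewrite /= in_itv/= => tc.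
have e20 : 0 < e / 2 by rewrite divr_gt0.
have /cvg_cabsP/(_ _ e20) H1 := H t tc.
have /cvg_cabsP/(_ _ e20) H2 := cG0 t tc.
have H3 : \forall q \near (nbhs t, F), cabs (G0 q.1 - G0 t) < e / 2.
  exact: (@cvg_fst _ _ (nbhs t) F FF _ H2).
move: H1 H3; apply: filterS2 => q h1 h3.
rewrite (_ : _ - _ = (G q.2 q.1 - G0 t) + (G0 t - G0 q.1)); last by ring.
apply: le_trans (cabsD _ _) _; rewrite [leRHS]splitr (cabsB (G0 t)).
by apply: lerD; apply: ltW.
Qed.

End cauchy_formula.

(** * Directional derivatives of holomorphic functions *)

Section directional_derivatives.
Context {R : realType} {V : normedModType R[i]}.
Implicit Types (f g : V -> R[i]) (W : set V) (x p v w : V) (z k l : R[i]) (r t e : R).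

Lemma ddir_line f x v z l : ddir f (z *: v + x) v l ->
  ddir (fun z' => f (z' *: v + x)) z 1 l.
Proof.
move=> H e e0; have [d d0 {}H] := H e e0; exists d => // k /H.
by rewrite -[k *: 1]/(k * 1) mulr1 scalerDl addrA.
Qed.

Lemma line_cvg (T : Type) (F : set_system T) (FF : Filter F) (a : T -> R[i])
    (b : T -> V) l p v : a @ F --> l -> b @ F --> p ->
  (fun s => a s *: v + b s) @ F --> l *: v + p.
Proof. by move=> Ha Hb; apply: cvgD => //; apply: cvgZr_tmp. Qed.

(** The radius is the same for all base points near p, so that one circle serves in Cauchy's formula
    while the base point moves. *)
Lemma disc_nbhs W p v : open W -> W p -> exists2 r : R, 0 < r &
  \forall x \near p, forall z, cabs z <= r -> W (z *: v + x).
Proof.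
move=> oW Wp.
have : \forall q \near ((0 : R[i]), p), W (q.1 *: v + q.2).
  have := @line_cvg _ (nbhs ((0 : R[i]), p)) _ fst snd 0 p v cvg_fst cvg_snd.
  by rewrite scale0r add0r; apply; apply: open_nbhs_nbhs.
case=> -[A B] /= [/nbhs_ballP[_ /= /complex_gt0[r r0 ->] rA] pB] AB.
exists (r / 2); first by rewrite divr_gt0.
apply: filterS pB => x Bx z zr; apply: (AB (z, x)); split => //=; apply: rA.
by rewrite /ball/= sub0r normrN lt_cabs; lra.
Qed.

(** Exactly what Cauchy's formula along the line in direction v uses. Unlike Frechet
    differentiability, this is easily passed on to the derivatives: [dir_good_derive] obtains it for
    ['D_v f] in every direction w. *)
Definition dir_good W v f := (forall x, W x -> {for x, continuous f}) /\
  (forall x, W x -> derivable f x v).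

Let quot r v f x t := (f (circ r t *: v + x) - f x) / circ r t.

Let quot_cts r W v f x : 0 < r -> dir_good W v f ->
  (forall z, cabs z <= r -> W (z *: v + x)) -> cts_on_circle (quot r v f x).
Proof.
move=> r0 [cf _] H t _; apply: cvgM; last first.
  by apply: cvgV; [exact: circ_neq0|exact: circ_continuous].
apply: cvgB; last exact: cvg_cst.
apply: (@continuous_comp _ _ _ (fun t => circ r t *: v + x) f).
  by apply: line_cvg; [exact: circ_continuous|exact: cvg_cst].
by apply/cf/H; rewrite cabs_circ// ltW.
Qed.

Let quot_formula r W v f x : 0 < r -> dir_good W v f ->
  (forall z, cabs z <= r -> W (z *: v + x)) ->
  cI (quot r v f x) = 'D_v f x * (pi *+ 2)%:C.
Proof.
move=> r0 [_ Df] H.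
have Dl z : cabs z <= r -> ddir (fun z' => f (z' *: v + x)) z 1 ('D_v f (z *: v + x)).
  by move=> zr; apply/ddir_line/derivable_ddir/Df/H.
have := @cauchy_derivative _ (fun z => f (z *: v + x)) r r0.
rewrite (ddir_derive (Dl 0 _)) ?Normc.normc0 ?ltW// !scale0r !add0r => -> //.
by move=> z /Dl/ddir_derivable.
Qed.

Let pi2_neq0 : (pi *+ 2)%:C != 0 :> R[i].
Proof.
have p0 : 0 < pi *+ 2 :> R by rewrite mulrn_wgt0// pi_gt0.
by rewrite -cabs_gt0 cabs_real normr_gt0 lt0r_neq0.
Qed.

(** Near p the derivative is a mean of quotients over a fixed circle. The quotient involves only
    values of f, and depends on the base point continuously, uniformly in the angle. *)
Lemma derive_continuous W v f p : open W -> W p -> dir_good W v f ->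
  {for p, continuous ('D_v f)}.
Proof.
move=> oW Wp gf.
have [r r0 nW] := disc_nbhs v oW Wp.
have pW := nbhs_singleton nW.
have near_eq : \forall x \near p, cI (quot r v f x) / (pi *+ 2)%:C = 'D_v f x.
  apply: filterS nW => x xW.
  by rewrite (quot_formula r0 gf xW) mulfK.
suff H : (fun x => cI (quot r v f x) / (pi *+ 2)%:C) x @[x --> p] -->
    cI (quot r v f p) / (pi *+ 2)%:C.
  have E := nbhs_singleton near_eq; rewrite E in H.
  by apply: cvg_trans H; apply: near_eq_cvg near_eq.
apply: cvgM; last exact: cvg_cst.
apply: cvg_cI.
- by apply: filterS nW => x xW; apply: quot_cts r0 gf xW.
- exact: quot_cts r0 gf pW.
apply: cts_uniform; first exact: quot_cts r0 gf pW.
move=> t tc; apply: cvgM; last first.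
  apply: cvgV; first exact: circ_neq0.
  by apply: (@cvg_comp _ _ _ fst (circ r)); [exact: cvg_fst|exact: circ_continuous].
have fp := gf.1 _ (pW (circ r t) ltac:(by rewrite cabs_circ// ltW)).
apply: cvgB; last by apply: (@cvg_comp _ _ _ snd f); [exact: cvg_snd|exact: (gf.1 _ Wp)].
apply: (@cvg_comp _ _ _ (fun q : R * V => circ r q.1 *: v + q.2) f _ _ _ _ fp).
apply: line_cvg cvg_snd.
by apply: (@cvg_comp _ _ _ fst (circ r)); [exact: cvg_fst|exact: circ_continuous].
Qed.

Let real_line_derive f x v t : derivable f (t%:C *: v + x) v -> forall c : R[i],
  is_derive t 1 (fun s : R => complex.Re (c * f (s%:C *: v + x)))
    (complex.Re (c * 'D_v f (t%:C *: v + x))).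
Proof.
move=> /derivable_ddir D c; set l := 'D_v f _ in D *.
suff H : h^-1 *: (((fun s : R => complex.Re (c * f (s%:C *: v + x))) \o shift t) (h *: (1 : R))
    - complex.Re (c * f (t%:C *: v + x))) @[h --> 0^'] --> complex.Re (c * l).
  by apply: DeriveDef; [apply/cvg_ex; exists (complex.Re (c * l))|exact: cvg_lim].
apply/cvgrPdist_le => e e0.
have c0 : 0 < cabs c + 1 by rewrite ltr_wpDl// cabs_ge0.
have [d d0 {}D] := D _ (divr_gt0 e0 c0).
exists d => // h /=; rewrite sub0r normrN => hd h0.
have h00 : 0 < `|h| by rewrite normr_gt0.
rewrite -(ler_pM2r h00) -normrM -[h^-1 *: _]/(h^-1 * _) mulrBl mulrAC mulVf// mul1r.
have := D h%:C; rewrite cabs_real => /(_ hd) {}D.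
rewrite distrC -ReB.
rewrite (_ : complex.Re (c * l) * h = complex.Re (c * (l * h%:C))); last first.
  by rewrite mulrA [RHS]ReM/= mulr0 subr0.
rewrite -ReB -mulrBr -mulrBr; apply: le_trans (Re_le_cabs _) _.
rewrite cabsM -[h *: 1]/(h * 1) mulr1 rmorphD/= scalerDl -[_ + _ *: v + x]addrA.
apply: le_trans (ler_wpM2l (cabs_ge0 _) D) _.
rewrite mulrA ler_wpM2r// mulrC -mulrA ler_piMr ?(ltW e0)//.
by rewrite mulrC ler_pdivrMr// mul1r lerDl.
Qed.

(* The limit is joint in the base point and the increment; this gives the uniform
   convergence on circles needed to differentiate Cauchy's formula in [w]. *)
Let difference_quotient W v f p : open W -> W p -> dir_good W v f ->
  (fun q : V * R[i] => q.2^-1 * (f (q.2 *: v + q.1) - f q.1)) @ (nbhs p, 0^') --> 'D_v f p.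
Proof.
move=> oW Wp gf; apply/cvg_cabsP => e e0.
have e4 : 0 < e / 4 by rewrite divr_gt0.
have /cvg_cabsP/(_ _ e4) nD := derive_continuous oW Wp gf.
have nW : \forall x \near p, W x /\ cabs ('D_v f x - 'D_v f p) < e / 4.
  by apply: filterI => //; apply: open_nbhs_nbhs.
(* On S the derivative is within e / 4 of its value at p. Taking the interior allows [disc_nbhs] to
   keep the whole segment from x to x + k v inside S, so the mean value theorem can be applied along
   it. *)
pose S := [set x | W x /\ cabs ('D_v f x - 'D_v f p) < e / 4].
pose U := S^°; have oU : open U by exact: open_interior.
have Up : U p by exact: nW.
have UW : U `<=` S by exact: interior_subset.
have [r r0 nU] := disc_nbhs v oU Up.
have nr : \forall k \near (0 : R[i])^', k != 0 /\ cabs k <= r.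
  exists r%:C => [|k /=]; first by rewrite /= ltcR.
  by rewrite sub0r normrN lt_cabs => /ltW.
exists ([set x | forall z, cabs z <= r -> U (z *: v + x)], [set k | k != 0 /\ cabs k <= r]) => //.
move=> [x k] /= [Ux [k0 kr]].
have Us (s : R) : 0 <= s <= 1 -> U (s%:C *: (k *: v) + x).
  move=> /andP[s0 s1]; rewrite scalerA; apply: Ux.
  rewrite cabsM cabs_real ger0_norm//; apply: le_trans kr.
  by rewrite ler_piMl// cabs_ge0.
have Dk (s : R) : 0 <= s <= 1 -> derivable f (s%:C *: (k *: v) + x) (k *: v) /\
   'D_(k *: v) f (s%:C *: (k *: v) + x) = k * 'D_v f (s%:C *: (k *: v) + x).
  move=> /Us/UW[WW _]; set y := s%:C *: _ + x.
  have D1 : ddir f y v ('D_v f y) by apply/derivable_ddir/gf.2.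
  have D2 : ddir f y (k *: v) (k * 'D_v f y).
    move=> eps eps0; have ck : 0 < cabs k by rewrite cabs_gt0.
    have [d d0 {}D1] := D1 _ (divr_gt0 eps0 ck).
    exists (d / cabs k); first exact: divr_gt0.
    move=> h; rewrite ltr_pdivlMr// -cabsM => /D1.
    by rewrite cabsM scalerA (mulrA (eps / _)) mulrAC divfK ?lt0r_neq0// mulrAC (mulrC ('D_v f y)) (mulrC h).
  by split; [exact: ddir_derivable D2|exact: ddir_derive D2].
(* The mean value theorem is only available for real functions; it is applied to the real part after
   multiplication by c, and c = 1 and c = -i give the real and imaginary parts. *)
have mv c : cabs c = 1 -> `|complex.Re (c * (k^-1 * (f (k *: v + x) - f x) - 'D_v f p))| <= e / 4.
  move=> c1; pose phi s := complex.Re ((c * k^-1) * f (s%:C *: (k *: v) + x)).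
  have Dphi (s : R) : 0 <= s <= 1 -> is_derive s 1 phi (complex.Re (c * 'D_v f (s%:C *: (k *: v) + x))).
    move=> s01; have [D1 D2] := Dk s s01.
    have := real_line_derive D1 (c * k^-1).
    by rewrite D2 -mulrA mulKf.
  have [||s] := @MVT _ phi (fun s => complex.Re (c * 'D_v f (s%:C *: (k *: v) + x))) 0 1 ltr01.
  - by move=> s; rewrite in_itv/= => /andP[s0 s1]; apply: Dphi; rewrite !ltW.
  - apply: continuous_in_subspaceT => s; rewrite inE/= in_itv/= => s01.
    apply: differentiable_continuous; apply/derivable1_diffP.
    exact: (@ex_derive _ _ _ _ _ _ _ (Dphi s s01)).
  rewrite in_itv/= => /andP[s0 s1]; rewrite subr0 mulr1 /phi scale1r scale0r add0r -ReB -mulrBr.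
  move=> E; rewrite mulrBr ReB mulrA E -ReB -mulrBr.
  apply: le_trans (Re_le_cabs _) _; rewrite cabsM c1 mul1r ltW//.
  have s01 : 0 <= s <= 1 by rewrite !ltW.
  by have [] := UW _ (Us s s01).
apply: (@le_lt_trans _ _ (e / 4 + e / 4)); last lra.
apply: le_trans (cabs_le _) _; apply: lerD.
  by have := mv 1 (Normc.normc1 _); rewrite mul1r.
have := mv (0 -i* 1); rewrite ReM/= mul0r mulN1r opprK add0r; apply.
by rewrite /= expr0n/= add0r sqrrN expr1n sqrtr1.
Qed.

Let dir_good_hol W v f : open W -> holomorphic_on W f -> dir_good W v f.
Proof.
move=> oW hf; split=> x Wx; first exact/differentiable_continuous/hf.
exact/diff_derivable/hf.
Qed.

(** Differentiation under the integral sign: the Cauchy mean representing ['D_v f] is differentiated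
    in the direction w. The result is the Cauchy mean for ['D_w f], which yields both the existence
    and the symmetry of the second derivatives. *)
Let mixed_quotient W f p v w r : open W -> holomorphic_on W f -> 0 < r ->
  (\forall x \near p, forall z, cabs z <= r -> W (z *: v + x)) ->
  ddir ('D_v f) p w (cI (quot r v ('D_w f) p) / (pi *+ 2)%:C).
Proof.
move=> oW hf r0 nW; apply/ddirP.
have pW := nbhs_singleton nW.
have Wp : W p by have := pW 0; rewrite scale0r add0r Normc.normc0; apply; exact: ltW.
have gv := dir_good_hol v oW hf; have gw := dir_good_hol w oW hf.
have kcvg : (fun k => k *: w + p) @ (0 : R[i])^' --> p.
  rewrite -[X in _ --> X]add0r -(scale0r w); apply: line_cvg; last exact: cvg_cst.
  exact: cvg_within.
have nk : \forall k \near (0 : R[i])^', forall z, cabs z <= r -> W (z *: v + (k *: w + p)).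
  exact: (kcvg _ nW).
pose Q x k := k^-1 * (f (k *: w + x) - f x).
(* A second difference quotient read in two orders. As a v-quotient of [Q] it converges for k -> 0
   by [difference_quotient]; as a w-quotient of [quot] its mean is the difference quotient of
   ['D_v f]. *)
pose G k t := (Q (circ r t *: v + p) k - Q p k) / circ r t.
have Gq k t : G k t = k^-1 * (quot r v f (k *: w + p) t - quot r v f p t).
  rewrite /G /quot /Q -mulrBr -mulrBl -mulrA; congr (_ * (_ / _)).
  rewrite [circ r t *: v + (k *: w + p)]addrCA; ring.
have cquot k : (forall z, cabs z <= r -> W (z *: v + (k *: w + p))) ->
    cts_on_circle (fun t => quot r v f (k *: w + p) t - quot r v f p t).
  move=> kW t tc; apply: cvgB; first exact: (quot_cts r0 gv kW).
  exact: (quot_cts r0 gv pW).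
have near_eq : \forall k \near (0 : R[i])^', cI (G k) / (pi *+ 2)%:C =
    k^-1 *: (('D_v f \o shift p) (k *: w) - 'D_v f p).
  apply: filterS nk => k kW.
  rewrite (_ : G k = fun t => k^-1 * (quot r v f (k *: w + p) t - quot r v f p t)); last first.
    by apply/funext => t; exact: Gq.
  rewrite cIZ; last exact: cquot.
  rewrite cIB; [|exact: (quot_cts r0 gv kW)|exact: (quot_cts r0 gv pW)].
  by rewrite !(quot_formula r0 gv)// -mulrBl mulrA mulfK.
suff H : (fun k => cI (G k) / (pi *+ 2)%:C) k @[k --> 0^'] -->
    cI (quot r v ('D_w f) p) / (pi *+ 2)%:C.
  by apply: cvg_trans H; apply: near_eq_cvg near_eq.
have Wt t : W (circ r t *: v + p) by apply: pW; rewrite cabs_circ// ltW.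
have gDw : cts_on_circle (quot r v ('D_w f) p).
  move=> t _; apply: cvgM; last first.
    by apply: cvgV; [exact: circ_neq0|exact: circ_continuous].
  apply: cvgB; last exact: cvg_cst.
  apply: (@continuous_comp _ _ _ (fun t => circ r t *: v + p) ('D_w f)).
    by apply: line_cvg; [exact: circ_continuous|exact: cvg_cst].
  exact: (derive_continuous oW (Wt t) gw).
apply: cvgM; last exact: cvg_cst.
apply: cvg_cI => //.
  apply: filterS nk => k kW t tc.
  have -> : G k = fun t => k^-1 * (quot r v f (k *: w + p) t - quot r v f p t).
    by apply/funext => s; exact: Gq.
  by apply: cvgM; [exact: cvg_cst|exact: (cquot k kW t tc)].
apply: cts_uniform => // t tc; apply: cvgM; last first.
  apply: cvgV; first exact: circ_neq0.
  by apply: (@cvg_comp _ _ _ fst (circ r)); [exact: cvg_fst|exact: circ_continuous].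
have C1 : (fun q : R * R[i] => (circ r q.1 *: v + p, q.2)) @ (nbhs t, 0^') -->
    (nbhs (circ r t *: v + p), (0 : R[i])^').
  apply: cvg_pair; last exact: cvg_snd.
  apply: line_cvg; last exact: cvg_cst.
  by apply: (@cvg_comp _ _ _ fst (circ r)); [exact: cvg_fst|exact: circ_continuous].
have C2 : (fun q : R * R[i] => (p, q.2)) @ (nbhs t, 0^') --> (nbhs p, (0 : R[i])^').
  by apply: cvg_pair; [exact: cvg_cst|exact: cvg_snd].
apply: cvgB; first exact: (cvg_comp _ _ C1 (difference_quotient oW (Wt t) gw)).
exact: (cvg_comp _ _ C2 (difference_quotient oW Wp gw)).
Qed.

Lemma derive_derivable W f p v w : open W -> holomorphic_on W f -> W p ->
  derivable ('D_v f) p w.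
Proof.
move=> oW hf Wp; have [r r0 nW] := disc_nbhs v oW Wp.
exact: ddir_derivable (mixed_quotient w oW hf r0 nW).
Qed.

Let dir_good_derive W f v w : open W -> holomorphic_on W f -> dir_good W w ('D_v f).
Proof.
move=> oW hf; split=> x Wx; last exact: derive_derivable oW hf Wx.
exact: derive_continuous oW Wx (dir_good_hol v oW hf).
Qed.

(** [mixed_quotient] expresses the left side as the v-mean for ['D_w f], and Cauchy's formula for
    ['D_w f] evaluates this mean as the right side. *)
Lemma derive_commute W f p v w : open W -> holomorphic_on W f -> W p ->
  'D_w ('D_v f) p = 'D_v ('D_w f) p.
Proof.
move=> oW hf Wp; have [r r0 nW] := disc_nbhs v oW Wp.
apply: (etrans (ddir_derive (mixed_quotient w oW hf r0 nW))).
have E := quot_formula r0 (dir_good_derive w v oW hf) (nbhs_singleton nW).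
by apply: (canLR (mulfK pi2_neq0)); exact: E.
Qed.

Lemma derive2_continuous W f p v w : open W -> holomorphic_on W f -> W p ->
  {for p, continuous ('D_w ('D_v f))}.
Proof. by move=> oW hf Wp; exact: derive_continuous oW Wp (dir_good_derive v w oW hf). Qed.

End directional_derivatives.

(** * Topology and measurability in C^n *)

Section relatively_compact.
Context {R : realType} {n : nat}.
Local Notation E := ('Cn[R]_n).
Implicit Types (x y : E) (U K Omega : set E).

Definition square (z : R[i]) (e : R) : set R[i] :=
  (fun p : R * R => p.1 +i* p.2) @`
    (`[complex.Re z - e, complex.Re z + e] `*` `[complex.Im z - e, complex.Im z + e]).

Lemma compact_square z e : compact (square z e).
Proof.
apply: continuous_compact; last by apply: compact_setX; exact: segment_compact.
apply: continuous_subspaceT => p; apply: cvg_ReIm => /=; [exact: cvg_fst|exact: cvg_snd].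
Qed.

Lemma square_cabs z w e : cabs (w - z) <= e -> square z e w.
Proof.
move=> we; exists (complex.Re w, complex.Im w) => /=; last by case: w {we}.
have := le_trans (Re_le_cabs _) we; have := le_trans (Im_le_cabs _) we.
by rewrite ReB ImB !in_itv/= !ler_norml => /andP[? ?] /andP[? ?]; split; lra.
Qed.

Lemma ball_CnP x (e : R) y : 0 < e ->
  ball x e%:C y <-> forall j, cabs (y ord0 j - x ord0 j) < e.
Proof.
move=> e0; split=> [[_ H] j|H].
  by have := H ord0 j; rewrite /ball/= lt_cabs cabsB.
split=> [|i j]; first by rewrite ltcR.
by rewrite ord1 /ball/= lt_cabs cabsB.
Qed.

Lemma nbhs_CnP x U : nbhs x U <-> exists2 e : R, 0 < e &
  forall y, (forall j, cabs (y ord0 j - x ord0 j) < e) -> U y.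
Proof.
split=> [/nbhs_ballP[_ /= /complex_gt0[e e0 ->] H]|[e e0 H]].
  by exists e => // y xy; apply: H; apply/(ball_CnP _ _ e0).
apply/nbhs_ballP; exists e%:C; first by rewrite /= ltcR.
by move=> y /(proj1 (ball_CnP _ _ e0)); exact: H.
Qed.

Lemma relcompact_point Omega x : open Omega -> Omega x ->
  exists2 U, relcompact U Omega & U x.
Proof.
move=> oO Ox.
have /nbhs_CnP[e e0 eO] : nbhs x Omega by exact: open_nbhs_nbhs.
have e20 : 0 < e / 2 by rewrite divr_gt0.
have e2C : 0 < (e / 2)%:C :> R[i] by rewrite ltcR.
exists (ball x (e / 2)%:C)^°; last exact: nbhsx_ballx.
pose box := [set v : E | forall j, square (x ord0 j) (e / 2) (v ord0 j)].
have cbox : compact box.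
  exact: (rV_compact (fun j => @compact_square (x ord0 j) (e / 2))).
have sbox : closure (ball x (e / 2)%:C)^° `<=` box.
  have /closure_id -> : closed box := compact_closed (@norm_hausdorff _ _) cbox.
  apply: closure_subset; apply: subset_trans (@interior_subset _ _) _.
  by move=> y /(proj1 (ball_CnP _ _ e20)) xy j; apply: square_cabs; exact: ltW.
split; first exact: open_interior.
  by apply: subclosed_compact cbox sbox; exact: closed_closure.
move=> y cy; apply: eO => j.
have [z [xz yz]] :
  (ball x (e / 2)%:C)^° `&` ball y (e / 2)%:C !=set0.
  by apply: cy; exact: nbhsx_ballx.
move/interior_subset/(proj1 (ball_CnP _ _ e20)) : xz => xz.
move/(proj1 (ball_CnP _ _ e20)) : yz => yz.
rewrite (_ : _ - _ = (y ord0 j - z ord0 j) + (z ord0 j - x ord0 j)); last by ring.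
apply: le_lt_trans (cabsD _ _) _; rewrite [ltRHS]splitr cabsB.
by apply: ltrD; [exact: yz|exact: xz].
Qed.

Lemma relcompactU U1 U2 Omega : relcompact U1 Omega -> relcompact U2 Omega ->
  relcompact (U1 `|` U2) Omega.
Proof.
move=> [ o1 c1 s1] [ o2 c2 s2]; split; first exact: openU.
  by rewrite closureU; exact: compactU.
by rewrite closureU subUset.
Qed.

(** The filter [F] consists of the properties shared by all sufficiently large relatively compact
    sets; finite unions make it a filter. The near-covering property along it replaces the choice of
    a finite subcover. *)
Lemma relcompact_nbhs K Omega : open Omega -> compact K -> K `<=` Omega ->
  exists2 U, relcompact U Omega & K `<=` U.
Proof.
move=> oO /compact_near_coveringP cK KO.
pose F : set_system (set E) := [set S | exists2 U0, relcompact U0 Omega &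
  forall U, relcompact U Omega -> U0 `<=` U -> S U].
have rc0 : relcompact set0 Omega.
  by split; [exact: open0|rewrite closure0; exact: compact0|rewrite closure0].
have FF : Filter F.
  split.
  - by exists set0.
  - move=> S T [U0 r0 H0] [U1 r1 H1]; exists (U0 `|` U1); first exact: relcompactU.
    move=> U rU sU; split; [apply: H0|apply: H1] => //; apply: subset_trans sU.
      exact: subsetUl.
    exact: subsetUr.
  - move=> S T ST [U0 r0 H0]; exists U0 => // U rU sU; exact/ST/H0.
have [x Kx|U0 r0 H] := cK _ F (fun U x => U x) FF.
  have [U rU Ux] := relcompact_point oO (KO _ Kx).
  exists (U, [set U' | U `<=` U']) => /=.
    by split; [case: rU => oU _ _; exact: open_nbhs_nbhs|exists U].
  by move=> [y U'] /= [Uy UU']; exact: UU'.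
by exists U0 => //; apply: H.
Qed.

End relatively_compact.

Section cells.
Context {R : realType} {n : nat}.
Local Notation E := ('Cn[R]_n).
Local Notation index := {ffun 'I_n -> (rat * rat) * (rat * rat)}.
Local Notation T := (n.-tuple (R2 R)).

(** Boxes with rational corners form a countable base of C^n. They connect the topology with the
    product sigma-algebra on tuples, and reduce unions of null sets to countable ones. *)
Definition cell (q : index) : set E := [set x | forall j,
  (ratr (q j).1.1 < complex.Re (x ord0 j) < ratr (q j).1.2) /\
  (ratr (q j).2.1 < complex.Im (x ord0 j) < ratr (q j).2.2)].

Lemma cell_nbhs x U : nbhs x U -> exists2 q, cell q x & cell q `<=` U.
Proof.
move=> /nbhs_CnP[e e0 eU].
have H (s : R) : exists q : rat * rat, [/\ ratr q.1 < s < ratr q.2,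
    s - e / 4 < ratr q.1 & ratr q.2 < s + e / 4].
  have [|q1] := @rat_in_itvoo R (s - e / 4) s; first lra.
  have [|q2] := @rat_in_itvoo R s (s + e / 4); first lra.
  rewrite !in_itv/= => /andP[a b] /andP[c d]; exists (q1, q2); split => //=; exact/andP.
have /choice[q qP] : forall j : 'I_n, exists q : (rat * rat) * (rat * rat),
  [/\ ratr q.1.1 < complex.Re (x ord0 j) < ratr q.1.2,
    complex.Re (x ord0 j) - e / 4 < ratr q.1.1 & ratr q.1.2 < complex.Re (x ord0 j) + e / 4] /\
  [/\ ratr q.2.1 < complex.Im (x ord0 j) < ratr q.2.2,
    complex.Im (x ord0 j) - e / 4 < ratr q.2.1 & ratr q.2.2 < complex.Im (x ord0 j) + e / 4].
  move=> j; have [q1 h1] := H (complex.Re (x ord0 j)).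
  by have [q2 h2] := H (complex.Im (x ord0 j)); exists (q1, q2).
exists [ffun j => q j] => [j|y yq]; first by rewrite ffunE; have [[? ? ?] [? ? ?]] := qP j.
apply: eU => j; have [[/andP[? ?] ? ?] [/andP[? ?] ? ?]] := qP j.
have := yq j; rewrite ffunE => -[/andP[? ?] /andP[? ?]].
apply: le_lt_trans (cabs_le _) _; rewrite ReB ImB.
have : `|complex.Re (y ord0 j) - complex.Re (x ord0 j)| < e / 4 by rewrite ltr_norml; lra.
have : `|complex.Im (y ord0 j) - complex.Im (x ord0 j)| < e / 4 by rewrite ltr_norml; lra.
lra.
Qed.

Lemma measurable_cell q : measurable ((of_tuple : T -> E) @^-1` cell q).
Proof.
pose A j : set (R2 R) := `](ratr (q j).1.1 : R), ratr (q j).1.2[%classic `*`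
  `](ratr (q j).2.1 : R), ratr (q j).2.2[%classic.
rewrite (_ : _ @^-1` _ = \bigcap_(j in [set: 'I_n]) ((fun t : T => tnth t j) @^-1` A j)).
  apply: fin_bigcap_measurable => [|j _]; first exact: finite_finset.
  rewrite -[X in measurable X]setTI; apply: measurable_tnth => //.
  by apply: measurableX; exact: measurable_itv.
apply/seteqP; split => t /=.
  move=> H j _; have := H j; rewrite /of_tuple mxE /A/= !in_itv/=.
  by move=> [h1 h2]; split.
move=> H j; have := H j I; rewrite /of_tuple mxE /A/= !in_itv/=.
by move=> [h1 h2]; split.
Qed.

Lemma measurable_open U : open U -> measurable ((of_tuple : T -> E) @^-1` U).
Proof.
move=> oU; rewrite (_ : _ @^-1` _ = \bigcup_q (if `[< cell q `<=` U >]
    then (of_tuple : T -> E) @^-1` cell q else set0)).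
  apply: countable_bigcupT_measurable => [|q]; first exact: countableP.
  by case: asboolP => _ //; exact: measurable_cell.
apply/seteqP; split => t /=.
  move=> Ut; have [q qt qU] := cell_nbhs (open_nbhs_nbhs (conj oU Ut)).
  by exists q => //; case: asboolP.
by move=> [q _]; case: asboolP => // qU /qU.
Qed.

Definition of_tuple2 (p : T * T) : E * E := (of_tuple p.1, of_tuple p.2).

Lemma measurable_open2 W : open W -> measurable (of_tuple2 @^-1` W).
Proof.
move=> oW; rewrite (_ : _ @^-1` _ = \bigcup_q (if `[< cell q.1 `*` cell q.2 `<=` W >]
    then ((of_tuple : T -> E) @^-1` cell q.1) `*` ((of_tuple : T -> E) @^-1` cell q.2) else set0)).
  apply: countable_bigcupT_measurable => [|q]; first exact: countableP.
  by case: asboolP => _ //; apply: measurableX; exact: measurable_cell.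
apply/seteqP; split => t /=.
  move=> Wt; have [[A B] /= [nA nB] AB] : nbhs (of_tuple t.1, of_tuple t.2) W.
    exact: open_nbhs_nbhs (conj oW Wt).
  have [q1 q1t q1A] := cell_nbhs nA; have [q2 q2t q2B] := cell_nbhs nB.
  exists (q1, q2) => //; case: asboolP => //; apply: contra_notP => _ [y z] [/= qy qz].
  by apply: AB; split; [exact: q1A|exact: q2B].
by move=> [q _]; case: asboolP => // qU [a b]; apply: qU.
Qed.

Let open_cts_measurable (V : topologicalType) d (T' : measurableType d) (phi : T' -> V) (U : set V)
  (f : V -> R) : (forall A, open A -> measurable (phi @^-1` A)) -> open U ->
  (forall x, U x -> {for x, continuous f}) ->
  measurable_fun (phi @^-1` U) (f \o phi : T' -> measurableTypeR R).
Proof.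
move=> mphi oU cf; apply: (measurability _ (measurable_realfun.RGenOInfty.measurableE R)) => _ [_ [r ->] <-].
rewrite (_ : _ `&` _ = phi @^-1` (U `&` f @^-1` `]r, +oo[%classic)).
  apply: mphi; rewrite openE => x [Ux fx]; apply: filterI; first exact: open_nbhs_nbhs.
  apply: (cf x Ux); apply: open_nbhs_nbhs; split; last exact: fx.
  by apply: interval_open => //.
by apply/seteqP; split.
Qed.

Lemma cts_measurable U (f : E -> R) : open U -> (forall x, U x -> {for x, continuous f}) ->
  measurable_fun ((of_tuple : T -> E) @^-1` U) (fun t => f (of_tuple t) : measurableTypeR R).
Proof. by move=> oU; apply: open_cts_measurable => //; exact: measurable_open. Qed.

Lemma cts_measurable2 U (f : E * E -> R) : open U -> (forall x, U x -> {for x, continuous f}) ->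
  measurable_fun (of_tuple2 @^-1` U) (fun t => f (of_tuple2 t) : measurableTypeR R).
Proof. by move=> oU; apply: open_cts_measurable => //; exact: measurable_open2. Qed.

(** A Lindelof argument: the complement of the support is covered by the countably many cells on
    which u vanishes almost everywhere. The cells are enumerated through [unpickle], so that a
    countable intersection of full-measure conditions applies. *)
Lemma ae_esupp Omega (u : E -> R[i]) :
  {ae lebesgueCn R n, forall t, Omega (of_tuple t) -> ~ esupp Omega u (of_tuple t) ->
     u (of_tuple t) = 0}.
Proof.
pose vanish (q : index) := {ae lebesgueCn R n, forall t, (Omega `&` cell q) (of_tuple t) ->
  u (of_tuple t) = 0}.
have H : {ae lebesgueCn R n, forall t, forall k : nat,
    if (unpickle k : option index) is Some q then vanish q ->
      (Omega `&` cell q) (of_tuple t) -> u (of_tuple t) = 0 else True}.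
  apply: ae_foralln => k; case: (unpickle k) => [q|]; last exact: aeW.
  have [vq|nvq] := pselect (vanish q); last by apply: aeW => t /nvq.
  by apply: filterS vq => t Ht _.
apply: filterS H => t Ht Ot nsupp.
have [U [ oU [Ut vU]]] : exists U, open U /\ U (of_tuple t) /\
    {ae lebesgueCn R n, forall t, (Omega `&` U) (of_tuple t) -> u (of_tuple t) = 0}.
  apply: contrapT => H; apply: nsupp; split => // U oU Ut vU.
  by apply: H; exists U.
have [q qt qU] := cell_nbhs (open_nbhs_nbhs (conj oU Ut)).
have := Ht (pickle q); rewrite pickleK; apply => //.
by apply: filterS vU => s Hs [Os qs]; apply: Hs; split => //; exact: qU.
Qed.

End cells.

(** * Gaussian integrals, Schur's test and integral operators *)

Section gaussian.
Context {R : realType}.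
Local Notation mu := (@lebesgue_measure R).
Local Open Scope ereal_scope.

Lemma measurable_gaussian (a s : R) : (0 < s)%R ->
  measurable_fun setT (fun x : R => expR (- (x - a) ^+ 2 / s)%R).
Proof.
move=> s0; have := measurable_normal_fun a (Num.sqrt (s / 2)).
by rewrite /normal_fun sqr_sqrtr ?divr_ge0 ?ltW// -mulr_natr divfK.
Qed.

Lemma integral_gaussian (a s : R) : (0 < s)%R ->
  \int[mu]_x (expR (- (x - a) ^+ 2 / s))%:E = (Num.sqrt (pi * s))%:E.
Proof.
move=> s0; pose sg := Num.sqrt (s / 2).
have s20 : (0 < s / 2)%R by rewrite divr_gt0.
have sg0 : (sg != 0)%R by rewrite lt0r_neq0// sqrtr_gt0.
have sg2 : (sg ^+ 2 *+ 2 = s)%R by rewrite sqr_sqrtr ?ltW//; lra.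
have ps0 : (0 < Num.sqrt (pi * s))%R by rewrite sqrtr_gt0 mulr_gt0// pi_gt0.
have pkE : normal_peak sg = ((Num.sqrt (pi * s))^-1)%R.
  by rewrite /normal_peak mulrC -mulrnAr sg2.
have H := integral_normal_pdf a sg; rewrite normal_pdfE// in H.
have E x : (expR (- (x - a) ^+ 2 / s))%:E =
   (Num.sqrt (pi * s))%:E * (normal_peak sg * normal_fun a sg x)%:E.
  by rewrite -EFinM pkE mulrA mulfV ?lt0r_neq0// mul1r /normal_fun sg2.
under eq_integral do rewrite E.
rewrite (ge0_integralZl_EFin _ measurableT _ _ (ltW ps0)); last 2 first.
- by move=> x _; rewrite lee_fin mulr_ge0 ?normal_peak_ge0 ?normal_fun_ge0.
- by apply/measurable_EFinP; apply: measurable_funM => //; exact: measurable_normal_fun.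
by rewrite H mule1.
Qed.

End gaussian.

Section power_integral.
Local Open Scope ereal_scope.
Context d (T : measurableType d) (R : realType).
Variable mu : {sigma_finite_measure set T -> \bar R}.

(** Induction on n: the power measure is the image of a product measure under [tuple_cons], so
    Tonelli's theorem splits off one factor at a time. *)
Lemma integral_power_measure (n : nat) (f : 'I_n -> T -> R) (c : 'I_n -> R) :
  (forall j, measurable_fun setT (f j)) -> (forall j x, 0 <= f j x)%R ->
  (forall j, \int[mu]_x (f j x)%:E = (c j)%:E) ->
  \int[power_measure mu n]_t (\prod_(j < n) f j (tnth t j))%:E = (\prod_(j < n) c j)%:E.
Proof.
elim: n f c => [f c _ _ _|n IH f c mf f0 fc].
  under eq_integral do rewrite big_ord0.
  by rewrite big_ord0 /= integral_dirac// diracT mul1e.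
have mprod m (g : 'I_m -> T -> R) : (forall j, measurable_fun setT (g j)) ->
    measurable_fun setT (fun t : m.-tuple T => (\prod_(j < m) g j (tnth t j))%R).
  move=> mg; apply: measurable_prod => j _.
  by apply: measurableT_comp; [exact: mg|exact: measurable_tnth].
rewrite /= ge0_integral_pushforward//; last 3 first.
- exact: measurable_tuple_cons.
- by apply/measurable_EFinP; exact: mprod.
- by move=> t _; rewrite lee_fin prodr_ge0.
rewrite preimage_setT /sfprod fubini_tonelli1; last 2 first.
- apply/measurable_EFinP.
  exact: (measurableT_comp (mprod _ f mf) (@measurable_tuple_cons _ _ n)).
- by move=> p; rewrite lee_fin prodr_ge0.
rewrite /fubini_F /=.
have E x (t : n.-tuple T) : (\prod_(j < n.+1) f j (tnth (tuple_cons (x, t)) j) =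
   f ord0 x * \prod_(j < n) f (lift ord0 j) (tnth t j))%R.
  by rewrite big_ord_recl tnth0; congr (_ * _)%R; apply: eq_bigr => j _; rewrite tnthS.
have mpr := mprod _ (fun j => f (lift ord0 j)) (fun j => mf (lift ord0 j)).
have inner x : \int[power_measure mu n]_t (\prod_(j < n.+1) f j (tnth (tuple_cons (x, t)) j))%:E =
    (f ord0 x)%:E * (\prod_(j < n) c (lift ord0 j))%:E.
  under eq_integral => t _ do rewrite E EFinM.
  rewrite (ge0_integralZl_EFin _ measurableT _ _ (f0 _ _)); last 2 first.
  - by move=> t _; rewrite lee_fin prodr_ge0.
  - exact/measurable_EFinP.
  by rewrite (IH (fun j => f (lift ord0 j)) (fun j => c (lift ord0 j))).
under eq_integral do rewrite inner.
rewrite ge0_integralZr//; last 3 first.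
- exact/measurable_EFinP.
- by move=> x _; rewrite lee_fin.
- rewrite lee_fin prodr_ge0// => j _; rewrite -lee_fin -fc.
  by apply: integral_ge0 => x _; rewrite lee_fin.
by rewrite fc -EFinM big_ord_recl.
Qed.

End power_integral.

Section gaussian_Cn.
Context {R : realType} {n : nat}.
Local Notation E := ('Cn[R]_n).
Local Notation T := (n.-tuple (R2 R)).
Implicit Types x y : E.

Lemma sqr_enorm x : enorm x ^+ 2 =
  \sum_(j < n) (complex.Re (x ord0 j) ^+ 2 + complex.Im (x ord0 j) ^+ 2).
Proof. by rewrite sqr_sqrtr// sumr_ge0// => j _; rewrite addr_ge0// sqr_ge0. Qed.

Lemma enormB x y : enorm (x - y) = enorm (y - x).
Proof.
congr Num.sqrt; apply: eq_bigr => j _.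
by rewrite !mxE !ReB !ImB -(opprB (complex.Re (y ord0 j))) -(opprB (complex.Im (y ord0 j))) !sqrrN.
Qed.

Lemma integral_gaussian_Cn y (s : R) : 0 < s ->
  (\int[lebesgueCn R n]_t (expR (- enorm (of_tuple t - y) ^+ 2 / s))%:E)%E =
  ((pi * s) ^+ n)%:E.
Proof.
move=> s0.
pose f (j : 'I_n) (p : R2 R) := expR (- (p.1 - complex.Re (y ord0 j)) ^+ 2 / s) *
  expR (- (p.2 - complex.Im (y ord0 j)) ^+ 2 / s).
have fE (t : T) : expR (- enorm (of_tuple t - y) ^+ 2 / s) = \prod_(j < n) f j (tnth t j).
  rewrite sqr_enorm -sumrN mulr_suml expR_sum; apply: eq_bigr => j _.
  by rewrite /f -expRD !mxE ReB ImB/= opprD mulrDl.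
under eq_integral do rewrite fE.
have m1 a := @measurable_gaussian R a s s0.
rewrite (integral_power_measure (c := fun=> pi * s)).
- by rewrite prodr_const card_ord.
- move=> j; apply: measurable_funM.
    by apply: (measurableT_comp (m1 _)).
  by apply: (measurableT_comp (m1 _)).
- by move=> j p; rewrite mulr_ge0 ?expR_ge0.
move=> j; rewrite /sfprod fubini_tonelli1; last 2 first.
- apply/measurable_EFinP; apply: measurable_funM.
    by apply: (measurableT_comp (m1 _)).
  by apply: (measurableT_comp (m1 _)).
- by move=> p; rewrite lee_fin mulr_ge0 ?expR_ge0.
rewrite /fubini_F /f /=.
have mE a : measurable_fun setT (fun x : R => (expR (- (x - a) ^+ 2 / s))%:E).
  exact/measurable_EFinP.
have inner (r : R) : (\int[lebesgue_measure]_z (expR (- (r - complex.Re (y ord0 j)) ^+ 2 / s) *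
    expR (- (z - complex.Im (y ord0 j)) ^+ 2 / s))%:E)%E =
    ((expR (- (r - complex.Re (y ord0 j)) ^+ 2 / s))%:E * (Num.sqrt (pi * s))%:E)%E.
  under eq_integral do rewrite EFinM.
  rewrite (ge0_integralZl_EFin _ measurableT _ _ (expR_ge0 _)) ?integral_gaussian//.
  exact: mE.
under eq_integral do rewrite inner.
rewrite (ge0_integralZr _ measurableT); last 3 first.
- exact: mE.
- by move=> z _; rewrite lee_fin expR_ge0.
- by rewrite lee_fin sqrtr_ge0.
rewrite integral_gaussian// -EFinM -expr2 sqr_sqrtr// mulr_ge0 ?pi_ge0//.
exact: ltW.
Qed.

End gaussian_Cn.

Section schur.
Local Open Scope ereal_scope.
Context d (T : measurableType d) (R : realType).

(** Young's inequality k w <= k (l / 2 + w^2 / (2 l)) is integrated and l is chosen afterwards. No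
    integrability of k w is required: if the right-hand side is finite, l = 1 already shows that the
    left-hand integral is. *)
Lemma cauchy_schwarz_weighted (nu : {measure set T -> \bar R}) (k w : T -> R) (A : R) :
  (0 < A)%R -> measurable_fun setT k -> measurable_fun setT w ->
  (forall x, 0 <= k x)%R -> (forall x, 0 <= w x)%R -> \int[nu]_x (k x)%:E <= A%:E ->
  (\int[nu]_x (k x * w x)%:E) ^+ 2 <= A%:E * \int[nu]_x (k x * w x ^+ 2)%:E.
Proof.
move=> A0 mk mw k0 w0 kA.
have mk2 : measurable_fun setT (fun x => k x * w x ^+ 2)%R.
  by apply: measurable_funM => //; exact: measurable_funX.
have mkw : measurable_fun setT (fun x => k x * w x)%R by exact: measurable_funM.
set B := (X in _ * X); set I := \int[nu]_x _.
have B0 : 0 <= B by apply: integral_ge0 => x _; rewrite lee_fin mulr_ge0// sqr_ge0.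
have I0 : 0 <= I by apply: integral_ge0 => x _; rewrite lee_fin mulr_ge0.
have young (l : R) : (0 < l)%R -> I <= (l / 2)%:E * A%:E + (2 * l)^-1%:E * B.
  move=> l0; have l20 : (0 <= l / 2)%R by lra.
  have l2V : (0 <= (2 * l)^-1)%R by rewrite invr_ge0; lra.
  apply: (@le_trans _ _ (\int[nu]_x ((l / 2)%:E * (k x)%:E + (2 * l)^-1%:E * (k x * w x ^+ 2)%:E))).
    apply: ge0_le_integral => //.
    - by move=> x _; rewrite lee_fin mulr_ge0.
    - exact/measurable_EFinP.
    - by apply: emeasurable_funD; apply: emeasurable_funM => //; exact/measurable_EFinP.
    move=> x _; rewrite -!EFinM -EFinD lee_fin.
    rewrite -subr_ge0 (_ : _ - _ = k x * ((2 * l)^-1 * (w x - l) ^+ 2))%R.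
      by apply: mulr_ge0 => //; apply: mulr_ge0 => //; exact: sqr_ge0.
    by field; rewrite lt0r_neq0.
  rewrite ge0_integralD//; last 4 first.
  - by move=> x _; rewrite -EFinM lee_fin mulr_ge0.
  - by apply: emeasurable_funM => //; exact/measurable_EFinP.
  - by move=> x _; rewrite -EFinM lee_fin !mulr_ge0// sqr_ge0.
  - by apply: emeasurable_funM => //; exact/measurable_EFinP.
  rewrite ge0_integralZl_EFin//; last 2 first.
  - by move=> x _; rewrite lee_fin.
  - exact/measurable_EFinP.
  rewrite ge0_integralZl_EFin//; last 2 first.
  - by move=> x _; rewrite lee_fin mulr_ge0// sqr_ge0.
  - exact/measurable_EFinP.
  by apply: leeD => //; apply: lee_wpmul2l => //; rewrite lee_fin.
clearbody B I; case: B B0 young => [b|_ _|//]; last first.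
  by rewrite gt0_muley ?leey// lte_fin.
rewrite lee_fin => b0 young.
case: I I0 young => [i|_ /(_ 1%R ltr01)|//]; last by rewrite -!EFinM -EFinD leye_eq.
rewrite lee_fin => i0 young; rewrite -EFin_expe -EFinM lee_fin.
move: i0; rewrite le_eqVlt => /predU1P[<-|i0].
  by rewrite expr0n/= mulr_ge0// ltW.
(* For l = I / A the first term is I / 2, leaving I / 2 <= A B / (2 I), which is the claim. *)
have := young _ (divr_gt0 i0 A0); rewrite -!EFinM -EFinD lee_fin.
rewrite (_ : (i / A / 2 * A = i / 2)%R); last by field; rewrite lt0r_neq0.
rewrite (_ : ((2 * (i / A))^-1 * b = (A * b) / (2 * i))%R); last first.
  by field; rewrite !lt0r_neq0.
move=> H; have : (i / 2 <= A * b / (2 * i))%R by lra.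
by rewrite ler_pdivlMr ?mulr_gt0// (_ : (i / 2 * (2 * i) = i ^+ 2)%R)//; field.
Qed.

(** Cauchy-Schwarz in y against the measure k(x, y) dy uses one marginal bound, and after exchanging
    the integrals the other marginal bound supplies the second factor A. *)
Lemma schur_test (mu : {sigma_finite_measure set T -> \bar R}) (k : T * T -> R)
    (w : T -> R) (A : R) (D : set T) : (0 < A)%R ->
  measurable_fun setT k -> measurable_fun setT w ->
  (forall p, 0 <= k p)%R -> (forall x, 0 <= w x)%R ->
  (forall x, \int[mu]_y (k (x, y))%:E <= A%:E) ->
  (forall y, \int[mu]_x (k (x, y))%:E <= A%:E) -> measurable D ->
  \int[mu]_(x in D) (\int[mu]_y (k (x, y) * w y)%:E) ^+ 2 <=
  (A ^+ 2)%:E * \int[mu]_y (w y ^+ 2)%:E.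
Proof.
move=> A0 mk mw k0 w0 kx ky mD.
have mkx x : measurable_fun setT (fun y => k (x, y)).
  exact: (measurableT_comp mk (measurable_pair1 x)).
have mky y : measurable_fun setT (fun x => k (x, y)).
  exact: (measurableT_comp mk (measurable_pair2 y)).
have mw2 : measurable_fun setT (fun p : T * T => w p.2) by exact: measurableT_comp.
have mkw : measurable_fun setT (fun p : T * T => (k p * w p.2)%:E).
  by apply/measurable_EFinP; exact: measurable_funM.
have mkw2 : measurable_fun setT (fun p : T * T => (k p * w p.2 ^+ 2)%:E).
  by apply/measurable_EFinP; apply: measurable_funM => //; exact: measurable_funX.
have mI : measurable_fun setT (fun x => \int[mu]_y (k (x, y) * w y)%:E).
  apply: (measurable_fun_fubini_tonelli_F (fun p : T * T => (k p * w p.2)%:E)) => //.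
  by move=> p; rewrite lee_fin mulr_ge0.
have mI2 : measurable_fun setT (fun x => \int[mu]_y (k (x, y) * w y ^+ 2)%:E).
  apply: (measurable_fun_fubini_tonelli_F (fun p : T * T => (k p * w p.2 ^+ 2)%:E)) => //.
  by move=> p; rewrite lee_fin mulr_ge0// sqr_ge0.
have mIsq : measurable_fun setT (fun x => (\int[mu]_y (k (x, y) * w y)%:E) ^+ 2).
  by under eq_fun do rewrite expe2; exact: emeasurable_funM.
apply: (@le_trans _ _ (\int[mu]_x (\int[mu]_y (k (x, y) * w y)%:E) ^+ 2)).
  by apply: ge0_subset_integral => // x _; exact: sqre_ge0.
apply: (@le_trans _ _ (\int[mu]_x (A%:E * \int[mu]_y (k (x, y) * w y ^+ 2)%:E))).
  apply: ge0_le_integral => //.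
  - by move=> x _; exact: sqre_ge0.
  - exact: emeasurable_funM.
  - by move=> x _; apply: cauchy_schwarz_weighted.
have A0' := ltW A0.
rewrite ge0_integralZl_EFin//; last first.
  by move=> x _; apply: integral_ge0 => y _; rewrite lee_fin mulr_ge0// sqr_ge0.
rewrite (fubini_tonelli (fun p : T * T => (k p * w p.2 ^+ 2)%:E))//; last first.
  by move=> p; rewrite lee_fin mulr_ge0// sqr_ge0.
rewrite expr2 EFinM -muleA; apply: lee_wpmul2l; first by rewrite lee_fin.
rewrite -ge0_integralZl_EFin//; last 2 first.
- by move=> x _; rewrite lee_fin sqr_ge0.
- by apply/measurable_EFinP; exact: measurable_funX.
apply: ge0_le_integral => //=.
- by move=> y _; apply: integral_ge0 => x _; rewrite lee_fin mulr_ge0// sqr_ge0.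
- apply: (measurable_fun_fubini_tonelli_G (fun p : T * T => (k p * w p.2 ^+ 2)%:E)) => //.
  by move=> p; rewrite lee_fin mulr_ge0// sqr_ge0.
- by apply: emeasurable_funM => //; apply/measurable_EFinP; exact: measurable_funX.
move=> y _; under eq_integral do rewrite mulrC EFinM.
rewrite ge0_integralZl_EFin ?sqr_ge0//; last 2 first.
- by move=> x _; rewrite lee_fin.
- exact/measurable_EFinP.
by rewrite muleC; apply: lee_wpmul2r => //; rewrite lee_fin sqr_ge0.
Qed.

End schur.

Section partial_integral.
Local Open Scope ereal_scope.
Context d (T : measurableType d) (R : realType).
Variable mu : {sigma_finite_measure set T -> \bar R}.

Lemma restrict_setX (D : set T) (F : T * T -> R) x : D x ->
  (fun y => ((EFin \o F) \_ (D `*` D)) (x, y)) = (fun y => (F (x, y))%:E) \_ D.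
Proof.
move=> Dx; apply/funext => y; rewrite /patch.
have [Dy|Dy] := boolP (y \in D).
  by rewrite ifT//; move/set_mem : Dy => Dy; apply/mem_set.
by rewrite ifF//; apply/negbTE; apply: contra Dy => /set_mem[_ Dy]; exact/mem_set.
Qed.

(** Tonelli gives measurability in the parameter for nonnegative functions on the whole product, so
    F is extended by zero and split into positive and negative parts. *)
Lemma measurable_partial_Rintegral (D : set T) (F : T * T -> R) : measurable D ->
  measurable_fun (D `*` D) F ->
  measurable_fun D (fun x => (\int[mu]_(y in D) F (x, y))%R).
Proof.
move=> mD mF.
have mDD : measurable (D `*` D) by exact: measurableX.
pose G := (EFin \o F) \_ (D `*` D).
have mG : measurable_fun setT G by apply/(measurable_restrictT _ mDD)/measurable_EFinP.
have H : measurable_fun setT (fun x => \int[mu]_y G (x, y)).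
  have mp := measurable_fun_fubini_tonelli_F (m2 := mu) _ (measurable_funepos mG) (funepos_ge0 G).
  have mn := measurable_fun_fubini_tonelli_F (m2 := mu) _ (measurable_funeneg mG) (funeneg_ge0 G).
  apply: eq_measurable_fun (emeasurable_funB mp mn) => x _.
  by rewrite /fubini_F [RHS]integralE; congr (_ - _); apply: eq_integral => y _; rewrite ?funeposE ?funenegE.
apply: (@eq_measurable_fun _ _ _ _ _ (fun x => fine (\int[mu]_y G (x, y)))).
  move=> x /set_mem Dx; rewrite /Rintegral integral_mkcond; congr fine.
  by rewrite -restrict_setX.
apply: measurable_funTS; exact: (measurableT_comp (fine_measurable measurableT) H).
Qed.

End partial_integral.

Lemma cvg_bigsum (K : numFieldType) (V : normedModType K) (S I : Type) (F : set_system S)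
    (FF : Filter F) (r : seq I) (f : I -> S -> V) (l : I -> V) :
  (forall i, f i @ F --> l i) ->
  (fun s => \sum_(i <- r) f i s) @ F --> \sum_(i <- r) l i.
Proof.
move=> H; elim: r => [|i r IH].
  by rewrite big_nil; under eq_cvg do rewrite big_nil; exact: cvg_cst.
rewrite big_cons; under eq_cvg do rewrite big_cons.
exact: (cvgD (H i) IH).
Qed.

(** * Measurability of kernel operators and the weighted L^2 bound *)

Section kernel_operators.
Context {R : realType} {n : nat}.
Local Notation E := ('Cn[R]_n).
Local Notation T := (n.-tuple (R2 R)).
Local Notation L := (lebesgueCn R n).
Local Notation pt := (of_tuple : T -> E).
Implicit Types (Omega U : set E) (u v : E -> R[i]) (K : E -> E -> R[i]) (Phi : E -> R).

Lemma measurable_sqrt : measurable_fun setT (Num.sqrt : R -> R).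
Proof. by apply: continuous_measurable_fun; exact: sqrt_continuous. Qed.

Lemma measurable_cabs d (S : measurableType d) (D : set S) (f : S -> R[i]) : measurable D ->
  measurable_fun D (fun t => complex.Re (f t)) -> measurable_fun D (fun t => complex.Im (f t)) ->
  measurable_fun D (fun t => cabs (f t)).
Proof.
move=> mD mR mI.
rewrite (_ : (fun t => _) = (fun t => Num.sqrt (complex.Re (f t) ^+ 2 + complex.Im (f t) ^+ 2))).
  apply: (measurableT_comp measurable_sqrt).
  by apply: measurable_funD; exact: measurable_funX.
by apply/funext => t; case: (f t).
Qed.

Lemma measurable_Re_mul d (S : measurableType d) (D : set S) (f g : S -> R[i]) :
  measurable_fun D (fun t => complex.Re (f t)) -> measurable_fun D (fun t => complex.Im (f t)) ->
  measurable_fun D (fun t => complex.Re (g t)) -> measurable_fun D (fun t => complex.Im (g t)) ->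
  measurable_fun D (fun t => complex.Re (f t * g t)) /\
  measurable_fun D (fun t => complex.Im (f t * g t)).
Proof.
move=> fR fI gR gI; split.
  by under eq_fun do rewrite ReM; apply: measurable_funB; exact: measurable_funM.
by under eq_fun do rewrite ImM; apply: measurable_funD; exact: measurable_funM.
Qed.

Lemma measurable_setX2 d (S : measurableType d) (D : set S) (f : S -> R) : measurable D ->
  measurable_fun D f -> measurable_fun (D `*` D) (fun p => f p.2).
Proof.
move=> mD mf; apply: (@measurable_comp _ _ _ _ _ _ D f _ snd) => //.
- by move=> _ [[x y] [/= Dx Dy] <-].
- by apply: measurable_funTS; exact: measurable_snd.
Qed.

Lemma measurable_setX1 d (S : measurableType d) (D : set S) (f : S -> R) : measurable D ->
  measurable_fun D f -> measurable_fun (D `*` D) (fun p => f p.1).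
Proof.
move=> mD mf; apply: (@measurable_comp _ _ _ _ _ _ D f _ fst) => //.
- by move=> _ [[x y] [/= Dx Dy] <-].
- by apply: measurable_funTS; exact: measurable_fst.
Qed.

Definition cts_kernel Omega K := forall p : E * E, (Omega `*` Omega) p ->
  {for p, continuous (fun p => K p.1 p.2)}.

Lemma measurable_kernel Omega K : open Omega -> cts_kernel Omega K ->
  let D := pt @^-1` Omega in
  measurable_fun (D `*` D) (fun p => complex.Re (K (pt p.1) (pt p.2))) /\
  measurable_fun (D `*` D) (fun p => complex.Im (K (pt p.1) (pt p.2))).
Proof.
move=> oO cK D.
have oOO : open (Omega `*` Omega).
  by rewrite openE => -[x y] [/= Ox Oy]; exists (Omega, Omega) => //; split; exact: open_nbhs_nbhs.
split.
  have H := @cts_measurable2 R n _ (fun p => complex.Re (K p.1 p.2)) oOO.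
  by apply: H => p /cK; exact: cvg_Re.
have H := @cts_measurable2 R n _ (fun p => complex.Im (K p.1 p.2)) oOO.
by apply: H => p /cK; exact: cvg_Im.
Qed.

Lemma measurable_kernel_fun Omega K u : open Omega -> cts_kernel Omega K ->
  cmeasurable_on Omega u -> let D := pt @^-1` Omega in
  measurable_fun (D `*` D) (fun p => complex.Re (K (pt p.1) (pt p.2) * u (pt p.2))) /\
  measurable_fun (D `*` D) (fun p => complex.Im (K (pt p.1) (pt p.2) * u (pt p.2))).
Proof.
move=> oO cK [uR uI] D; have [KR KI] := measurable_kernel oO cK.
have mD : measurable D by exact: measurable_open.
apply: measurable_Re_mul => //.
  exact: (measurable_setX2 mD uR).
exact: (measurable_setX2 mD uI).
Qed.

Lemma measurable_slice d (S : measurableType d) (D : set S) (f : S * S -> R) x : measurable D ->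
  D x -> measurable_fun (D `*` D) f -> measurable_fun D (fun y => f (x, y)).
Proof.
move=> mD Dx mf; apply: (@measurable_comp _ _ _ _ _ _ (D `*` D) f _ (pair x)) => //.
- exact: measurableX.
- by move=> _ [y Dy <-].
- by apply: measurable_funTS; exact: measurable_pair1.
Qed.

Lemma cmeasurable_kernel_op Omega K u : open Omega -> cts_kernel Omega K ->
  cmeasurable_on Omega u ->
  cmeasurable_on Omega (fun x => cintegral Omega (fun y => K x y * u y)).
Proof.
move=> oO cK mu; have [mR mI] := measurable_kernel_fun oO cK mu.
have mD : measurable (pt @^-1` Omega) by exact: measurable_open.
split.
  exact: (@measurable_partial_Rintegral _ _ _ L _ _ mD mR).
exact: (@measurable_partial_Rintegral _ _ _ L _ _ mD mI).
Qed.

Lemma L2normE Phi h U u : L2norm Phi h U u = sqrte (\int[L]_(t in pt @^-1` U)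
  (cabs (u (pt t)) ^+ 2 * expR (- 2 * Phi (pt t) / h))%:E)%E.
Proof. by congr sqrte; apply: eq_integral => t _; rewrite sqr_cabs. Qed.

Lemma expR_sqr (a h : R) : expR (- 2 * a / h) = expR (- a / h) ^+ 2.
Proof. by rewrite expr2 -expRD; congr expR; rewrite -mulrDl; congr (_ / _); ring. Qed.

(** Absorbing the weights into u and into the image leaves the kernel C times a Gaussian, both of
    whose marginals have mass C (pi s)^n. The factor sqrt 2 arises because the real and imaginary
    parts of the image are estimated separately by the same quantity. The bound is asked of the
    product K u for almost every y, so that the vanishing of u off its support and of K off U1 can
    both be used. *)
Lemma kernel_L2_bound Omega U1 U2 (Phi1 Phi2 : E -> R) K u (h C s : R) :
  open Omega -> open U1 -> open U2 -> U1 `<=` Omega -> U2 `<=` Omega ->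
  (forall x, Omega x -> {for x, continuous Phi1}) ->
  (forall x, Omega x -> {for x, continuous Phi2}) ->
  cts_kernel Omega K -> cmeasurable_on Omega u -> 0 < C -> 0 < s ->
  {ae L, forall t, Omega (pt t) -> forall x, U2 x ->
    cabs (K x (pt t) * u (pt t)) <= C * expR ((Phi2 x - Phi1 (pt t)) / h) *
      expR (- enorm (x - pt t) ^+ 2 / s) * (if pt t \in U1 then cabs (u (pt t)) else 0)} ->
  (L2norm Phi2 h U2 (fun x => cintegral Omega (fun y => K x y * u y))%R <=
    (Num.sqrt 2 * (C * (pi * s) ^+ n))%:E * L2norm Phi1 h U1 u)%E.
Proof.
move=> oO o1 o2 s1 s2 cP1 cP2 cK mu C0 s0 bound.
set D := pt @^-1` Omega; set D1 := pt @^-1` U1; set D2 := pt @^-1` U2.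
have mD : measurable D by exact: measurable_open.
have mD1 : measurable D1 by exact: measurable_open.
have mD2 : measurable D2 by exact: measurable_open.
have [muR muI] := mu.
have mcu : measurable_fun D (fun t => cabs (u (pt t))) by exact: measurable_cabs.
have mweight U (P : E -> R) (c : R) : open U -> U `<=` Omega -> (forall x, Omega x -> {for x, continuous P}) ->
    measurable_fun (pt @^-1` U) (fun t => expR (c * P (pt t) / h)).
  move=> oU UO cP; apply: measurableT_comp => //; apply: measurable_funM => //.
  apply: measurable_funM => //.
  by apply: (cts_measurable (U := U)) => // x /UO/cP.
pose w := (fun t => cabs (u (pt t)) * expR (- Phi1 (pt t) / h)) \_ D1.
pose k (p : T * T) := C * expR (- enorm (pt p.1 - pt p.2) ^+ 2 / s).
have w0 t : 0 <= w t.
  by rewrite /w /patch; case: ifPn => // _; rewrite mulr_ge0 ?cabs_ge0 ?expR_ge0.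
have k0 p : 0 <= k p by rewrite mulr_ge0 ?expR_ge0// ltW.
have mw : measurable_fun setT w.
  apply/(measurable_restrictT _ mD1); apply: measurable_funM.
    exact: (measurable_funS mD (fun t => s1 (pt t)) mcu).
  by have := mweight U1 Phi1 (-1) o1 s1 cP1; under eq_fun do rewrite mulN1r.
have mk : measurable_fun setT k.
  apply: measurable_funM => //; apply: measurableT_comp => //.
  have cC (j : 'I_n) : continuous (fun p : E * E => p.1 ord0 j - p.2 ord0 j).
    move=> p; apply: cvgB.
      by apply: (cvg_comp fst (fun x : E => x ord0 j)); [exact: cvg_fst|exact: coord_continuous].
    by apply: (cvg_comp snd (fun x : E => x ord0 j)); [exact: cvg_snd|exact: coord_continuous].
  have := @cts_measurable2 R n setT (fun p => - enorm (p.1 - p.2) ^+ 2 / s) openT.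
  apply => p _; apply: cvgM; last exact: cvg_cst.
  apply: cvgN; rewrite sqr_enorm; under eq_cvg do rewrite sqr_enorm.
  apply: cvg_bigsum => j; under eq_cvg do rewrite !mxE; rewrite !mxE.
  by apply: cvgD; [apply: cvgM; apply: cvg_Re; exact: cC|apply: cvgM; apply: cvg_Im; exact: cC].
have A0 : 0 < C * (pi * s) ^+ n by rewrite mulr_gt0// exprn_gt0// mulr_gt0// pi_gt0.
have ky t : (\int[L]_x (k (x, t))%:E)%E = (C * (pi * s) ^+ n)%:E.
  rewrite /k /=; under eq_integral do rewrite EFinM.
  rewrite (ge0_integralZl_EFin _ measurableT _ _ (ltW C0)); last 2 first.
  - by move=> x _; rewrite lee_fin expR_ge0.
  - apply/measurable_EFinP.
    have /(measurable_funM (measurable_cst C^-1)) := measurableT_comp mk (measurable_pair2 t).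
    by apply: eq_measurable_fun => x _; rewrite /= /k /= mulKf// lt0r_neq0.
  by rewrite integral_gaussian_Cn.
have kx t : (\int[L]_x (k (t, x))%:E)%E = (C * (pi * s) ^+ n)%:E.
  by rewrite -(ky t); apply: eq_integral => x _; rewrite /k /= enormB.
rewrite !L2normE -/D1 -/D2.
have wE : (\int[L]_y (w y ^+ 2)%:E = \int[L]_(t in D1) (cabs (u (pt t)) ^+ 2 * expR (- 2 * Phi1 (pt t) / h))%:E)%E.
  rewrite [RHS]integral_mkcond; apply: eq_integral => t _; rewrite /w /patch.
  by case: ifPn => _; [rewrite exprMn expR_sqr|rewrite expr0n].
rewrite -wE -[X in (X%:E * _)%E](_ : Num.sqrt (2 * (C * (pi * s) ^+ n) ^+ 2) = _); last first.
  by rewrite sqrtrM// sqrtr_sqr gtr0_norm.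
rewrite -[(Num.sqrt _)%:E]/(sqrte _%:E) -sqrteM; last by rewrite lee_fin mulr_ge0// sqr_ge0.
have iw0 : (0 <= \int[L]_y (w y ^+ 2)%:E)%E.
  by apply: integral_ge0 => t _; rewrite lee_fin sqr_ge0.
rewrite lee_sqrt; last by rewrite mule_ge0// lee_fin mulr_ge0// sqr_ge0.
have kx' t : (\int[L]_x (k (t, x))%:E <= (C * (pi * s) ^+ n)%:E)%E by rewrite kx.
have ky' t : (\int[L]_x (k (x, t))%:E <= (C * (pi * s) ^+ n)%:E)%E by rewrite ky.
have schur := schur_test A0 mk mw k0 w0 kx' ky' mD2.
rewrite EFinM -muleA; apply: le_trans (lee_wpmul2l _ schur); last by rewrite lee_fin.
have mIw : measurable_fun setT (fun x => \int[L]_y (k (x, y) * w y)%:E)%E.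
  apply: (measurable_fun_fubini_tonelli_F (fun p : T * T => (k p * w p.2)%:E)%E) => //.
    apply/measurable_EFinP; apply: measurable_funM => //; exact: measurableT_comp.
  by move=> p; rewrite lee_fin mulr_ge0.
have mIsq : measurable_fun D2 (fun x => (\int[L]_y (k (x, y) * w y)%:E) ^+ 2)%E.
  by apply: measurable_funTS; under eq_fun do rewrite expe2; exact: emeasurable_funM.
rewrite -ge0_integralZl_EFin//; last by move=> x _; exact: sqre_ge0.
have [mAR mAI] := cmeasurable_kernel_op oO cK mu.
apply: ge0_le_integral => //.
- by move=> t _; rewrite lee_fin mulr_ge0 ?expR_ge0 ?sqr_ge0.
- apply/measurable_EFinP; apply: measurable_funM; last exact: (mweight _ Phi2 _ o2 s2 cP2).
  by apply: measurable_funX; apply: (measurable_funS mD (fun t => s2 (pt t))); exact: (measurable_cabs mD mAR mAI).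
- exact: emeasurable_funM.
move=> t Ut.
have Dt : D t by exact: s2.
set I := (\int[L]_y _)%E.
have I0 : (0 <= I)%E by apply: integral_ge0 => y _; rewrite lee_fin mulr_ge0.
have [mKR mKI] := measurable_kernel_fun oO cK mu.
have {}mKR := measurable_slice mD Dt mKR; have {}mKI := measurable_slice mD Dt mKI.
have mKc : measurable_fun D (fun y => cabs (K (pt t) (pt y) * u (pt y))) by exact: measurable_cabs.
have mkt : measurable_fun setT (fun y => k (t, y)) by exact: (measurableT_comp mk (measurable_pair1 t)).
have mkw : measurable_fun setT (fun y => (k (t, y) * w y)%:E).
  by apply/measurable_EFinP; exact: measurable_funM.
have bI : (\int[L]_(y in D) (cabs (K (pt t) (pt y) * u (pt y)))%:E <= (expR (Phi2 (pt t) / h))%:E * I)%E.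
  apply: (@le_trans _ _ (\int[L]_(y in D) ((expR (Phi2 (pt t) / h))%:E * (k (t, y) * w y)%:E))%E).
    apply: ae_ge0_le_integral => //.
    - by move=> y _; rewrite lee_fin cabs_ge0.
    - exact/measurable_EFinP.
    - by move=> y _; rewrite -EFinM lee_fin; apply: mulr_ge0; [exact: expR_ge0|exact: mulr_ge0].
    - by apply: measurable_funTS; exact: (emeasurable_funM (measurable_cst _) mkw).
    apply: filterS bound => y by_ Dy; rewrite -EFinM lee_fin.
    apply: le_trans (by_ Dy _ Ut) _; rewrite /k /w /patch /=.
    rewrite (_ : (y \in D1) = (pt y \in U1)); last by apply/idP/idP => /set_mem ?; exact/mem_set.
    case: ifPn => _; last by rewrite !mulr0.
    rewrite mulrBl expRD -mulNr le_eqVlt; apply/orP; left; apply/eqP; ring.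
  rewrite -(ge0_integralZl_EFin _ measurableT _ mkw (expR_ge0 _)); last first.
    by move=> y _; rewrite lee_fin mulr_ge0.
  apply: ge0_subset_integral => //.
  - exact: (emeasurable_funM (measurable_cst _) mkw).
  - by move=> y _; rewrite -EFinM lee_fin; apply: mulr_ge0; [exact: expR_ge0|exact: mulr_ge0].
have absR (g : T -> R) : measurable_fun D g -> (forall y, `|g y| <= cabs (K (pt t) (pt y) * u (pt y))) ->
    ((`|\int[L]_(y in D) g y|)%:E <= (expR (Phi2 (pt t) / h))%:E * I)%E.
  move=> mg gle; apply: le_trans bI.
  apply: (@le_trans _ _ (`|\int[L]_(y in D) (g y)%:E|)%E).
    (* At an infinite integral [fine] returns 0, so the inequality holds there as well and no
       integrability of g has to be known. *)
    rewrite /Rintegral; case: (\int[L]_(y in D) _)%E => [r| |] //=; by rewrite normr0 leey.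
  apply: le_trans (le_abse_integral _ mD _) _; first exact/measurable_EFinP.
  apply: ge0_le_integral => //.
  - by apply/measurable_EFinP; apply: measurableT_comp.
  - exact/measurable_EFinP.
  - by move=> y _; rewrite lee_fin.
have hR := absR _ mKR (fun y => Re_le_cabs _).
have hI := absR _ mKI (fun y => Im_le_cabs _).
rewrite sqr_cabs /= expR_sqr; clearbody I.
case: I I0 hR hI {bI absR} => [i| _ _ _|//]; last first.
  by rewrite mulyy gt0_muley ?leey// lte_fin.
rewrite lee_fin => i0; rewrite -EFinM !lee_fin => hR hI.
set a := Rintegral _ _ _ in hR *; set b := Rintegral _ _ _ in hI *.
have e0 : 0 < expR (Phi2 (pt t) / h) by exact: expR_gt0.
have ea : a ^+ 2 <= (expR (Phi2 (pt t) / h) * i) ^+ 2.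
  by rewrite -[leLHS]real_normK ?num_real// ler_pXn2r ?nnegrE// mulr_ge0// ltW.
have eb : b ^+ 2 <= (expR (Phi2 (pt t) / h) * i) ^+ 2.
  by rewrite -[leLHS]real_normK ?num_real// ler_pXn2r ?nnegrE// mulr_ge0// ltW.
apply: (@le_trans _ _ (2 * (expR (Phi2 (pt t) / h) * i) ^+ 2 * expR (- Phi2 (pt t) / h) ^+ 2)).
  by apply: ler_wpM2r; [exact: sqr_ge0|lra].
rewrite mulNr expRN; set X := expR _ in e0 *.
rewrite le_eqVlt; apply/orP; left; apply/eqP; field; exact: lt0r_neq0.
Qed.

End kernel_operators.

Lemma cts_bounded (R : realType) (X : topologicalType) (f : X -> R) (A : set X) :
  compact A -> (forall x, A x -> {for x, continuous f}) ->
  exists2 M, 0 < M & forall x, A x -> `|f x| <= M.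
Proof.
move=> cA cf.
have /compact_bounded[M [_ H]] : compact (f @` A).
  by apply: continuous_compact => //; apply: continuous_in_subspaceT => x /set_mem; exact: cf.
exists (`|M| + 1) => [|x Ax]; first by rewrite ltr_wpDl.
by apply: (H (`|M| + 1)); [rewrite ltr_pwDr// ler_norm|exists x].
Qed.

(** * Local integrability and the calculus of complex-valued integrals *)

Section local_integrability.
Context {R : realType} {n : nat}.
Local Notation E := ('Cn[R]_n).
Local Notation T := (n.-tuple (R2 R)).
Local Notation L := (lebesgueCn R n).
Local Notation pt := (of_tuple : T -> E).
Implicit Types (Omega U : set E) (u v F : E -> R[i]) (K : E -> E -> R[i]) (Phi : E -> R).

Lemma enorm_continuous : continuous (@enorm R n).
Proof.
move=> x.
have H : (fun x : E => \sum_(j < n) (complex.Re (x ord0 j) ^+ 2 + complex.Im (x ord0 j) ^+ 2)) y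
    @[y --> x] --> \sum_(j < n) (complex.Re (x ord0 j) ^+ 2 + complex.Im (x ord0 j) ^+ 2).
  apply: (cvg_bigsum (nbhs_filter x)) => j.
  have cj : (fun y : E => y ord0 j) y @[y --> x] --> x ord0 j by exact: coord_continuous.
  have cR := cvg_Re (nbhs_filter x) cj; have cI := cvg_Im (nbhs_filter x) cj.
  exact: (cvgD (cvgM cR cR) (cvgM cI cI)).
exact: (cvg_comp _ _ H (@sqrt_continuous R _)).
Qed.

(** On a bounded set the constant 1 lies below e^{M^2} times the Gaussian e^{-|x|^2}, whose integral
    has been computed. *)
Lemma relcompact_finite Omega U : relcompact U Omega -> (L (pt @^-1` U) < +oo)%E.
Proof.
move=> [oU cU _]; have mU : measurable (pt @^-1` U) by exact: measurable_open.
have [M M0 HM] := cts_bounded cU (fun x _ => @enorm_continuous x).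
rewrite -[X in (X < _)%E]mul1e -(integral_cst _ mU).
have mg : measurable_fun setT (fun t : T => (expR (- enorm (pt t - 0) ^+ 2 / 1))%:E).
  under eq_fun do rewrite subr0 divr1.
  apply/measurable_EFinP; apply: measurableT_comp => //.
  have := @cts_measurable R n setT (fun x => - enorm x ^+ 2) openT.
  by apply => x _; have ce := @enorm_continuous x; exact: (cvgN (cvgM ce ce)).
apply: (@le_lt_trans _ _ (\int[L]_(t in pt @^-1` U) ((expR (M ^+ 2))%:E * (expR (- enorm (pt t - 0) ^+ 2 / 1))%:E))%E).
  apply: ge0_le_integral => //.
  - by apply: measurable_funTS; exact: (emeasurable_funM (measurable_cst _) mg).
  - move=> t Ut; rewrite -EFinM lee_fin -expRD -[leLHS]expR0 ler_expR divr1 subr0.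
    have e0 : 0 <= enorm (pt t) by exact: sqrtr_ge0.
    have := HM (pt t) (@subset_closure _ _ _ Ut); rewrite ger0_norm// => eM.
    rewrite subr_ge0 ler_pXn2r// nnegrE; exact: ltW.
apply: (@le_lt_trans _ _ (\int[L]_t ((expR (M ^+ 2))%:E * (expR (- enorm (pt t - 0) ^+ 2 / 1))%:E))%E).
  by apply: ge0_subset_integral => //; exact: (emeasurable_funM (measurable_cst _) mg).
rewrite (ge0_integralZl_EFin _ measurableT _ mg (expR_ge0 _)); last by move=> t _; rewrite lee_fin expR_ge0.
by rewrite integral_gaussian_Cn// -EFinM ltry.
Qed.

(** L^2 is contained in L^1 on a set of finite measure, by |u| <= 1 + |u|^2. The zero extension from
    U to Omega has the form in which it serves as a majorant. *)
Lemma L2loc_integrable Omega U u : open Omega -> L2loc Omega u -> relcompact U Omega ->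
  L.-integrable (pt @^-1` Omega) (EFin \o ((fun t => cabs (u (pt t))) \_ (pt @^-1` U))).
Proof.
move=> oO [[uR uI] uL] rU; have [oU _ sU] := rU.
have UO : U `<=` Omega := subset_trans (@subset_closure _ U) sU.
have mU : measurable (pt @^-1` U) by exact: measurable_open.
have mO : measurable (pt @^-1` Omega) by exact: measurable_open.
have mcO : measurable_fun (pt @^-1` Omega) (fun t => cabs (u (pt t))) by exact: measurable_cabs.
have mcU : measurable_fun (pt @^-1` U) (fun t => cabs (u (pt t))).
  exact: (measurable_funS mO (fun t => UO (pt t)) mcO).
have mr : measurable_fun setT ((fun t => cabs (u (pt t))) \_ (pt @^-1` U)).
  exact/(measurable_restrictT _ mU).
apply/integrableP; split; first by apply/measurable_EFinP; exact: measurable_funTS.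
have L2 : (\int[L]_(t in pt @^-1` U) (cabs (u (pt t)) ^+ 2)%:E < +oo)%E.
  have := uL U rU; rewrite L2normE.
  under eq_integral do rewrite mulr0 mul0r expR0 mulr1.
  set I := (\int[L]_(t in _) _)%E.
  have I0 : (0 <= I)%E by apply: integral_ge0 => t _; rewrite lee_fin sqr_ge0.
  have H : (sqrte I \is a fin_num) = (I \is a fin_num) := sqrte_fin_num I0.
  rewrite -(@ge0_fin_numE _ (sqrte I)) ?sqrte_ge0// H => If.
  by rewrite -ge0_fin_numE.
apply: (@le_lt_trans _ _ (\int[L]_(t in pt @^-1` U) (cabs (u (pt t)))%:E)%E).
  rewrite [leRHS]integral_mkcond [leLHS]integral_mkcond.
  apply: ge0_le_integral => //.
  - by move=> t _; rewrite /patch; case: ifP.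
  - apply/(measurable_restrictT _ mO); apply: measurableT_comp => //.
    by apply/measurable_EFinP; exact: measurable_funTS.
  - by apply/(measurable_restrictT _ mU)/measurable_EFinP.
  move=> t _; rewrite /patch /=; case: ifP => _; last by case: ifP => //; rewrite lee_fin cabs_ge0.
  by case: ifP => _; rewrite lee_fin ?normr0// ger0_norm ?cabs_ge0.
apply: (@le_lt_trans _ _ (\int[L]_(t in pt @^-1` U) (1%:E + (cabs (u (pt t)) ^+ 2)%:E))%E).
  apply: ge0_le_integral => //.
  - by move=> t _; rewrite lee_fin cabs_ge0.
  - exact/measurable_EFinP.
  - by apply: emeasurable_funD => //; apply/measurable_EFinP; exact: measurable_funX.
  move=> t _; rewrite -EFinD lee_fin; set c := cabs _.
  have := sqr_ge0 (c - 2^-1); rewrite sqrrB; lra.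
rewrite ge0_integralD//; last 2 first.
- by move=> t _; rewrite lee_fin sqr_ge0.
- by apply/measurable_EFinP; exact: measurable_funX.
apply: lte_add_pinfty => //.
by rewrite integral_cst// mul1e; exact: relcompact_finite rU.
Qed.

Definition cintegrable U F := L.-integrable (pt @^-1` U) (EFin \o (fun t => complex.Re (F (pt t)))) /\
  L.-integrable (pt @^-1` U) (EFin \o (fun t => complex.Im (F (pt t)))).

Lemma cintegrable_le U F (b : T -> R) : open U -> cmeasurable_on U F ->
  L.-integrable (pt @^-1` U) (EFin \o b) -> (forall t, U (pt t) -> cabs (F (pt t)) <= b t) ->
  cintegrable U F.
Proof.
move=> oU [FR FI] ib Fb; have mU : measurable (pt @^-1` U) by exact: measurable_open.
split; apply: (le_integrable mU _ _ ib); first exact/measurable_EFinP.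
- move=> t Ut; rewrite /= lee_fin; apply: le_trans (Re_le_cabs _) _.
  by apply: le_trans (Fb t Ut) (ler_norm _).
- exact/measurable_EFinP.
- move=> t Ut; rewrite /= lee_fin; apply: le_trans (Im_le_cabs _) _.
  by apply: le_trans (Fb t Ut) (ler_norm _).
Qed.

Let iZ (D : set T) (k : R) (f : T -> R) : measurable D -> L.-integrable D (EFin \o f) ->
  L.-integrable D (EFin \o (fun t => k * f t)).
Proof. by move=> mD ih; have := integrableZl mD k ih. Qed.

Lemma cintegralZ U c F : open U -> cintegrable U F ->
  cintegral U (fun y => c * F y) = c * cintegral U F.
Proof.
move=> oU [FR FI]; have mU : measurable (pt @^-1` U) by exact: measurable_open.
apply: complexP; rewrite /cintegral ?ReM ?ImM/=.
  under eq_Rintegral do rewrite ReM.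
  by rewrite RintegralB ?RintegralZl//; exact: iZ.
under eq_Rintegral do rewrite ImM.
by rewrite RintegralD ?RintegralZl//; exact: iZ.
Qed.

Lemma cintegralD U F G : open U -> cintegrable U F -> cintegrable U G ->
  cintegral U (fun y => F y + G y) = cintegral U F + cintegral U G.
Proof.
move=> oU [FR FI] [GR GI]; have mU : measurable (pt @^-1` U) by exact: measurable_open.
apply: complexP; rewrite /cintegral ?ReD ?ImD/=.
  by under eq_Rintegral do rewrite ReD; rewrite RintegralD.
by under eq_Rintegral do rewrite ImD; rewrite RintegralD.
Qed.

Lemma cintegralJ U F : open U -> cintegrable U F ->
  cintegral U (fun y => conjc (F y)) = conjc (cintegral U F).
Proof.
move=> oU [FR FI]; have mU : measurable (pt @^-1` U) by exact: measurable_open.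
rewrite /cintegral; apply: complexP => /=.
  by apply: eq_Rintegral => t _; case: (F _).
rewrite -mulN1r -RintegralZl//.
by apply: eq_Rintegral => t _; rewrite mulN1r; case: (F _).
Qed.

Lemma eq_cintegral U F G : (forall y, U y -> F y = G y) -> cintegral U F = cintegral U G.
Proof.
move=> FG; apply: complexP; rewrite /cintegral/=; apply: eq_Rintegral => t /set_mem Ut;
  by rewrite FG.
Qed.

Lemma ae_eq_cintegral U F G : open U -> cmeasurable_on U F -> cmeasurable_on U G ->
  {ae L, forall t, U (pt t) -> F (pt t) = G (pt t)} -> cintegral U F = cintegral U G.
Proof.
move=> oU [FR FI] [GR GI] FG; have mU : measurable (pt @^-1` U) by exact: measurable_open.
apply: complexP; rewrite /cintegral /Rintegral/=; congr fine; apply: ae_eq_integral => //;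
  try exact/measurable_EFinP.
  by apply: filterS FG => t H Ut; rewrite /= H.
by apply: filterS FG => t H Ut; rewrite /= H.
Qed.

End local_integrability.

Section real_fubini.
Local Open Scope ereal_scope.
Context d (T : measurableType d) (R : realType).
Variable mu : {sigma_finite_measure set T -> \bar R}.

(** The product majorant a(x) b(y) makes the zero extension of g integrable on the product space and
    all its slices integrable, so that the real-valued integrals carry no default values. *)
Lemma Rintegral_swap (D : set T) (g : T * T -> R) (a b : T -> R) : measurable D ->
  measurable_fun (D `*` D) g -> (forall x, 0 <= a x)%R -> (forall x, 0 <= b x)%R ->
  mu.-integrable D (EFin \o a) -> mu.-integrable D (EFin \o b) ->
  (forall x y, D x -> D y -> `|g (x, y)| <= a x * b y)%R ->
  (\int[mu]_(x in D) \int[mu]_(y in D) g (x, y) =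
   \int[mu]_(y in D) \int[mu]_(x in D) g (x, y))%R.
Proof.
move=> mD mg a0 b0 ia ib gab.
have mDD : measurable (D `*` D) by exact: measurableX.
pose G := (EFin \o g) \_ (D `*` D).
have mG : measurable_fun setT G by apply/(measurable_restrictT _ mDD)/measurable_EFinP.
have GE x y : D x -> D y -> G (x, y) = (g (x, y))%:E.
  by move=> Dx Dy; rewrite /G /patch ifT//; exact/mem_set.
have G0 x y : ~ (D x /\ D y) -> G (x, y) = 0.
  by move=> nD; rewrite /G /patch ifF//; apply/negbTE/negP => /set_mem.
have iA : mu.-integrable setT ((EFin \o a) \_ D).
  by apply/(integrable_mkcond _ mD).
have iB : mu.-integrable setT ((EFin \o b) \_ D).
  by apply/(integrable_mkcond _ mD).
have A0 x : 0 <= ((EFin \o a) \_ D) x by rewrite /patch; case: ifP; rewrite /= ?lee_fin.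
have B0 x : 0 <= ((EFin \o b) \_ D) x by rewrite /patch; case: ifP; rewrite /= ?lee_fin.
have Gle x y : `|G (x, y)| <= ((EFin \o a) \_ D) x * ((EFin \o b) \_ D) y.
  have [[Dx Dy]|nD] := pselect (D x /\ D y); last by rewrite G0// abse0 mule_ge0.
  by rewrite GE// /patch !ifT ?lee_fin ?gab//; exact/mem_set.
have iG : (mu \x mu).-integrable setT G.
  apply/(integrable12ltyP mu mu mG).
  apply: (@le_lt_trans _ _ (\int[mu]_x (((EFin \o a) \_ D) x * \int[mu]_y ((EFin \o b) \_ D) y))).
    apply: ge0_le_integral => //.
    - by move=> x _; apply: integral_ge0.
    - apply: (measurable_fun_fubini_tonelli_F (fun p => `|G p|)) => //.
      exact: measurableT_comp.
    - by apply: emeasurable_funM => //; exact: measurable_int iA.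
    move=> x _; rewrite -ge0_integralZl//; last exact: measurable_int iB.
    apply: ge0_le_integral => //.
    - by apply: measurableT_comp => //; exact: (measurableT_comp mG (measurable_pair1 x)).
    - by apply: emeasurable_funM => //; exact: measurable_int iB.
  rewrite ge0_integralZr//; [|exact: measurable_int iA|exact: integral_ge0].
  rewrite lte_mul_pinfty//; first exact: integral_ge0.
    by apply/(integrable_fin_num measurableT).
  by have /integrable_fin_num := iB; rewrite ge0_fin_numE; [apply|exact: integral_ge0].
have slice1 x : D x -> \int[mu]_y G (x, y) = (\int[mu]_(y in D) g (x, y))%R%:E.
  move=> Dx.
  have ig : mu.-integrable D (EFin \o (fun y => g (x, y))).
    have mgx : measurable_fun D (fun y => g (x, y)).
      exact: (measurable_slice mD Dx mg).
    apply: (le_integrable mD _ _ (integrableZl mD (a x) ib)); first exact/measurable_EFinP.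
    move=> y Dy; rewrite /= lee_fin; apply: le_trans (gab x y Dx Dy) _.
    by rewrite ler_norm.
  rewrite /Rintegral fineK; last exact: (integrable_fin_num mD ig).
  by rewrite integral_mkcond -restrict_setX.
have slice2 y : D y -> \int[mu]_x G (x, y) = (\int[mu]_(x in D) g (x, y))%R%:E.
  move=> Dy.
  have ig : mu.-integrable D (EFin \o (fun x => g (x, y))).
    have mgy : measurable_fun D (fun x => g (x, y)).
      apply: (@measurable_comp _ _ _ _ _ _ (D `*` D) g _ (pair^~ y)) => //.
        by move=> _ [x Dx <-].
      by apply: measurable_funTS; exact: measurable_pair2.
    apply: (le_integrable mD _ _ (integrableZl mD (b y) ia)); first exact/measurable_EFinP.
    move=> x Dx; rewrite /= lee_fin; apply: le_trans (gab x y Dx Dy) _.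
    by rewrite mulrC ler_norm.
  rewrite /Rintegral fineK; last exact: (integrable_fin_num mD ig).
  rewrite integral_mkcond; apply: eq_integral => x _.
  rewrite [RHS]/patch; case: ifPn => [/set_mem Dx|/negP nDx]; first by rewrite GE.
  by rewrite G0// => -[Dx _]; apply: nDx; exact/mem_set.
have := Fubini iG; rewrite /Rintegral => E; congr fine.
transitivity (\int[mu]_x \int[mu]_y G (x, y)).
  rewrite integral_mkcond; apply: eq_integral => x _; rewrite /patch.
  case: ifPn => [/set_mem Dx|/negP nDx]; first by rewrite slice1.
  by rewrite integral0_eq// => y _; apply: G0 => -[Dx _]; apply: nDx; exact/mem_set.
rewrite E integral_mkcond; apply: eq_integral => y _; rewrite /patch.
case: ifPn => [/set_mem Dy|/negP nDy]; first by rewrite slice2.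
by rewrite integral0_eq// => x _; apply: G0 => -[_ Dy]; apply: nDy; exact/mem_set.
Qed.

End real_fubini.

Lemma cvg_cst_pair (X Y : topologicalType) (x : X) (y : Y) :
  (fun z : Y => (x, z)) z @[z --> y] --> (x, y).
Proof.
move=> A [[B C] /= [nB nC] BC]; apply: filterS nC => z Cz.
by apply: BC; split => //=; exact: nbhs_singleton.
Qed.

(** * Weighted pairings, formal adjoints and uniform continuity of kernel operators *)

Section operators.
Context {R : realType} {n : nat}.
Local Notation E := ('Cn[R]_n).
Local Notation T := (n.-tuple (R2 R)).
Local Notation L := (lebesgueCn R n).
Local Notation pt := (of_tuple : T -> E).
Implicit Types (Omega U V : set E) (u v F : E -> R[i]) (K : E -> E -> R[i]) (Phi : E -> R).

Lemma measurable_weight U Phi (c h : R) : open U -> (forall x, U x -> {for x, continuous Phi}) ->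
  measurable_fun (pt @^-1` U) (fun t => expR (c * Phi (pt t) / h)).
Proof.
move=> oU cP; apply: measurableT_comp => //; apply: measurable_funM => //.
by apply: measurable_funM => //; exact: (cts_measurable (U := U)).
Qed.

Lemma L2norm_le (Pa Pb : E -> R) (ha hb c : R) U v : open U -> cmeasurable_on U v ->
  (forall x, U x -> {for x, continuous Pa}) -> (forall x, U x -> {for x, continuous Pb}) ->
  0 <= c -> (forall x, U x -> expR (- 2 * Pa x / ha) <= c ^+ 2 * expR (- 2 * Pb x / hb)) ->
  (L2norm Pa ha U v <= c%:E * L2norm Pb hb U v)%E.
Proof.
move=> oU [vR vI] cPa cPb c0 H; have mU : measurable (pt @^-1` U) by exact: measurable_open.
have mc2 : measurable_fun (pt @^-1` U) (fun t => cabs (v (pt t)) ^+ 2).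
  by apply: measurable_funX; exact: measurable_cabs.
have mb : measurable_fun (pt @^-1` U) (fun t => (cabs (v (pt t)) ^+ 2 * expR (- 2 * Pb (pt t) / hb))%:E).
  by apply/measurable_EFinP; apply: measurable_funM => //; exact: measurable_weight.
have b0 t : (0 <= (cabs (v (pt t)) ^+ 2 * expR (- 2 * Pb (pt t) / hb))%:E)%E.
  by rewrite lee_fin mulr_ge0 ?sqr_ge0 ?expR_ge0.
rewrite !L2normE -[X in (_ <= X%:E * _)%E](ger0_norm c0) -sqrtr_sqr.
rewrite -[(Num.sqrt _)%:E]/(sqrte _%:E) -sqrteM ?lee_fin ?sqr_ge0//.
rewrite lee_sqrt; last by rewrite mule_ge0 ?lee_fin ?sqr_ge0//; exact: integral_ge0.
rewrite -(ge0_integralZl_EFin _ mU _ mb (sqr_ge0 _)); last by move=> t _; exact: b0.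
apply: ge0_le_integral => //.
- by move=> t _; rewrite lee_fin mulr_ge0 ?sqr_ge0 ?expR_ge0.
- by apply/measurable_EFinP; apply: measurable_funM => //; exact: measurable_weight.
- exact: (emeasurable_funM (measurable_cst _) mb).
move=> t Ut; rewrite -EFinM lee_fin mulrCA; apply: ler_wpM2l; first exact: sqr_ge0.
exact: H.
Qed.

Lemma cmeasurableM U u v : cmeasurable_on U u -> cmeasurable_on U v ->
  cmeasurable_on U (fun x => u x * v x).
Proof. by move=> [uR uI] [vR vI]; exact: measurable_Re_mul. Qed.

Lemma cmeasurableJ U u : cmeasurable_on U u -> cmeasurable_on U (fun x => conjc (u x)).
Proof.
move=> [uR uI]; split; first by apply: eq_measurable_fun uR => t _; case: (u _).
by apply: eq_measurable_fun (measurable_funN uI) => t _ /=; case: (u (of_tuple t)).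
Qed.

Lemma cmeasurable_real U (f : E -> R) : measurable_fun (pt @^-1` U) (fun t => f (pt t)) ->
  cmeasurable_on U (fun x => (f x)%:C).
Proof. by move=> mf; split => //=; exact: measurable_cst. Qed.

Lemma cmeasurable_kernel Omega K x : open Omega -> cts_kernel Omega K -> Omega x ->
  cmeasurable_on Omega (K x).
Proof.
move=> oO cK Ox.
have cKx y : Omega y -> (K x z) @[z --> y] --> K x y.
  move=> Oy; have Kp := cK (x, y) (conj Ox Oy).
  have px : (fun z : E => (x, z)) z @[z --> y] --> (x, y) := @cvg_cst_pair _ _ x y.
  exact: (cvg_comp _ _ px Kp).
split; [apply: (@cts_measurable R n Omega (fun y => complex.Re (K x y)) oO)|
  apply: (@cts_measurable R n Omega (fun y => complex.Im (K x y)) oO)] => y Oy.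
  exact: (cvg_Re (nbhs_filter y) (cKx y Oy)).
exact: (cvg_Im (nbhs_filter y) (cKx y Oy)).
Qed.

Definition proper_kernel Omega K := forall U2, relcompact U2 Omega ->
  exists2 U1, relcompact U1 Omega & forall x y, U2 x -> Omega y -> K x y != 0 -> U1 y.

Lemma kernel_cintegrable Omega K x u : open Omega -> cts_kernel Omega K ->
  proper_kernel Omega K -> L2loc Omega u -> Omega x -> cintegrable Omega (fun y => K x y * u y).
Proof.
move=> oO cK pK Lu Ox; have [U2 rU2 U2x] := relcompact_point oO Ox.
have [U1 rU1 U1P] := pK _ rU2; have [oU1 cU1 sU1] := rU1.
have [M M0 HM] : exists2 M, 0 < M & forall y, closure U1 y -> `|cabs (K x y)| <= M.
  apply: cts_bounded => // y /sU1 Oy; have Kp := cK (x, y) (conj Ox Oy).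
  have px : (fun z : E => (x, z)) z @[z --> y] --> (x, y) := @cvg_cst_pair _ _ x y.
  exact: (cvg_cabs (nbhs_filter y) (cvg_comp _ _ px Kp)).
have mO : measurable (pt @^-1` Omega) by exact: measurable_open.
apply: (cintegrable_le oO _ (integrableZl mO M (L2loc_integrable oO Lu rU1))).
  by apply: cmeasurableM; [exact: cmeasurable_kernel|exact: Lu.1].
move=> t Ot; rewrite cabsM /= /patch.
case: ifPn => [/set_mem U1t|/negP nU1].
  apply: ler_wpM2r; first exact: cabs_ge0.
  by have := HM _ (@subset_closure _ _ _ U1t); rewrite ger0_norm ?cabs_ge0.
have -> : K x (pt t) = 0.
  apply/eqP; apply: contraPT isT => Kn0; case: nU1; exact/mem_set/(U1P x).
by rewrite Normc.normc0 mul0r mulr0.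
Qed.

(** Fubini's theorem is legitimate because the integrand vanishes off V x V', on whose compact
    closure the weighted kernel is bounded by some M; the majorant is M |v(x)| |u(y)|, with v and u
    cut off to V and V'. *)
Lemma kernel_pairing_sym Omega Phi h K u v V V' : open Omega ->
  (forall x, Omega x -> {for x, continuous Phi}) -> cts_kernel Omega K -> proper_kernel Omega K ->
  L2loc Omega u -> L2loc Omega v -> relcompact V Omega -> relcompact V' Omega ->
  (forall x y, Omega x -> Omega y -> K x y * u y * conjc (v x) != 0 -> V x /\ V' y) ->
  (forall x y, Omega x -> Omega y -> K x y * (expR (- 2 * Phi x / h))%:C =
    conjc (K y x) * (expR (- 2 * Phi y / h))%:C) ->
  L2dot Phi h Omega (fun x => cintegral Omega (fun y => K x y * u y)) v =
  L2dot Phi h Omega u (fun x => cintegral Omega (fun y => K x y * v y)).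
Proof.
move=> oO cPhi cK pK Lu Lv rV rV' KV herm.
pose W x : R[i] := (expR (- 2 * Phi x / h))%:C.
pose G x y := conjc (v x) * W x * (K x y * u y).
have mO : measurable (pt @^-1` Omega) by exact: measurable_open.
transitivity (cintegral Omega (fun x => cintegral Omega (G x))).
  apply: eq_cintegral => x Ox; rewrite [RHS]cintegralZ//; last exact: kernel_cintegrable.
  by rewrite -/(W x); ring.
transitivity (cintegral Omega (fun y => cintegral Omega (fun x => G x y))); last first.
  apply: eq_cintegral => y Oy; have iK := kernel_cintegrable oO cK pK Lv Oy.
  rewrite -cintegralJ// mulrAC -cintegralZ//; last first.
    case: iK => iR iI; split; first by apply: eq_integrable iR => // t _ /=; case: (_ * _).
    have := integrableN iI; apply: eq_integrable => // t _ /=; by case: (_ * _).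
  apply: eq_cintegral => x Ox; rewrite /G rmorphM/=.
  have := herm x y Ox Oy; rewrite -/(W x) -/(W y) => H.
  rewrite (_ : _ * _ * (K x y * u y) = conjc (v x) * u y * (K x y * W x)); last by ring.
  by rewrite H; ring.
have [oV cV sV] := rV; have [oV' cV' sV'] := rV'.
have [M M0 HM] : exists2 M, 0 < M & forall p : E * E, (closure V `*` closure V') p ->
    `|cabs (K p.1 p.2) * expR (- 2 * Phi p.1 / h)| <= M.
  apply: cts_bounded; first exact: compact_setX.
  move=> p [/sV Ox /sV' Oy].
  have C1 : Phi q.1 @[q --> p] --> Phi p.1.
    exact: (cvg_comp fst Phi cvg_fst (cPhi _ Ox)).
  have C2 : (- 2 * Phi q.1 / h) @[q --> p] --> - 2 * Phi p.1 / h.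
    apply: cvgM; last exact: cvg_cst.
    by apply: cvgM => //; exact: cvg_cst.
  exact: (cvgM (cvg_cabs (nbhs_filter p) (cK p (conj Ox Oy))) (cvg_comp _ _ C2 (@continuous_expR R _))).
have [mKR mKI] := measurable_kernel_fun oO cK Lu.1.
have [mfR mfI] : cmeasurable_on Omega (fun x => conjc (v x) * W x).
  apply: cmeasurableM; first exact/cmeasurableJ/Lv.1.
  by apply: cmeasurable_real; exact: measurable_weight.
have [mGR mGI] := measurable_Re_mul (measurable_setX1 mO mfR) (measurable_setX1 mO mfI) mKR mKI.
pose a := (fun t => cabs (v (pt t))) \_ (pt @^-1` V).
pose b := (fun t => cabs (u (pt t))) \_ (pt @^-1` V').
have a0 t : 0 <= M * a t.
  by rewrite mulr_ge0 ?(ltW M0)// /a /patch; case: ifP => // _; exact: cabs_ge0.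
have b0 t : 0 <= b t by rewrite /b /patch; case: ifP => // _; exact: cabs_ge0.
have ia := integrableZl mO M (L2loc_integrable oO Lv rV).
have ib := L2loc_integrable oO Lu rV'.
have Gab s t : Omega (pt s) -> Omega (pt t) -> cabs (G (pt s) (pt t)) <= M * a s * b t.
  move=> Os Ot; have [G0|Gn0] := eqVneq (K (pt s) (pt t) * u (pt t) * conjc (v (pt s))) 0.
    rewrite /G [X in cabs X](_ : _ = 0); first by rewrite Normc.normc0 mulr_ge0.
    by rewrite mulrAC [X in X * _]mulrC G0 mul0r.
  have [Vs Vt] := KV _ _ Os Ot Gn0.
  rewrite /a /b /patch !ifT; [|exact/mem_set..].
  rewrite /G !cabsM cabsJ /W cabs_real (ger0_norm (expR_ge0 _)).
  have := HM (pt s, pt t) (conj (@subset_closure _ _ _ Vs) (@subset_closure _ _ _ Vt)).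
  rewrite /= ger0_norm ?mulr_ge0 ?cabs_ge0 ?expR_ge0// => H.
  rewrite (_ : _ * _ * _ = (cabs (K (pt s) (pt t)) * expR (- 2 * Phi (pt s) / h)) *
    (cabs (v (pt s)) * cabs (u (pt t)))); last by ring.
  by rewrite -[leRHS]mulrA; apply: ler_wpM2r => //; rewrite mulr_ge0 ?cabs_ge0.
apply: complexP; rewrite /cintegral/=.
  apply: (@Rintegral_swap _ _ _ L _ (fun p => complex.Re (G (pt p.1) (pt p.2))) (fun t => M * a t) b) => // s t Os Ot.
  by apply: le_trans (Gab s t Os Ot); exact: Re_le_cabs.
apply: (@Rintegral_swap _ _ _ L _ (fun p => complex.Im (G (pt p.1) (pt p.2))) (fun t => M * a t) b) => // s t Os Ot.
by apply: le_trans (Gab s t Os Ot); exact: Im_le_cabs.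
Qed.

End operators.

Section operator_theorems.
Context {R : realType} {n : nat}.
Local Notation E := ('Cn[R]_n).
Local Notation T := (n.-tuple (R2 R)).
Local Notation L := (lebesgueCn R n).
Local Notation pt := (of_tuple : T -> E).
Implicit Types (Omega U V S : set E) (u v F : E -> R[i]) (Phi : E -> R).
Implicit Types (K : R -> E -> E -> R[i]).

(** A support is only defined modulo null sets, while the pairing argument needs vanishing at every
    point. For V containing the support, this is a representative of the same class that vanishes
    pointwise outside V. *)
Definition truncate V u : E -> R[i] := fun x => if x \in V then u x else 0.

Lemma L2loc_truncate Omega V u : open Omega -> open V -> L2loc Omega u ->
  L2loc Omega (truncate V u).
Proof.
move=> oO oV [[uR uI] uL].
have mO : measurable (pt @^-1` Omega) by exact: measurable_open.
have mV : measurable (pt @^-1` V) by exact: measurable_open.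
have mtr (f : T -> R) : measurable_fun (pt @^-1` Omega) f ->
    measurable_fun (pt @^-1` Omega) (f \_ (pt @^-1` V)).
  move=> mf; apply/(measurable_restrict _ mV mO).
  by apply: measurable_funS mf => // t [].
have inE' t : (t \in pt @^-1` V) = (pt t \in V).
  by apply/idP/idP => /set_mem ?; exact/mem_set.
have [tR tI] : cmeasurable_on Omega (truncate V u).
  split.
    by apply: eq_measurable_fun (mtr _ uR) => t _; rewrite /truncate /patch inE'; case: ifP.
  by apply: eq_measurable_fun (mtr _ uI) => t _; rewrite /truncate /patch inE'; case: ifP.
split=> // U rU; apply: le_lt_trans (uL U rU); have [oU _ sU] := rU.
have UO : U `<=` Omega := subset_trans (@subset_closure _ U) sU.
have mU : measurable (pt @^-1` U) by exact: measurable_open.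
rewrite !L2normE lee_sqrt; last first.
  by apply: integral_ge0 => t _; rewrite lee_fin mulr_ge0 ?sqr_ge0 ?expR_ge0.
have mU2 (f : E -> R[i]) : cmeasurable_on Omega f -> measurable_fun (pt @^-1` U)
    (fun t => (cabs (f (pt t)) ^+ 2 * expR (- 2 * 0 / 1))%:E).
  move=> [fR fI]; apply/measurable_EFinP; apply: measurable_funM => //.
  apply: measurable_funX; apply: (measurable_funS mO (fun t => UO (pt t))).
  exact: (measurable_cabs mO fR fI).
apply: ge0_le_integral => //.
- by move=> t _; rewrite lee_fin mulr_ge0 ?sqr_ge0 ?expR_ge0.
- exact: mU2.
- exact: mU2.
move=> t _; rewrite lee_fin; apply: ler_wpM2r; first exact: expR_ge0.
rewrite /truncate; case: ifP => _ //.
by rewrite Normc.normc0 expr0n/= sqr_ge0.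
Qed.

Lemma truncate_ae Omega V u : esupp Omega u `<=` V ->
  {ae L, forall t, Omega (pt t) -> u (pt t) = truncate V u (pt t)}.
Proof.
move=> uV; apply: filterS (ae_esupp Omega u) => t H Ot.
rewrite /truncate; case: ifPn => // /negP nV; apply: H => // /uV Vt.
by apply: nV; exact/mem_set.
Qed.

Lemma kernel_op_ae Omega (k : E -> E -> R[i]) u v x : open Omega -> cts_kernel Omega k ->
  cmeasurable_on Omega u -> cmeasurable_on Omega v -> Omega x ->
  {ae L, forall t, Omega (pt t) -> u (pt t) = v (pt t)} ->
  cintegral Omega (fun y => k x y * u y) = cintegral Omega (fun y => k x y * v y).
Proof.
move=> oO ck mu mv Ox uv; have mk := cmeasurable_kernel oO ck Ox.
apply: ae_eq_cintegral => //; try exact: cmeasurableM.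
by apply: filterS uv => t H Ot; rewrite H.
Qed.

Lemma L2dot_ae Omega Phi (h : R) u u' v v' : open Omega ->
  (forall x, Omega x -> {for x, continuous Phi}) ->
  cmeasurable_on Omega u -> cmeasurable_on Omega u' ->
  cmeasurable_on Omega v -> cmeasurable_on Omega v' ->
  {ae L, forall t, Omega (pt t) -> u (pt t) = u' (pt t)} ->
  {ae L, forall t, Omega (pt t) -> v (pt t) = v' (pt t)} ->
  L2dot Phi h Omega u v = L2dot Phi h Omega u' v'.
Proof.
move=> oO cPhi mu mu' mv mv' uu vv.
have mW : cmeasurable_on Omega (fun x => (expR (- 2 * Phi x / h))%:C).
  by apply: cmeasurable_real; exact: measurable_weight.
apply: ae_eq_cintegral => //; try by apply: cmeasurableM => //; apply: cmeasurableM => //; exact: cmeasurableJ.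
by apply: filterS2 uu vv => t H1 H2 Ot; rewrite H1// H2.
Qed.

(** The compactly supported function is truncated to a relatively compact neighbourhood of its
    support. Properness of the kernel, or of its transpose when u is the compactly supported one,
    then confines the other variable. *)
Lemma kernel_formal_adjoint Omega Phi K : open Omega ->
  (forall x, Omega x -> {for x, continuous Phi}) ->
  (forall h, 0 < h <= 1 -> cts_kernel Omega (K h)) ->
  (forall h, 0 < h <= 1 -> proper_kernel Omega (K h)) ->
  (forall h, 0 < h <= 1 -> proper_kernel Omega (fun x y => K h y x)) ->
  (forall h x y, 0 < h <= 1 -> Omega x -> Omega y ->
    K h x y * (expR (- 2 * Phi x / h))%:C = conjc (K h y x) * (expR (- 2 * Phi y / h))%:C) ->
  formal_adjoint Omega Phi (kernel_operator Omega K) (kernel_operator Omega K).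
Proof.
move=> oO cPhi cK pK pK' herm h u v hh Lu Lv.
have ck := cK h hh; have herm' x y := @herm h x y hh.
have reflae f : {ae L, forall t, Omega (pt t) -> f (pt t) = f (pt t) :> R[i]} by exact: aeW.
have mA f : cmeasurable_on Omega f -> cmeasurable_on Omega (kernel_operator Omega K h f).
  by move=> mf; exact: cmeasurable_kernel_op.
have Aae f g : cmeasurable_on Omega f -> cmeasurable_on Omega g ->
    {ae L, forall t, Omega (pt t) -> f (pt t) = g (pt t)} ->
    {ae L, forall t, Omega (pt t) -> kernel_operator Omega K h f (pt t) = kernel_operator Omega K h g (pt t)}.
  by move=> mf mg fg; apply: aeW => t Ot; exact: kernel_op_ae.
case=> [cu|cv].
- have [V' rV' uV'] := relcompact_nbhs oO cu (fun x => @proj1 _ _).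
  have [oV' _ _] := rV'; have Lt := L2loc_truncate oO oV' Lu.
  have [V rV VP] := pK' h hh V' rV'.
  have uu := truncate_ae uV'.
  rewrite (L2dot_ae h oO cPhi (mA _ Lu.1) (mA _ Lt.1) Lv.1 Lv.1 (Aae _ _ Lu.1 Lt.1 uu) (reflae v)).
  rewrite (L2dot_ae h oO cPhi Lu.1 Lt.1 (mA _ Lv.1) (mA _ Lv.1) uu (reflae _)).
  apply: (kernel_pairing_sym oO cPhi ck (pK h hh) Lt Lv rV rV') => // x y Ox Oy.
  rewrite !mulf_eq0 !negb_or /truncate => /andP[/andP[Kn0]].
  by case: ifPn => [/set_mem V'y _ _|]; [split => //; exact: (VP y)|rewrite eqxx].
- have [V rV vV] := relcompact_nbhs oO cv (fun x => @proj1 _ _).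
  have [oV _ _] := rV; have Lt := L2loc_truncate oO oV Lv.
  have [V' rV' VP] := pK h hh V rV.
  have vv := truncate_ae vV.
  rewrite (L2dot_ae h oO cPhi (mA _ Lu.1) (mA _ Lu.1) Lv.1 Lt.1 (reflae _) vv).
  rewrite (L2dot_ae h oO cPhi Lu.1 Lu.1 (mA _ Lv.1) (mA _ Lt.1) (reflae _) (Aae _ _ Lv.1 Lt.1 vv)).
  apply: (kernel_pairing_sym oO cPhi ck (pK h hh) Lu Lt rV rV') => // x y Ox Oy.
  rewrite !mulf_eq0 !negb_or /truncate => /andP[/andP[Kn0 _]].
  by case: ifPn => [/set_mem Vx _|]; [split => //; exact: (VP x)|rewrite conjc0 eqxx].
Qed.

(** The kernel bound is only asked for y in S, since an element of [L2loc_supp] vanishes almost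
    everywhere off S. The sets and the constant depend on U2 but not on h, so [est] gives the
    uniform estimate with h0 = 1. *)
Lemma kernel_uniformly_continuous Omega S Phi Phi2 K : open Omega -> S `<=` Omega ->
  (forall x, Omega x -> {for x, continuous Phi}) ->
  (forall x, Omega x -> {for x, continuous Phi2}) ->
  (forall h, 0 < h <= 1 -> cts_kernel Omega (K h)) ->
  (forall U2, relcompact U2 Omega -> exists2 U1, relcompact U1 Omega &
     forall h x y, 0 < h <= 1 -> U2 x -> Omega y -> K h x y != 0 -> U1 y) ->
  (forall U2, relcompact U2 Omega -> exists C s : R, [/\ 0 < C, 0 < s &
     forall h x y, 0 < h <= 1 -> U2 x -> S y ->
       cabs (K h x y) <= C / h ^+ n * expR ((Phi2 x - Phi y) / h) *
         expR (- enorm (x - y) ^+ 2 / (s * h))]) ->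
  uniformly_continuous Omega Phi (L2loc_supp Omega S) Omega Phi2 (kernel_operator Omega K).
Proof.
move=> oO SO cPhi cPhi2 cK pK bK.
have est U2 : relcompact U2 Omega -> exists (U1 : set E) (M : R), relcompact U1 Omega /\ 0 < M /\
    forall h u, 0 < h <= 1 -> L2loc_supp Omega S u ->
    (L2norm Phi2 h U2 (kernel_operator Omega K h u) <= M%:E * L2norm Phi h U1 u)%E.
  move=> rU2; have [oU2 _ sU2] := rU2.
  have [U1 rU1 U1P] := pK _ rU2; have [oU1 _ sU1] := rU1.
  have [C [s [C0 s0 CP]]] := bK _ rU2.
  exists U1, (Num.sqrt 2 * (C * (pi * s) ^+ n)); split => //; split.
    by rewrite mulr_gt0 ?sqrtr_gt0// mulr_gt0// exprn_gt0// mulr_gt0// pi_gt0.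
  move=> h u hh [Lu uS]; have h0 : 0 < h by case/andP: hh.
  have hn0 : 0 < h ^+ n by rewrite exprn_gt0.
  (* The Gaussian of width s h has mass (pi s h)^n, which cancels the factor h^-n of the kernel;
     this is where uniformity in h comes from. *)
  have -> : C * (pi * s) ^+ n = C / h ^+ n * (pi * (s * h)) ^+ n.
    by rewrite mulrA [in RHS]exprMn; field; exact: lt0r_neq0.
  apply: (kernel_L2_bound oO oU1 oU2 _ _ cPhi cPhi2 (cK h hh) Lu.1).
  - exact: subset_trans (@subset_closure _ U1) sU1.
  - exact: subset_trans (@subset_closure _ U2) sU2.
  - exact: divr_gt0.
  - exact: mulr_gt0.
  apply: filterS (ae_esupp Omega u) => t Ht Ot x Ux; rewrite cabsM.
  have rhs0 : 0 <= C / h ^+ n * expR ((Phi2 x - Phi (pt t)) / h) *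
      expR (- enorm (x - pt t) ^+ 2 / (s * h)).
    by rewrite !mulr_ge0 ?expR_ge0 ?invr_ge0 ?ltW.
  have [St|nSt] := pselect (S (pt t)); last first.
    rewrite Ht ?Normc.normc0 ?mulr0//; last by move=> /uS.
    by case: ifP => _; rewrite mulr0.
  case: ifPn => [_|/negP nU1].
    by apply: ler_wpM2r; [exact: cabs_ge0|exact: CP].
  have -> : K h x (pt t) = 0.
    by apply/eqP; apply: contraPT isT => Kn0; case: nU1; exact/mem_set/(U1P h x).
  by rewrite Normc.normc0 mul0r mulr0.
split.
- move=> h u hh Du; have [Lu _] := Du; split; first exact: (cmeasurable_kernel_op oO (cK h hh) Lu.1).
  move=> U2 rU2; have [oU2 cU2 sU2] := rU2.
  have [U1 [M [rU1 [M0 HM]]]] := est _ rU2; have [oU1 cU1 sU1] := rU1.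
  have U2O : U2 `<=` Omega := subset_trans (@subset_closure _ U2) sU2.
  have U1O : U1 `<=` Omega := subset_trans (@subset_closure _ U1) sU1.
  have sub U f : open U -> U `<=` Omega -> cmeasurable_on Omega f -> cmeasurable_on U f.
    move=> oU UO [fR fI]; have mO : measurable (pt @^-1` Omega) by exact: measurable_open.
    by split; [exact: (measurable_funS mO (fun t => UO (pt t)) fR)|
      exact: (measurable_funS mO (fun t => UO (pt t)) fI)].
  have h0 : 0 < h by case/andP: hh.
  (* Membership in L^2_loc concerns a fixed h. Both weights are bounded above and away from 0 on
     compact sets, so the weighted estimate can be compared with the unweighted norms at the price
     of constants depending on h. *)
  have [B2 B20 HB2] := cts_bounded cU2 (fun x Ux => cPhi2 x (sU2 x Ux)).
  have [B1 B10 HB1] := cts_bounded cU1 (fun x Ux => cPhi x (sU1 x Ux)).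
  have H2 : (L2norm (fun=> 0%R) 1%R U2 (kernel_operator Omega K h u) <=
      (expR (B2 / h))%:E * L2norm Phi2 h U2 (kernel_operator Omega K h u))%E.
    apply: L2norm_le => //; first exact: (sub _ _ oU2 U2O (cmeasurable_kernel_op oO (cK h hh) Lu.1)).
    - by move=> x _; exact: cst_continuous.
    - by move=> x /U2O/cPhi2.
    move=> x Ux; rewrite mulr0 mul0r expR_sqr -exprMn -expRD expR0 expr_ge1 ?expR_ge0//.
    rewrite -mulrDl -[leLHS]expR0 ler_expR; apply: divr_ge0; last exact: ltW.
    by have := HB2 x (@subset_closure _ _ _ Ux); rewrite ler_norml; lra.
  have H1 : (L2norm Phi h U1 u <= (expR (B1 / h))%:E * L2norm (fun=> 0%R) 1%R U1 u)%E.
    apply: L2norm_le => //; first exact: (sub _ _ oU1 U1O Lu.1).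
    - by move=> x /U1O/cPhi.
    - by move=> x _; exact: cst_continuous.
    move=> x Ux; rewrite mulr0 mul0r expR0 mulr1 expR_sqr ler_pXn2r ?nnegrE ?expR_ge0//.
    rewrite ler_expR ler_pM2r ?invr_gt0//.
    by have := HB1 x (@subset_closure _ _ _ Ux); rewrite ler_norml; lra.
  apply: (le_lt_trans H2).
  have fin1 : L2norm (fun=> 0%R) 1%R U1 u \is a fin_num.
    by rewrite ge0_fin_numE ?sqrte_ge0//; exact: Lu.2.
  have fin2 : (M%:E * ((expR (B1 / h))%:E * L2norm (fun=> 0%R) 1%R U1 u))%E \is a fin_num.
    by rewrite !fin_numM.
  have le2 : (L2norm Phi2 h U2 (kernel_operator Omega K h u) <=
      M%:E * ((expR (B1 / h))%:E * L2norm (fun=> 0%R) 1%R U1 u))%E.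
    by apply: (le_trans (HM h u hh Du)); apply: lee_wpmul2l => //; rewrite lee_fin ltW.
  apply: lte_mul_pinfty => //.
  by apply: (le_lt_trans le2); rewrite -ge0_fin_numE//; apply: (le_trans _ le2); exact: sqrte_ge0.
- move=> h c u v hh [Lu _] [Lv _]; apply: aeW => t Ot.
  have pKh : proper_kernel Omega (K h).
    by move=> U2 /pK[U1 rU1 H]; exists U1 => // x y; exact: H.
  have iu := kernel_cintegrable oO (cK h hh) pKh Lu Ot.
  have iv := kernel_cintegrable oO (cK h hh) pKh Lv Ot.
  have icu : cintegrable Omega (fun y => c * (K h (pt t) y * u y)).
    have mO : measurable (pt @^-1` Omega) by exact: measurable_open.
    have [iR iI] := iu; split.
      have := integrableB mO (integrableZl mO (complex.Re c) iR) (integrableZl mO (complex.Im c) iI).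
      by congr (integrable _ _ _); apply/funext => s; rewrite /= (ReM c).
    have := integrableD mO (integrableZl mO (complex.Re c) iI) (integrableZl mO (complex.Im c) iR).
    by congr (integrable _ _ _); apply/funext => s; rewrite /= (ImM c).
  rewrite /kernel_operator -cintegralZ// -cintegralD//.
  by apply: eq_cintegral => y Oy; ring.
exists 1; split; first by rewrite ltr01 lexx.
by move=> U2 /est.
Qed.

End operator_theorems.

(** * Continuity and Hermitian symmetry of the kernel *)

Section big_limits.
Context {R : realType} (S : Type) (F : set_system S) {FF : Filter F}.

Lemma cvg_bigprod (I : Type) (r : seq I) (f : I -> S -> R[i]) (l : I -> R[i]) :
  (forall i, f i @ F --> l i) ->
  (fun s => \prod_(i <- r) f i s) @ F --> \prod_(i <- r) l i.
Proof.
move=> H; elim: r => [|i r IH].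
  by rewrite big_nil; under eq_cvg do rewrite big_nil; exact: cvg_cst.
rewrite big_cons; under eq_cvg do rewrite big_cons.
exact: (cvgM (H i) IH).
Qed.

Lemma cvg_det n (A : S -> 'M[R[i]]_n) (B : 'M[R[i]]_n) :
  (forall i j, (fun s => A s i j) @ F --> B i j) -> (fun s => \det (A s)) @ F --> \det B.
Proof.
move=> H; rewrite /determinant.
apply: (cvg_bigsum FF (f := fun (s : {perm 'I_n}) (t : S) => (-1) ^+ s * \prod_i A t i (s i))
  (l := fun s : {perm 'I_n} => (-1) ^+ s * \prod_i B i (s i))) => s.
apply: cvgM; first exact: cvg_cst.
by apply: (cvg_bigprod _ (f := fun i t => A t i (s i))) => i; exact: H.
Qed.

End big_limits.

Section conjugation.
Context {R : realType} {n : nat}.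
Local Notation E := ('Cn[R]_n).
Implicit Types (x y : E) (p : E * E) (Omega : set E).

Lemma conjvK : involutive (@conjv R n).
Proof. by move=> x; apply/rowP => j; rewrite !mxE conjcK. Qed.

Lemma conjvD x y : conjv (x + y) = conjv x + conjv y.
Proof. by apply/rowP => j; rewrite !mxE rmorphD. Qed.

Lemma conjvZ (c : R[i]) x : conjv (c *: x) = conjc c *: conjv x.
Proof. by apply/rowP => j; rewrite !mxE rmorphM. Qed.

Lemma conjv_continuous : continuous (@conjv R n).
Proof.
move=> x A /nbhs_CnP[e e0 eA]; apply/nbhs_CnP; exists e => // y xy; apply: eA => j.
by have := xy j; rewrite !mxE -rmorphB cabsJ.
Qed.

(** The kernel is a function of (x, y), whereas [psi], the symbol and [chi] live at (x, conj y).
    Under this map [swap] becomes the exchange of x and y. *)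
Definition twist p : E * E := (p.1, conjv p.2).

Lemma twist_continuous : continuous twist.
Proof.
move=> [x y] A [[B C] /= [nB nC] BC].
exists (B, conjv @^-1` C); first by split => //=; exact: conjv_continuous.
by move=> [z w] [/= Bz Cw]; exact: BC.
Qed.

Lemma twist_swap x y : swap (twist (x, y)) = twist (y, x).
Proof. by rewrite /swap /twist/= conjvK. Qed.

Lemma cexp_continuous : continuous (@cexp R).
Proof. by move=> z; exact/derivable1_cts/cexp_derivable. Qed.

Lemma cexp_conjc (z : R[i]) : cexp (conjc z) = conjc (cexp z).
Proof.
by case: z => a b; rewrite /cexp rmorphM /= cosN sinN oppr0.
Qed.

Lemma cabs_cexp (z : R[i]) : cabs (cexp z) = expR (complex.Re z).
Proof.
by case: z => a b; rewrite cexp_circ cabs_circ ?expR_ge0.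
Qed.

End conjugation.

Section mixed_hessian.
Context {R : realType} {n : nat}.
Local Notation E := ('Cn[R]_n).
Variables (W : set (E * E)) (psi : E * E -> R[i]).
Hypotheses (oW : open W) (psi_hol : holomorphic_on W psi).

Let e1 (j : 'I_n) : E * E := (delta_mx ord0 j, 0).
Let e2 (j : 'I_n) : E * E := (0, delta_mx ord0 j).

Lemma mixed_hessianE p i j :
  mixed_hessian psi p i j = 'D_(e1 i) ('D_(e2 j) psi) p.
Proof. by rewrite /mixed_hessian mxE. Qed.

Lemma det_mixed_hessian_continuous p : W p ->
  {for p, continuous (fun p => \det (mixed_hessian psi p))}.
Proof.
move=> Wp.
have E i j : (fun s => mixed_hessian psi s i j) = 'D_(e1 i) ('D_(e2 j) psi).
  by apply/funext => s; exact: mixed_hessianE.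
apply: (@cvg_det _ _ _ (nbhs_filter p) _ (mixed_hessian psi) (mixed_hessian psi p)) => i j.
have H := @derive2_continuous _ _ _ _ _ (e2 j) (e1 i) oW psi_hol Wp.
by rewrite -E in H.
Qed.

Lemma conjv_delta (j : 'I_n) : conjv (delta_mx ord0 j : E) = delta_mx ord0 j.
Proof.
by apply/rowP => k; rewrite !mxE; exact: rmorph_nat.
Qed.

(** The chain rule through the antilinear map [swap]: the conjugation of the argument and that of
    the value compensate each other, so the result is again a complex derivative. *)
Lemma ddir_swap (f g : E * E -> R[i]) p v v' l : W p -> (forall q, W q -> f (swap q) = conjc (g q)) ->
  (forall (k : R[i]) q, swap (k *: v' + q) = conjc k *: v + swap q) ->
  ddir g p v' l -> ddir f (swap p) v (conjc l).
Proof.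
move=> Wp fg vv' D e e0; have [d d0 {}D] := D e e0.
have [r r0 nW] := disc_nbhs v' oW Wp; have {}nW := nbhs_singleton nW.
exists (Num.min d r); first by rewrite lt_min d0.
move=> k; rewrite lt_min => /andP[kd kr].
have -> : k *: v + swap p = swap (conjc k *: v' + p) by rewrite vv' conjcK.
have Wk : W (conjc k *: v' + p) by apply: nW; rewrite cabsJ ltW.
rewrite (fg _ Wk) (fg _ Wp).
have -> : conjc (g (conjc k *: v' + p)) - conjc (g p) - conjc l * k =
    conjc (g (conjc k *: v' + p) - g p - l * conjc k).
  by rewrite !rmorphB rmorphM /= conjcK.
by have := D (conjc k); rewrite !cabsJ; apply.
Qed.

(** [swap] exchanges the two groups of variables, so each entry turns into the conjugate of a
    derivative taken in the opposite order. Restoring the order by [derive_commute] produces the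
    transpose. *)
Lemma mixed_hessian_swap p : hermitian_on W psi -> (forall q, W q -> W (swap q)) -> W p ->
  mixed_hessian psi (swap p) = (map_mx conjc (mixed_hessian psi p))^T.
Proof.
move=> psi_herm Wsw Wp; apply/matrixP => j k; rewrite mixed_hessianE [RHS]mxE [RHS]mxE mixed_hessianE.
have sw1 i (c : R[i]) q : swap (c *: e1 i + q) = conjc c *: e2 i + swap q.
  case: q => x y; rewrite /swap /e1 /e2 /=; congr (_, _).
    by rewrite /= !scaler0 !add0r.
  by rewrite /= conjvD conjvZ conjv_delta.
have sw2 i (c : R[i]) q : swap (c *: e2 i + q) = conjc c *: e1 i + swap q.
  case: q => x y; rewrite /swap /e1 /e2 /=; congr (_, _).
    by rewrite /= conjvD conjvZ conjv_delta.
  by rewrite /= !scaler0 !add0r.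
have D1 q : W q -> 'D_(e2 k) psi (swap q) = conjc ('D_(e1 k) psi q).
  move=> Wq; apply: ddir_derive; apply: (ddir_swap Wq psi_herm (sw1 k)).
  exact/derivable_ddir/diff_derivable/psi_hol.
apply: (@etrans _ _ (conjc ('D_(e2 j) ('D_(e1 k) psi) p))).
  have H := derivable_ddir (derive_derivable (v := e1 k) (w := e2 j) oW psi_hol Wp).
  exact: ddir_derive (ddir_swap Wp D1 (sw2 j) H).
exact: (congr1 conjc (@derive_commute _ _ _ _ _ (e1 k) (e2 j) oW psi_hol Wp)).
Qed.

Lemma det_mixed_hessian_swap p : hermitian_on W psi -> (forall q, W q -> W (swap q)) -> W p ->
  \det (mixed_hessian psi (swap p)) = conjc (\det (mixed_hessian psi p)).
Proof. by move=> H1 H2 Wp; rewrite mixed_hessian_swap// det_tr det_map_mx. Qed.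

End mixed_hessian.

(** * The truncated symbol *)

Section truncated_symbol.
Context {R : realType} {n : nat}.
Local Notation E := ('Cn[R]_n).
Variables (W : set (E * E)) (a : nat -> E * E -> R[i]) (Cc : E * E -> R) (theta : R -> R).
Hypotheses (oW : open W) (a_hol : forall j, holomorphic_on W (a j))
  (Cc_cts : forall p, W p -> {for p, continuous Cc}) (Cc_gt0 : forall p, W p -> 0 < Cc p)
  (theta_cutoff : is_cutoff theta).
Implicit Types (p : E * E) (h : R).

Let term h j p := (theta (j%:R * h * Cc p))%:C * a j p * h%:C ^+ j.

Lemma a_C_sum h N p : 0 < h -> 0 < Cc p -> 1 <= N%:R * h * Cc p ->
  a_C theta Cc a h p = \sum_(j < N) term h j p.
Proof.
move=> h0 C0 NC; have [_ _ _ [delta d1 Hd]] := theta_cutoff.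
apply: cvg_lim; first exact: norm_hausdorff.
apply: cvg_near_cst; exists N => // m /= Nm.
have -> : \sum_(j < N) term h j p = \sum_(0 <= j < N) term h j p by rewrite big_mkord.
rewrite /series/= (@big_cat_nat _ _ _ N)//=.
rewrite [X in _ + X]big_nat_cond [X in _ + X]big1 ?addr0// => j /andP[/andP[Nj _] _].
rewrite /term Hd ?mul0r//; apply: le_trans (ltW d1) _; apply: le_trans NC _.
by rewrite -!mulrA ler_wpM2r ?mulr_ge0 ?ler_nat// ltW.
Qed.

(** One N works wherever Cc >= c. As Cc is continuous and positive, [a_C] is a fixed finite sum near
    each point, so continuity can be checked term by term. *)
Lemma a_C_exists_sum h (c : R) : 0 < h -> 0 < c -> exists N, forall p, c <= Cc p ->
  a_C theta Cc a h p = \sum_(j < N) term h j p.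
Proof.
move=> h0 c0; have hc0 : 0 < h * c by rewrite mulr_gt0.
have N1 := archi_boundP (ltW (divr_gt0 ltr01 hc0)).
exists (Num.bound (1 / (h * c))) => p cC; apply: a_C_sum => //; first exact: lt_le_trans cC.
apply: (@le_trans _ _ ((Num.bound (1 / (h * c)))%:R * (h * c))).
  by rewrite -ler_pdivrMr// ltW.
by rewrite mulrA ler_wpM2l// mulr_ge0// ltW.
Qed.

Let theta_cts t : 0 < t -> {for t, continuous theta}.
Proof.
have [H _ _ _] := theta_cutoff; move=> /(H 0%N)/derivable1_diffP.
exact: differentiable_continuous.
Qed.

Lemma a_C_continuous h p : 0 < h -> W p -> {for p, continuous (a_C theta Cc a h)}.
Proof.
move=> h0 Wp; have C0 := Cc_gt0 Wp.
have [N HN] := @a_C_exists_sum h (Cc p / 2) h0 ltac:(lra).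
have nC : \forall q \near p, Cc p / 2 <= Cc q.
  have /cvgrPdist_lt/(_ (Cc p / 2) ltac:(lra)) := Cc_cts Wp.
  by apply: filterS => q; rewrite ltr_norml; lra.
have near_eq : \forall q \near p, \sum_(j < N) term h j q = a_C theta Cc a h q.
  by apply: filterS nC => q /HN.
have H : (fun q => \sum_(j < N) term h j q) q @[q --> p] --> \sum_(j < N) term h j p.
  apply: (cvg_bigsum (nbhs_filter p)) => j.
  apply: cvgM; last exact: cvg_cst.
  apply: cvgM; last exact/differentiable_continuous/a_hol.
  (* For j = 0 the argument of [theta] is constantly 0, a point where [is_cutoff] provides no
     two-sided continuity; the factor is constant there. *)
  apply: cvg_realC; have [j0|j0] := posnP j.
    by under eq_cvg do rewrite j0 !mul0r; rewrite j0 !mul0r; exact: cvg_cst.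
  have cC : (j%:R * h * Cc q) @[q --> p] --> j%:R * h * Cc p.
    by apply: cvgM; [exact: cvg_cst|exact: Cc_cts].
  apply: (cvg_comp _ _ cC (theta_cts _)).
  by rewrite !mulr_gt0// ltr0n.
have E0 := nbhs_singleton near_eq; rewrite E0 in H.
by apply: cvg_trans H; apply: near_eq_cvg near_eq.
Qed.

Lemma a_C_hermitian h p : 0 < h -> (forall q, W q -> W (swap q)) ->
  (forall q, W q -> Cc (swap q) = Cc q) -> (forall j, hermitian_on W (a j)) -> W p ->
  a_C theta Cc a h (swap p) = conjc (a_C theta Cc a h p).
Proof.
move=> h0 Wsw Csw ah Wp.
have [N HN] := @a_C_exists_sum h (Cc p) h0 (Cc_gt0 Wp).
rewrite !HN ?Csw// rmorph_sum; apply: eq_bigr => j _.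
rewrite /term Csw// ah// !rmorphM rmorphXn /= !oppr0.
by congr (_ * _ * _ ^+ _).
Qed.

(** Where [theta] does not vanish, j h Cc < delta, hence |a_j| h^j <= Cc (Cc j h)^j <= Cc delta^j.
    The geometric series gives Cc / (1 - delta), whatever h is. *)
Lemma a_C_bounded : (forall j p, W p -> `|a j p| <= (Cc p ^+ j.+1 * j%:R ^+ j)%:C) ->
  exists2 B, 0 < B & forall h p, 0 < h -> W p -> cabs (a_C theta Cc a h p) <= B * Cc p.
Proof.
move=> aC; have [_ th01 th1 [delta d1 Hd]] := theta_cutoff.
have d0 : 0 < delta.
  rewrite ltNge; apply/negP => dle; have := th1 0 ltac:(lra).
  by rewrite Hd// => /eqP; rewrite eq_sym oner_eq0.
have B0 : 0 < (1 - delta)^-1 by rewrite invr_gt0; lra.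
exists (1 - delta)^-1 => // h p h0 Wp; have C0 := Cc_gt0 Wp.
have [N HN] := @a_C_exists_sum h (Cc p) h0 C0.
rewrite HN//.
have tle j : cabs (term h j p) <= Cc p * delta ^+ j.
  have j0 : 0 <= j%:R * h * Cc p by rewrite !mulr_ge0// ltW.
  rewrite /term !cabsM cabsX !cabs_real (gtr0_norm h0).
  have [dj|jd] := leP delta (j%:R * h * Cc p).
    by rewrite Hd// normr0 !mul0r mulr_ge0 ?exprn_ge0// ltW.
  have /andP[t0 t1] := th01 _ j0; rewrite ger0_norm//.
  have := aC j p Wp; rewrite le_cabs => aj.
  apply: (@le_trans _ _ (1 * (Cc p ^+ j.+1 * j%:R ^+ j) * h ^+ j)).
    apply: ler_wpM2r; first by rewrite exprn_ge0// ltW.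
    by apply: ler_pM => //; exact: cabs_ge0.
  rewrite mul1r exprS -!mulrA ler_wpM2l ?(ltW C0)// mulrA -!exprMn.
  apply: lerXn2r; rewrite ?nnegrE ?(ltW d0)//.
    by rewrite -mulrA mulrC.
  by apply: le_trans (ltW jd); rewrite le_eqVlt; apply/orP; left; apply/eqP; ring.
have sumle M : cabs (\sum_(j < M) term h j p) <= Cc p * \sum_(j < M) delta ^+ j.
  elim: M => [|M IH]; first by rewrite !big_ord0 Normc.normc0 mulr0.
  by rewrite !big_ord_recr/= mulrDr; apply: le_trans (cabsD _ _) (lerD IH (tle M)).
apply: le_trans (sumle N) _; rewrite mulrC ler_wpM2r ?(ltW C0)//.
rewrite -div1r ler_pdivlMr; last by lra.
have -> : (\sum_(j < N) delta ^+ j) * (1 - delta) = 1 - delta ^+ N.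
  elim: N {HN} => [|N IH]; first by rewrite big_ord0 mul0r expr0 subrr.
  by rewrite big_ord_recr/= mulrDl IH exprSr; ring.
by rewrite gerBl exprn_ge0// ltW.
Qed.

End truncated_symbol.

(* [delta x] is the infimum of [d z y + |x - z|] over [F z y] with [y] in [S],
   capped by 1 so that the infimum is over a nonempty set. *)
Section inf_convolution.
Context {R : realType} {V : normedModType R[i]}.
Variables (D S : set V) (F : V -> V -> Prop) (d : V -> V -> R).
Hypothesis d_ge0 : forall z y, F z y -> S y -> 0 <= d z y.
Hypothesis d_gt0 : forall x, D x -> ~ S x -> exists2 c : R, 0 < c &
  \forall z \near x, forall y, F z y -> S y -> c <= d z y.

Let N (v : V) : R := complex.Re `|v|.

Let normE v : `|v| = (N v)%:C.
Proof. by have := normr_ge0 v; rewrite lecE => /andP[/eqP H _]; exact: complexP. Qed.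

Let N_ge0 v : 0 <= N v. Proof. by rewrite -lecR -normE normr_ge0. Qed.

Let N_triangle x z w : N (x - w) <= N (x - z) + N (z - w).
Proof. by rewrite -lecR rmorphD /= -!normE ler_distD. Qed.

Let NB x y : N (x - y) = N (y - x). Proof. by rewrite /N distrC. Qed.

Let A x := [set s | s = 1 \/ exists z y, [/\ F z y, S y & s = d z y + N (x - z)]].

Let A_ge0 x s : A x s -> 0 <= s.
Proof. by move=> [->//|[z [y [Fzy Sy ->]]]]; rewrite addr_ge0// d_ge0. Qed.

Let delta x := inf (A x).

Let has_lbA x : has_lbound (A x). Proof. by exists 0 => s /A_ge0. Qed.

Let A_neq0 x : A x !=set0. Proof. by exists 1; left. Qed.

Let delta_le x s : A x s -> delta x <= s.
Proof. by move=> As; exact: ge_inf. Qed.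

Let delta_ge x c : (forall s, A x s -> c <= s) -> c <= delta x.
Proof. by move=> H; apply: lb_le_inf => // s; exact: H. Qed.

Let delta_lip x z : delta x <= delta z + N (x - z).
Proof.
rewrite -lerBlDr; apply: delta_ge => s As; rewrite lerBlDr.
case: As => [->|[w [y [Fwy Sy ->]]]].
  by apply: le_trans (delta_le _) _; [left; reflexivity|rewrite lerDl].
apply: (@le_trans _ _ (d w y + N (x - w))); first by apply: delta_le; right; exists w, y.
by have := N_triangle x z w; lra.
Qed.

Lemma inf_convolution : exists delta : V -> R, [/\ continuous delta,
  forall x, 0 <= delta x, forall x, D x -> ~ S x -> 0 < delta x &
  forall x y, F x y -> S y -> delta x <= d x y].
Proof.
exists delta; split.
- move=> x; apply/cvgrPdist_lt => e e0.
  have e0C : 0 < e%:C :> R[i] by rewrite ltcR.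
  have /cvgrPdist_lt/(_ _ e0C) : id @ x --> x by exact: cvg_id.
  apply: filterS => z; rewrite normE ltcR => H.
  rewrite ltr_norml; have := delta_lip x z; have := delta_lip z x.
  by rewrite (NB z x); lra.
- by move=> x; apply: delta_ge => s /A_ge0.
- move=> x Dx Sx; have [c c0 H] := d_gt0 Dx Sx.
  have /nbhs_ballP[_ /= /complex_gt0[e e0 ->] He] := H.
  apply: (@lt_le_trans _ _ (Num.min 1 (Num.min c e))); first by rewrite !lt_min ltr01 c0.
  apply: delta_ge => s [->|[z [y [Fzy Sy ->]]]]; first by rewrite ge_min lexx.
  rewrite !ge_min; apply/orP; right; apply/orP.
  (* A point z within e of x falls under the locally uniform lower bound c of d; for any other z the
     penalty alone is at least e. *)
  have [Nz|Nz] := ltP (N (x - z)) e; last by right; have := d_ge0 Fzy Sy; lra.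
  left; have : c <= d z y.
    by apply: He => //; rewrite -ball_normE /ball_/= normE ltcR.
  by have := N_ge0 (x - z); lra.
- move=> x y Fxy Sy; apply: delta_le; right; exists x, y; split => //.
  by rewrite /N subrr normr0 addr0.
Qed.

End inf_convolution.

Lemma fst_continuous (X Y : topologicalType) : continuous (@fst X Y).
Proof. by move=> [x y] A nA; exists (A, setT); [split => //=; exact: filterT|move=> [? ?] []]. Qed.

Lemma snd_continuous (X Y : topologicalType) : continuous (@snd X Y).
Proof. by move=> [x y] A nA; exists (setT, A); [split => //=; exact: filterT|move=> [? ?] []]. Qed.

(** * The operator Pi *)

(** On both sides the exponents add up to (2 / h) (conj P - f - g): the weight at x completes the
    factor exp(-2 Phi(y) / h) of the kernel to an expression symmetric in x and y. *)
Lemma hermitian_weight (R : realType) (c f g h t : R) (P D A : R[i]) :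
  c%:C * cexp ((2 / h)%:C * (conjc P - g%:C)) * conjc D * conjc A * t%:C *
    (expR (- 2 * f / h))%:C =
  conjc (c%:C * cexp ((2 / h)%:C * (P - f%:C)) * D * A * t%:C) * (expR (- 2 * g / h))%:C.
Proof.
have er (s : R) : (expR s)%:C = cexp (s%:C) by rewrite /cexp/= cos0 sin0 mulr1.
have cr (s : R) : conjc (s%:C) = s%:C by rewrite /= oppr0.
have cM (z w : R[i]) : conjc (z * w) = conjc z * conjc w by exact: rmorphM.
rewrite 4!cM -cexp_conjc !er.
transitivity (c%:C * conjc D * conjc A * t%:C *
   (cexp ((2 / h)%:C * (conjc P - g%:C)) * cexp (- 2 * f / h)%:C)); first by ring.
transitivity (c%:C * conjc D * conjc A * t%:C *
   (cexp (conjc ((2 / h)%:C * (P - f%:C))) * cexp (- 2 * g / h)%:C)); last first.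
  by rewrite (cr c) (cr t); ring.
rewrite -!cexpD; congr (_ * cexp _).
by case: P => u v; apply: complexP; rewrite ?ReD ?ImD /= ?ReM ?ImM ?ReB ?ImB /=; ring.
Qed.

Lemma sqr_coord_le_enorm (R : realType) n (v : 'Cn[R]_n) j :
  cabs (v ord0 j) ^+ 2 <= enorm v ^+ 2.
Proof.
rewrite sqr_enorm sqr_cabs (bigD1 j)//= lerDl sumr_ge0// => i _.
by rewrite addr_ge0// sqr_ge0.
Qed.

Section Bergman_operator.
Context {R : realType} {n : nat}.
Local Notation E := ('Cn[R]_n).
Variables (Omega : set E) (Phi : E -> R) (Omega2 : set (E * E)) (psi : E * E -> R[i]).
Variables (a : nat -> E * E -> R[i]) (Cc chi : E * E -> R) (theta : R -> R).
Hypotheses (Omega_open : open Omega) (Omega2_open : open Omega2).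
Hypotheses (Omega2_sub : Omega2 `<=` bidomain Omega) (Omega2_adiag : adiag Omega `<=` Omega2).
Hypothesis Omega2_swap : forall p, Omega2 p -> Omega2 (swap p).
Hypothesis Omega2_proper : proper_projections Omega Omega2.
Hypotheses (psi_hol : holomorphic_on Omega2 psi) (psi_hermitian : hermitian_on Omega2 psi).
Hypothesis psi_adiag : forall x, Omega x -> psi (x, conjv x) = (Phi x)%:C.
Hypothesis psi_equiv : diastasis_equiv Phi psi Omega2.
Hypotheses (a_hol : forall j, holomorphic_on Omega2 (a j))
  (a_hermitian : forall j, hermitian_on Omega2 (a j)).
Hypothesis Cc_cts : forall p, Omega2 p -> {for p, continuous Cc}.
Hypothesis Cc_gt0 : forall p, Omega2 p -> 0 < Cc p.
Hypothesis Cc_sym : forall p, Omega2 p -> Cc (swap p) = Cc p.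
Hypothesis Cc_bound :
  forall j p, Omega2 p -> `|a j p| <= (Cc p ^+ j.+1 * j%:R ^+ j)%:C.
Hypothesis theta_cutoff : is_cutoff theta.
Hypothesis chi_cts : forall p, bidomain Omega p -> {for p, continuous chi}.
Hypothesis chi_sym : forall p, bidomain Omega p -> chi (swap p) = chi p.
Hypothesis chi_supp : bidomain Omega `&`
  closure [set p | bidomain Omega p /\ chi p != 0] `<=` Omega2.
Implicit Types (x y : E) (p : E * E) (h : R).

Let K := Pi_kernel Phi psi a theta Cc chi.
Let F := bidomain Omega `&` closure [set p | bidomain Omega p /\ chi p != 0].
Let d p := Phi p.1 + Phi (conjv p.2) - 2 * complex.Re (psi p).

Let twist_bidomain x y : Omega x -> Omega y -> bidomain Omega (twist (x, y)).
Proof. by move=> Ox Oy; split => //=; rewrite conjvK. Qed.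

(** Phi is the continuous function [psi] composed with x |-> (x, conj x). *)
Lemma weight_continuous x : Omega x -> {for x, continuous Phi}.
Proof.
move=> Ox; have O2x : Omega2 (x, conjv x) by exact: Omega2_adiag.
have cd : (y, conjv y) @[y --> x] --> (x, conjv x).
  move=> B [[B1 B2] /= [nB1 nB2] HB].
  by apply: filterS2 nB1 (conjv_continuous nB2) => y H1 H2; exact: HB.
have cpsi : psi @ (x, conjv x) --> psi (x, conjv x).
  exact/differentiable_continuous/psi_hol.
have H := cvg_Re (nbhs_filter x) (cvg_comp _ _ cd cpsi).
rewrite psi_adiag//= in H; apply: cvg_trans H; apply: near_eq_cvg; first exact: nbhs_filter.
have nO : \forall y \near x, Omega y by exact: open_nbhs_nbhs.
by apply: filterS nO => y Oy; rewrite /= psi_adiag.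
Qed.

Let near_chi0 p : bidomain Omega p -> ~ F p -> \forall q \near p, bidomain Omega q -> chi q = 0.
Proof.
move=> Bp Fp; apply: contrapT => H; apply: Fp; split => // B nB.
apply: contrapT => H'; apply: H; apply: filterS nB => q Bq Oq.
by apply/eqP/negP => /negP chiq; apply: H'; exists q.
Qed.

Let bidomain_open : open (bidomain Omega).
Proof.
rewrite openE => p [H1 H2].
have n1 := @fst_continuous _ _ p _ (open_nbhs_nbhs (conj Omega_open H1)).
have n2 := @snd_continuous _ _ p _ (@conjv_continuous R n _ _ (open_nbhs_nbhs (conj Omega_open H2))).
exact: (@filterS2 _ _ (nbhs_filter p) _ _ _ (fun q => @conj _ _) n1 n2).
Qed.

(** The factors other than the cut-off are controlled on [Omega2] only. At points of the support F,
    which lies in [Omega2], each factor is continuous; at other points [chi] vanishes in a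
    neighbourhood, and the kernel with it. *)
Lemma Pi_kernel_continuous h : 0 < h -> cts_kernel Omega (K h).
Proof.
move=> h0 [x y] [/= Ox Oy]; have Bp := twist_bidomain Ox Oy.
have tw := @twist_continuous R n (x, y).
have FF := nbhs_filter ((x, y) : E * E).
have cst (c : R[i]) : (fun=> c) @ (x, y) --> c by exact: cvg_cst.
have cM (f g : E * E -> R[i]) (l m : R[i]) : f @ (x, y) --> l -> g @ (x, y) --> m ->
    (fun p => f p * g p) @ (x, y) --> l * m by exact: (@cvgM _ _ _ FF).
have cB (f g : E * E -> R[i]) (l m : R[i]) : f @ (x, y) --> l -> g @ (x, y) --> m ->
    (fun p => f p - g p) @ (x, y) --> l - m by exact: (@cvgB _ _ _ _ FF).
have [Fp|Fp] := pselect (F (twist (x, y))).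
  have Wp := chi_supp Fp.
  have c1 : (fun p => psi (twist p)) @ (x, y) --> psi (twist (x, y)).
    exact: (cvg_comp _ _ tw (differentiable_continuous (psi_hol Wp))).
  have c2 : (fun p => (Phi p.2)%:C) @ (x, y) --> (Phi y)%:C.
    apply: (cvg_realC (nbhs_filter (x, y))).
    exact: (cvg_comp _ _ (@snd_continuous _ _ (x, y)) (weight_continuous Oy)).
  have c3 : (fun p => cexp ((2 / h)%:C * (psi (twist p) - (Phi p.2)%:C))) @ (x, y) -->
      cexp ((2 / h)%:C * (psi (twist (x, y)) - (Phi y)%:C)).
    exact: (cvg_comp _ _ (cM _ _ _ _ (cst _) (cB _ _ _ _ c1 c2)) (@cexp_continuous R _)).
  have c4 : (fun p => \det (mixed_hessian psi (twist p))) @ (x, y) -->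
      \det (mixed_hessian psi (twist (x, y))).
    exact: (cvg_comp _ _ tw (det_mixed_hessian_continuous Omega2_open psi_hol Wp)).
  have c5 : (fun p => a_C theta Cc a h (twist p)) @ (x, y) --> a_C theta Cc a h (twist (x, y)).
    exact: (cvg_comp _ _ tw (a_C_continuous a_hol Cc_cts Cc_gt0 theta_cutoff h0 Wp)).
  have c6 : (fun p => (chi (twist p))%:C) @ (x, y) --> (chi (twist (x, y)))%:C.
    by apply: (cvg_realC (nbhs_filter (x, y))); exact: (cvg_comp _ _ tw (chi_cts Bp)).
  exact: (cM _ _ _ _ (cM _ _ _ _ (cM _ _ _ _ (cM _ _ _ _ (cst _) c3) c4) c5) c6).
have n0 := tw _ (near_chi0 Bp Fp).
have nB := tw _ (open_nbhs_nbhs (conj bidomain_open Bp)).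
have H0 : \forall p \near (x, y), K h p.1 p.2 = 0.
  apply: (@filterS2 _ _ FF _ _ _ _ n0 nB) => p H1 H2.
  by rewrite /K /Pi_kernel -/(twist p) (H1 H2) mulr0.
have H := @cvg_near_cst _ _ _ _ _ FF H0.
by rewrite -[X in _ --> X](nbhs_singleton H0) in H.
Qed.

Lemma Pi_kernel_neq0 h x y : Omega x -> Omega y -> K h x y != 0 -> F (twist (x, y)).
Proof.
move=> Ox Oy K0; have Bp := twist_bidomain Ox Oy; split => //; apply: subset_closure; split => //.
apply: contra_neq K0 => chi0.
by rewrite /K /Pi_kernel -/(twist (x, y)) chi0 mulr0.
Qed.

Lemma kernel_supp_Pi h x y : kernel_supp Omega Omega (K h) (x, y) -> F (twist (x, y)).
Proof.
move=> [[/= Ox Oy] cl]; split; first exact: twist_bidomain.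
move=> B /(@twist_continuous R n (x, y)) nB.
have [[z w] [[[/= Oz Ow] K0] Bq]] := cl _ nB.
exists (twist (z, w)); split => //; split; first exact: twist_bidomain.
by apply: contra_neq K0 => chi0; rewrite /K /Pi_kernel -/(twist (z, w)) chi0 mulr0.
Qed.

Let F_closed : bidomain Omega `&` closure F `<=` F.
Proof.
move=> p [Bp Fp]; split => //.
by apply: closed_closure; apply: closureS Fp => q [].
Qed.

Let F_compact1 U : relcompact U Omega -> compact (F `&` [set p | closure U p.1]).
Proof. by move=> [_ cU UO]; exact: (Omega2_proper chi_supp F_closed).1. Qed.

Let F_compact2 U : relcompact U Omega -> compact (F `&` [set p | closure U (conjv p.2)]).
Proof.
move=> [_ cU UO].
have -> : [set p : E * E | closure U (conjv p.2)] = [set p | (conjv @` closure U) p.2].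
  apply/seteqP; split => p /= H; first by exists (conjv p.2); rewrite ?conjvK.
  by case: H => z Uz <-; rewrite conjvK.
apply: (Omega2_proper chi_supp F_closed).2.
  by apply: continuous_compact => //; apply: continuous_subspaceT; exact: conjv_continuous.
by move=> _ [z Uz <-]; rewrite /= conjvK; exact: UO.
Qed.

(** The part of F over the closure of U2 is compact, so its projection to the second factor has a
    relatively compact neighbourhood. F does not involve h, and hence neither does U1. *)
Lemma proper_fst U2 : relcompact U2 Omega -> exists2 U1, relcompact U1 Omega &
  forall x y, U2 x -> F (twist (x, y)) -> U1 y.
Proof.
move=> rU; have cA := F_compact1 rU.
have [] := @relcompact_nbhs R n ((fun p : E * E => conjv p.2) @` (F `&` [set p | closure U2 p.1])) Omega Omega_open.
- apply: continuous_compact => //; apply: continuous_subspaceT => p.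
  exact: (cvg_comp _ _ (@snd_continuous _ _ p) (@conjv_continuous R n p.2)).
- by move=> _ [p [[[_ ?] _] _] <-].
move=> U1 rU1 H; exists U1 => // x y Ux Fxy; apply: H; exists (twist (x, y)).
  by split => //=; exact: subset_closure.
by rewrite /= conjvK.
Qed.

Lemma proper_snd U1 : relcompact U1 Omega -> exists2 U2, relcompact U2 Omega &
  forall x y, U1 y -> F (twist (x, y)) -> U2 x.
Proof.
move=> rU; have cA := F_compact2 rU.
have [] := @relcompact_nbhs R n (fst @` (F `&` [set p | closure U1 (conjv p.2)])) Omega Omega_open.
- by apply: continuous_compact => //; apply: continuous_subspaceT => p; exact: fst_continuous.
- by move=> _ [p [[[? _] _] _] <-].
move=> U2 rU2 H; exists U2 => // x y Uy Fxy; apply: H; exists (twist (x, y)) => //.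
by split => //=; rewrite conjvK; exact: subset_closure.
Qed.

Lemma Pi_properly_supported : uniformly_properly_supported Omega Omega K.
Proof.
exists 1; split; first by rewrite ltr01 lexx.
split=> [U2 /proper_fst|U1 /proper_snd] [U rU HU]; exists U; split; try exact: rU.
  move=> h _ x y Ux /kernel_supp_Pi; exact: HU.
move=> h _ x y Ux /kernel_supp_Pi; exact: HU.
Qed.

Lemma Pi_proper h : proper_kernel Omega (K h) /\ proper_kernel Omega (fun x y => K h y x).
Proof.
split=> U rU.
  have [U1 rU1 H] := proper_fst rU; exists U1 => // x y Ux Oy K0.
  by apply: (H x) => //; apply: (Pi_kernel_neq0 _ Oy K0); case: rU => _ _; apply; exact: subset_closure.
have [U1 rU1 H] := proper_snd rU; exists U1 => // x y Ux Oy K0.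
by apply: (H _ x) => //; apply: (Pi_kernel_neq0 Oy _ K0); case: rU => _ _; apply; exact: subset_closure.
Qed.

Lemma Pi_kernel_hermitian h x y : 0 < h -> Omega x -> Omega y ->
  K h x y * (expR (- 2 * Phi x / h))%:C = conjc (K h y x) * (expR (- 2 * Phi y / h))%:C.
Proof.
move=> h0 Ox Oy; have Bp := twist_bidomain Oy Ox.
have [c0|c0] := eqVneq (chi (twist (y, x))) 0.
  have c0' : chi (twist (x, y)) = 0 by rewrite -twist_swap chi_sym.
  by rewrite /K /Pi_kernel -!/(twist (_, _)) c0 c0' !mulr0 conjc0 !mul0r.
have Wp : Omega2 (twist (y, x)) by apply: chi_supp; split => //; apply: subset_closure.
have sw := twist_swap y x.
have E1 : psi (x, conjv y) = conjc (psi (y, conjv x)).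
  by have := psi_hermitian Wp; rewrite sw.
have E2 : \det (mixed_hessian psi (x, conjv y)) = conjc (\det (mixed_hessian psi (y, conjv x))).
  by have := det_mixed_hessian_swap Omega2_open psi_hol psi_hermitian Omega2_swap Wp; rewrite sw.
have E3 : a_C theta Cc a h (x, conjv y) = conjc (a_C theta Cc a h (y, conjv x)).
  by have := a_C_hermitian Cc_gt0 theta_cutoff h0 Omega2_swap Cc_sym a_hermitian Wp; rewrite sw.
have E4 : chi (x, conjv y) = chi (y, conjv x) by have := chi_sym Bp; rewrite sw.
rewrite /K /Pi_kernel /Brg_kernel.
rewrite E4 E3 E1; move: E2; generalize (mixed_hessian psi) => M E2; rewrite E2.
exact: hermitian_weight.
Qed.

Let d_equiv U : relcompact U Omega -> exists2 M : R, 0 < M & forall x y,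
  closure U x -> F (twist (x, y)) -> M^-1 * enorm (x - y) ^+ 2 <= d (twist (x, y)).
Proof.
move=> rU; have AO : F `&` [set p | closure U p.1] `<=` Omega2 by move=> p [/chi_supp].
have [M [M0 H]] := psi_equiv (F_compact1 rU) AO.
exists M => // x y Ux Fxy.
have [+ _] := H (twist (x, y)) (conj Fxy Ux).
by rewrite /d /twist/= conjvK.
Qed.

Lemma Pi_kernel_bound S (delta : E -> R) U2 : S `<=` Omega ->
  (forall x y, F (twist (x, y)) -> S y -> delta x <= d (twist (x, y)) / 2) ->
  relcompact U2 Omega -> exists C s : R, [/\ 0 < C, 0 < s &
    forall h x y, 0 < h <= 1 -> U2 x -> S y -> cabs (K h x y) <=
      C / h ^+ n * expR ((Phi x - delta x - Phi y) / h) *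
      expR (- enorm (x - y) ^+ 2 / (s * h))].
Proof.
move=> SO Hdelta rU; have cA := F_compact1 rU.
set A := F `&` _ in cA; have AO p : A p -> Omega2 p by case=> Fp _; exact: chi_supp.
have [M M0 HM] := d_equiv rU.
have [B1 B10 HB1] := cts_bounded cA (fun p Ap => cvg_cabs (nbhs_filter p)
  (det_mixed_hessian_continuous Omega2_open psi_hol (AO p Ap))).
have [B2 B20 HB2] := cts_bounded cA (fun p Ap => Cc_cts (AO p Ap)).
have [B3 B30 HB3] := cts_bounded cA (fun p Ap => chi_cts (Omega2_sub (AO p Ap))).
have [B B0 HB] := a_C_bounded Cc_gt0 theta_cutoff Cc_bound.
have c0 : 0 < 2 ^+ n / pi ^+ n :> R by rewrite divr_gt0 ?exprn_gt0// pi_gt0.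
have C0 := mulr_gt0 (mulr_gt0 (mulr_gt0 c0 B10) (mulr_gt0 B0 B20)) B30.
(* C collects the normalization without its h^-n and the bounds for the Hessian determinant, the
   symbol and the cut-off on the compact set A. The width 2 M comes from the half of d not spent on
   [delta], which is at least |x - y|^2 / (2 M). *)
exists (2 ^+ n / pi ^+ n * B1 * (B * B2) * B3), (2 * M); split.
- exact: C0.
- by rewrite mulr_gt0.
move=> h x y /andP[h0 _] Ux Sy.
have Oy := SO _ Sy; have Ox : Omega x by case: rU => _ _; apply; exact: subset_closure.
have hn : 0 < h ^+ n by rewrite exprn_gt0.
have [->|K0] := eqVneq (K h x y) 0.
  by rewrite Normc.normc0 mulr_ge0 ?expR_ge0// mulr_ge0 ?expR_ge0// ltW// divr_gt0.
have Fp := Pi_kernel_neq0 Ox Oy K0.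
have Ap : A (twist (x, y)) by split => //=; exact: subset_closure.
have Dd := Hdelta _ _ Fp Sy; have DM := HM x y (subset_closure Ux) Fp.
have X1 := HB1 _ Ap; have X2 := HB2 _ Ap; have X3 := HB3 _ Ap.
have X4 := HB h _ h0 (AO _ Ap).
rewrite (ger0_norm (cabs_ge0 _)) in X1; rewrite (gtr0_norm (Cc_gt0 (AO _ Ap))) in X2.
have {X2}X4 : cabs (a_C theta Cc a h (x, conjv y)) <= B * B2.
  by apply: le_trans X4 _; rewrite ler_pM2l.
have X5 : cabs (cexp ((2 / h)%:C * (psi (x, conjv y) - (Phi y)%:C))) <=
    expR ((Phi x - delta x - Phi y) / h) * expR (- enorm (x - y) ^+ 2 / (2 * M * h)).
  rewrite cabs_cexp -expRD ler_expR.
  have -> : - enorm (x - y) ^+ 2 / (2 * M * h) = - (M^-1 * enorm (x - y) ^+ 2 / 2) / h.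
    by field; rewrite !lt0r_neq0.
  have -> : complex.Re ((2 / h)%:C * (psi (x, conjv y) - (Phi y)%:C)) =
      (Phi x - Phi y - d (twist (x, y))) / h.
    rewrite ReM ReB /= /d /= conjvK.
    by rewrite mul0r subr0; field; rewrite lt0r_neq0.
  rewrite -mulrDl ler_pM2r ?invr_gt0//; lra.
rewrite {1}/K /Pi_kernel /Brg_kernel 4!cabsM !cabs_real.
have -> : `|2 ^+ n / (pi * h) ^+ n| = 2 ^+ n / pi ^+ n / h ^+ n :> R.
  rewrite ger0_norm; last by rewrite divr_ge0 ?exprn_ge0// mulr_ge0 ?pi_ge0 ?ltW.
  by rewrite exprMn invfM mulrA.
have -> : 2 ^+ n / pi ^+ n * B1 * (B * B2) * B3 / h ^+ n *
    expR ((Phi x - delta x - Phi y) / h) * expR (- enorm (x - y) ^+ 2 / (2 * M * h)) =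
  2 ^+ n / pi ^+ n / h ^+ n * (expR ((Phi x - delta x - Phi y) / h) *
    expR (- enorm (x - y) ^+ 2 / (2 * M * h))) * B1 * (B * B2) * B3 by ring.
have cn0 : 0 <= 2 ^+ n / pi ^+ n / h ^+ n :> R by rewrite ltW// divr_gt0.
have P z := cabs_ge0 (R := R) z.
apply: ler_pM (mulr_ge0 (mulr_ge0 (mulr_ge0 cn0 (P _)) (P _)) (P _)) (normr_ge0 _) _ X3.
apply: ler_pM (mulr_ge0 (mulr_ge0 cn0 (P _)) (P _)) (P _) _ X4.
apply: ler_pM (mulr_ge0 cn0 (P _)) (P _) _ X1.
by rewrite ler_wpM2l.
Qed.

(** The lower half of the diastasis comparison gives the two hypotheses of [inf_convolution]: D is
    nonnegative on F, and near a point off the closed set S it is bounded below, because nearby z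
    stay away from S and one constant M serves for all of them. *)
Lemma diastasis_gap S : S `<=` Omega -> Omega `&` closure S `<=` S ->
  exists delta : E -> R, [/\ continuous delta, forall x, 0 <= delta x,
    forall x, Omega x -> ~ S x -> 0 < delta x &
    forall x y, F (twist (x, y)) -> S y -> delta x <= d (twist (x, y)) / 2].
Proof.
move=> SO Scl; apply: (@inf_convolution R E Omega S (fun x y => F (twist (x, y)))
  (fun x y => d (twist (x, y)) / 2)) => [x y Fxy Sy|x Ox Sx].
  have [[/= Ox _] _] := Fxy.
  have [U rU Ux] := relcompact_point Omega_open Ox.
  have [M M0 HM] := d_equiv rU; have := HM x y (subset_closure Ux) Fxy.
  have : 0 <= M^-1 * enorm (x - y) ^+ 2 by rewrite mulr_ge0 ?sqr_ge0// invr_ge0 ltW.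
  by lra.
have [e e0 He] : exists2 e : R, 0 < e & forall y, S y -> exists j, e <= cabs (y ord0 j - x ord0 j).
  have : ~ closure S x by move=> H; apply: Sx; exact: Scl.
  move=> /existsNP[B /not_implyP[/nbhs_CnP[e e0 eB] SB]]; exists e => // y Sy.
  apply: contrapT => /forallNP H; apply: SB; exists y; split => //; apply: eB => j.
  by rewrite ltNge; apply/negP/H.
have [U rU Ux] := relcompact_point Omega_open Ox.
have [M M0 HM] := d_equiv rU.
(* If x is at distance e from S in the maximum norm, every z within e / 2 of x has |z - y| >= e / 2
   for y in S. The last division by 2 is the half of the diastasis used as cost. *)
exists (M^-1 * (e / 2) ^+ 2 / 2).
  by rewrite !mulr_gt0 ?invr_gt0// exprn_gt0// divr_gt0.
have nU : nbhs x U by apply: open_nbhs_nbhs; split => //; case: rU.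
have nz : nbhs x [set z : E | forall j, cabs (z ord0 j - x ord0 j) < e / 2].
  by apply/nbhs_CnP; exists (e / 2) => //; lra.
apply: (@filterS2 _ _ (nbhs_filter x) _ _ _ _ nU nz) => z Uz xz y Fzy Sy.
rewrite ler_pM2r; last by lra.
apply: le_trans (HM z y (subset_closure Uz) Fzy); rewrite ler_pM2l ?invr_gt0//.
have [j ej] := He y Sy; apply: le_trans (sqr_coord_le_enorm (z - y) j).
apply: lerXn2r; rewrite ?nnegrE ?cabs_ge0//; first by lra.
have T := cabsD (y ord0 j - z ord0 j) (z ord0 j - x ord0 j); rewrite subrKA in T.
by rewrite !mxE cabsB; have := xz j; lra.
Qed.

Let Pi := Pi_op Omega Phi psi a theta Cc chi.

Lemma Pi_uniformly_continuous_gap S (delta : E -> R) : S `<=` Omega -> continuous delta ->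
  (forall x y, F (twist (x, y)) -> S y -> delta x <= d (twist (x, y)) / 2) ->
  uniformly_continuous Omega Phi (L2loc_supp Omega S) Omega (fun x => Phi x - delta x) Pi.
Proof.
move=> SO cdelta Hdelta; apply: kernel_uniformly_continuous => //.
- exact: weight_continuous.
- by move=> x Ox; exact: (cvgB (weight_continuous Ox) (cdelta x)).
- by move=> h /andP[h0 _]; exact: Pi_kernel_continuous.
- move=> U2 rU; have [U1 rU1 H] := proper_fst rU.
  exists U1 => // h x y _ Ux Oy Kxy; apply: (H x) => //.
  apply: (Pi_kernel_neq0 _ Oy Kxy).
  by case: rU => _ _; apply; exact: subset_closure.
- by move=> U2 rU; exact: Pi_kernel_bound.
Qed.

Lemma Pi_uniformly_continuous : uniformly_continuous Omega Phi (L2loc Omega) Omega Phi Pi.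
Proof.
have LE : L2loc Omega = L2loc_supp Omega Omega.
  by apply/seteqP; split => [u Lu|u []//]; split => // x [].
have SO : Omega `<=` Omega by [].
(* Continuity without gain is the case S = Omega with gap 0. The inequality 0 <= D / 2 it requires
   is read off from 0 <= delta <= D / 2. *)
have [delta [_ delta0 _ Hd]] := diastasis_gap SO (fun x => @proj1 _ _).
have c0 : continuous ((fun=> 0) : E -> R) by apply: cst_continuous.
have := Pi_uniformly_continuous_gap SO c0 (fun x y Fxy Oy => le_trans (delta0 x) (Hd x y Fxy Oy)).
rewrite LE (_ : (fun x => Phi x - 0) = Phi)//.
by apply/funext => x; rewrite subr0.
Qed.

Lemma Pi_localized S : S `<=` Omega -> Omega `&` closure S `<=` S ->
  exists Phi2 : E -> R, [/\ forall x, Omega x -> {for x, continuous Phi2},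
    forall x, Omega x -> Phi2 x <= Phi x, forall x, (Omega `\` S) x -> Phi2 x < Phi x &
    uniformly_continuous Omega Phi (L2loc_supp Omega S) Omega Phi2 Pi].
Proof.
move=> SO Scl; have [delta [delta_cts delta0 delta_gt0 Hd]] := diastasis_gap SO Scl.
exists (fun x => Phi x - delta x); split.
- by move=> x Ox; exact: (cvgB (weight_continuous Ox) (delta_cts x)).
- by move=> x _; rewrite gerBl.
- by move=> x [Ox Sx]; rewrite gtrBl delta_gt0.
- exact: Pi_uniformly_continuous_gap.
Qed.

Lemma Pi_self_adjoint : formal_adjoint Omega Phi Pi Pi.
Proof.
apply: kernel_formal_adjoint => //.
- exact: weight_continuous.
- by move=> h /andP[h0 _]; exact: Pi_kernel_continuous.
- by move=> h _; exact: (Pi_proper h).1.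
- by move=> h _; exact: (Pi_proper h).2.
- by move=> h x y /andP[h0 _]; exact: Pi_kernel_hermitian.
Qed.

End Bergman_operator.

Theorem proposition4p9 (R : realType) (n : nat)
    (Omega : set 'Cn[R]_n) (Phi : 'Cn[R]_n -> R)
    (Omega_open : open Omega)
    (Phi_analytic : forall x, Omega x -> real_analytic_at Phi x)
    (Phi_spsh : strictly_psh_on Omega Phi)
    (Omega2 : set ('Cn[R]_n * 'Cn[R]_n))
    (Omega2_open : open Omega2)
    (Omega2_sub : Omega2 `<=` bidomain Omega)
    (Omega2_adiag : adiag Omega `<=` Omega2)
    (Omega2_swap : forall p, Omega2 p -> Omega2 (swap p))
    (Omega2_proper : proper_projections Omega Omega2)
    (psi : 'Cn[R]_n * 'Cn[R]_n -> R[i])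
    (psi_hol : holomorphic_on Omega2 psi)
    (psi_adiag : forall x, Omega x -> psi (x, conjv x) = (Phi x)%:C)
    (psi_hermitian : hermitian_on Omega2 psi)
    (psi_equiv : diastasis_equiv Phi psi Omega2)
    (a : nat -> 'Cn[R]_n * 'Cn[R]_n -> R[i])
    (a_symbol : formal_analytic_symbol Omega2 a)
    (a_identity : Brg_inverts_identity Omega Phi psi Omega2 a)
    (a_hermitian : forall j, hermitian_on Omega2 (a j))
    (Cc : 'Cn[R]_n * 'Cn[R]_n -> R)
    (Cc_smooth : smooth_on Omega2 Cc)
    (Cc_gt0 : forall p, Omega2 p -> 0 < Cc p)
    (Cc_sym : forall p, Omega2 p -> Cc (swap p) = Cc p)
    (Cc_bound : forall j p, Omega2 p ->
       `|a j p| <= (Cc p ^+ j.+1 * j%:R ^+ j)%:C)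
    (theta : R -> R) (theta_cutoff : is_cutoff theta)
    (chi : 'Cn[R]_n * 'Cn[R]_n -> R)
    (chi_smooth : smooth_on (bidomain Omega) chi)
    (chi_sym : forall p, bidomain Omega p -> chi (swap p) = chi p)
    (chi_supp : bidomain Omega `&`
       closure [set p | bidomain Omega p /\ chi p != 0] `<=` Omega2)
    (chi_adiag : exists W : set ('Cn[R]_n * 'Cn[R]_n),
       [/\ open W, adiag Omega `<=` W &
           forall p, W p -> bidomain Omega p -> chi p = 1]) :
  let Pi := Pi_op Omega Phi psi a theta Cc chi in
  [/\ uniformly_properly_supported Omega Omega
        (Pi_kernel Phi psi a theta Cc chi) /\
      uniformly_continuous Omega Phi (L2loc Omega) Omega Phi Pi,
      formal_adjoint Omega Phi Pi Pi &
      forall K : set 'Cn[R]_n, K `<=` Omega -> Omega `&` closure K `<=` K ->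
      exists Phi2 : 'Cn[R]_n -> R,
        [/\ forall x, Omega x -> {for x, continuous Phi2},
            forall x, Omega x -> Phi2 x <= Phi x,
            forall x, (Omega `\` K) x -> Phi2 x < Phi x &
            uniformly_continuous Omega Phi (L2loc_supp Omega K)
              Omega Phi2 Pi]].
Proof.
have [a_hol _] := a_symbol.
have Cc_cts p : Omega2 p -> {for p, continuous Cc} := (Cc_smooth 0%N).1 p.
have chi_cts p : bidomain Omega p -> {for p, continuous chi} := (chi_smooth 0%N).1 p.
split; [split| |].
- exact: (Pi_properly_supported Phi psi a Cc theta Omega_open Omega2_proper chi_supp).
- exact: (Pi_uniformly_continuous Omega_open Omega2_open Omega2_sub Omega2_adiag Omega2_proper
    psi_hol psi_adiag psi_equiv a_hol Cc_cts Cc_gt0 Cc_bound theta_cutoff chi_cts chi_supp).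
- exact: (Pi_self_adjoint Omega_open Omega2_open Omega2_adiag Omega2_swap Omega2_proper
    psi_hol psi_hermitian psi_adiag a_hol a_hermitian Cc_cts Cc_gt0 Cc_sym theta_cutoff
    chi_cts chi_sym chi_supp).
- exact: (Pi_localized Omega_open Omega2_open Omega2_sub Omega2_adiag Omega2_proper
    psi_hol psi_adiag psi_equiv a_hol Cc_cts Cc_gt0 Cc_bound theta_cutoff chi_cts chi_supp).
Qed.
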